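(* Let $\mathscr{P}\subseteq\{2,3,\dots\}$ with $|\mathscr{P}|\ge 2$, let $\mathcal{P}(s)=\sum_{n\in\mathscr{P}} n^{-s}$ have abscissa of convergence $\kappa$, and assume $1<\mathcal{P}(\kappa)\le\infty$ (so that there exists a unique real $\rho>\max\{\kappa,0\}$ with $\mathcal{P}(\rho)=1$). Let \[ \mu := -\frac{1}{\mathcal{P}'(\rho)},\qquad \sigma^2:=\mu^3\mathcal{P}''(\rho)-\mu . \] Then, as $N\to\infty$, \[ \frac{Y_N-\mu\log N}{\sigma\sqrt{\log N}}\ \stackrel{d}{\to}\ \mathscr{N}(0,1), \] where $\stackrel{d}{\to}$ denotes convergence in distribution and $\mathscr{N}(0,1)$ is the standard normal distribution. Moreover, $\mathbb{E}(Y_N)\sim\mu\log N$ and $\mathrm{Var}(Y_N)\sim\sigma^2\log N$.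
   Context: For a fixed set $\mathscr{P}\subseteq\{2,3,\dots\}$, an ordered factorization of a positive integer $n$ (over $\mathscr{P}$) is a finite ordered sequence $(n_1,\dots,n_k)$, $k\ge 0$, of elements of $\mathscr{P}$ with $n_1\cdots n_k=n$; $a(n)$ denotes the number of such factorizations of $n$ (so $a(1)=1$, the empty factorization). Let $A(N)=\sum_{1\le n\le N}a(n)$. $Y_N$ is the random variable equal to the number of factors $k$ in a factorization chosen uniformly at random among all $A(N)$ ordered factorizations of all integers $n\le N$. The abscissa of convergence $\kappa$ of $\mathcal{P}(s)$ satisfies $\kappa=-\infty$ if $\mathscr{P}$ is finite and $0\le\kappa\le1$ otherwise; $\mathcal{P}(\kappa)$ denotes $\lim_{s\to\kappa^+}\mathcal{P}(s)$ over real $s$ (a value in $[0,\infty]$; it is $\infty$ when $\kappa=-\infty$ and $|\mathscr{P}|\ge1$). *)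

(* Defs.v *)
From HB Require Import structures.
From mathcomp Require Import all_boot all_order all_algebra finmap.
From mathcomp Require Import all_classical all_reals all_analysis.

Set Implicit Arguments.
Unset Strict Implicit.
Unset Printing Implicit Defensive.

Import Order.TTheory GRing.Theory Num.Theory.
Import numFieldNormedType.Exports.

Local Open Scope classical_set_scope.
Local Open Scope ring_scope.

Section dirichlet_series.
Context {R : realType}.
Local Open Scope ereal_scope.

(* The terms are nonnegative, so the value is +oo exactly on divergence. *)
Definition dirichlet (P : set nat) (s : R) : \bar R :=
  \esum_(n in P) (n%:R `^ (- s))%:E.

(* As the coefficients are nonnegative, real arguments suffice to determine the
   abscissa; it is -oo when the series converges for every s. *)
Definition abscissa (P : set nat) : \bar R :=
  ereal_inf (EFin @` [set s : R | dirichlet P s < +oo]).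

(* The limit of the series at its abscissa, from the right, in [0, +oo]. The
   last case means that the series diverges everywhere, which is impossible for
   P included in {2, 3, ...}. *)
Definition dirichlet_at_abscissa (P : set nat) : \bar R :=
  match abscissa P with
  | k%:E => lim (dirichlet P s @[s --> k^'+])
  | -oo => lim (dirichlet P s @[s --> -oo%R])
  | +oo => +oo
  end.

(* Meaningful for s > abscissa P. *)
Definition dirichlet_fun (P : set nat) : R -> R := fun s => fine (dirichlet P s).

Definition is_growth_exponent (P : set nat) (rho : R) : Prop :=
  maxe (abscissa P) 0 < rho%:E /\ dirichlet P rho = 1.

End dirichlet_series.

Section constants.
Context {R : realType}.
Variables (P : set nat) (rho : R).

Definition mean_coef : R := - ((dirichlet_fun P)^`()%classic rho)^-1.

Definition variance_coef : R :=
  mean_coef ^+ 3 * (dirichlet_fun P)^`(2)%classic rho - mean_coef.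

End constants.

(* The sample space: finite sequences of natural numbers, all events being
   measurable. *)
Definition factors := seq nat.

HB.instance Definition _ := Choice.on factors.
HB.instance Definition _ := isPointed.Build factors [::].
HB.instance Definition _ := @isMeasurable.Build default_measure_display
  factors discrete_measurable discrete_measurable0
  discrete_measurableC discrete_measurableU.

Definition ordered_factorization (P : set nat) (n : nat) : set factors :=
  [set s | (forall m, m \in (s : seq nat) -> P m) /\ (\prod_(m <- s) m)%N = n].

(* The union is disjoint: a sequence determines its product. *)
Definition factorizations_upto (P : set nat) (N : nat) : set factors :=
  \bigcup_(n in [set n | (1 <= n <= N)%N]) ordered_factorization P n.

Lemma measurable_factorizations_upto (P : set nat) (N : nat) :
  measurable (factorizations_upto P N).
Proof. by []. Qed.

Section uniform_factorization.
Context (R : realType).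

(* Uniform probability on factorizations_upto P N, which is finite, and nonempty
   for N >= 1; the Dirac mass is only used for N = 0. *)
Definition uniform_factorization (P : set nat) (N : nat) :
    probability factors R :=
  mnormalize (mrestr counting (measurable_factorizations_upto P N))
    (dirac ([::] : factors)).

Definition nb_factors (s : factors) : R := (size s)%:R.

Definition standardized_nb_factors (mu sigma : R) (N : nat) (s : factors) : R :=
  (nb_factors s - mu * ln N%:R) / (sigma * Num.sqrt (ln N%:R)).

Let measurable_standardized mu sigma N :
  measurable_fun [set: factors] (standardized_nb_factors mu sigma N).
Proof. by []. Qed.

HB.instance Definition _ mu sigma N :=
  isMeasurableFun.Build _ _ _ _ (standardized_nb_factors mu sigma N)
    (measurable_standardized mu sigma N).

End uniform_factorization.

(* Each X_ n lives on its own probability space (T, Pr_ n). *)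
Definition cvg_in_distribution (d : measure_display) (T : measurableType d)
    (R : realType) (Pr_ : nat -> probability T R)
    (X_ : forall n, {RV (Pr_ n) >-> R})
    (nu : probability (measurableTypeR R) R) : Prop :=
  forall x : R, {for x, continuous (fun y : R => nu `]-oo, y]%classic)} ->
    cdf (X_ n) x @[n --> \oo] --> nu `]-oo, x]%classic.

(* Main.v *)
Require Import Defs.
From HB Require Import structures.
From mathcomp Require Import all_boot all_order all_algebra finmap.
From mathcomp Require Import all_classical all_reals all_analysis.
From mathcomp Require Import ring lra.

Set Implicit Arguments.
Unset Strict Implicit.
Unset Printing Implicit Defensive.

Import Order.TTheory GRing.Theory Num.Theory.
Import numFieldNormedType.Exports.

Local Open Scope classical_set_scope.
Local Open Scope ring_scope.

(* Giving [ln p] the probability [p^(- rho)], p in P, turns the sequences of k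
   elements of P with product at most [e^z] into a random walk [S_k] with
   positive steps: their number is [e^(rho z) walk k z], where [walk k z] is the
   expectation of [e^(- rho (z - S_k))] on [S_k <= z]. Hence [Y_N] has weights
   proportional to [walk k z] at [z = ln N], and every sum
   [u z = \sum_k f k * walk k z] satisfies a renewal equation. A maximum
   principle with an explicit barrier bounds the solutions of that equation; it
   first gives that the total mass is bounded, almost convex along each step,
   hence asymptotically invariant under shifts and asymptotically constant in
   the needed averaged sense. It then compares [\sum_k v 0 ((k - z / m1) / s)
   walk k z], with [s^2 = z], to a solution [v] of the heat equation
   [v_t = (sigma^2 / 2) v_yy]: by a second order expansion the rescaled solution
   satisfies the renewal equation up to negligible terms. Taking for [v] the
   Gaussian distribution functions gives the central limit theorem, and
   trigonometric functions of small frequency give the first two moments. The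
   derivatives of the Dirichlet series at [rho] are the moments of the steps. *)

(** When all elements of [P] are powers of one integer, the steps lie on a lattice and the total
    mass oscillates without a limit. No limit is therefore ever used: for each target position L the
    constant in the comparison is the mass at L itself, only positions z for which L - z is an
    asymptotically invariant shift are visited, and the constant cancels on dividing by the mass.
    Lattice and non-lattice cases are thus treated alike. The steps are unbounded, so a step from
    above a threshold may land anywhere below it, even below 0, and a barrier has to dominate on a
    whole half-line. As [rho] lies strictly to the right of the abscissa, the steps have exponential
    moments up to some order 4 theta: the squared barrier uses the orders theta and 2 theta, and its
    tilted version in [walk_sum_exp_le] the order 4 theta. Convergence in distribution does not give
    the moments; the uniform integrability they require comes from [walk_sum_exp_le]. *)

(** Along a progression of step l the increments are nearly nondecreasing. An increment above e
    stays above e / 2 for m steps, one below - e was below - e / 2 during the m previous steps, and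
    either would move w by more than C. *)
Lemma almost_convex_shift (R : realType) (w : R -> R) (C l : R) : 0 < l ->
  (forall z, 0 <= w z <= C) ->
  (forall e : R, 0 < e -> exists T : R, forall z : R, T <= z ->
     - e <= w z - 2 * w (z - l) + w (z - l - l)) ->
  forall e : R, 0 < e -> exists T : R, forall z : R, T <= z -> `|w z - w (z - l)| <= e.
Proof.
move=> l0 wC cvx e e0; pose d z := w z - w (z - l).
(* m increments of size e / 2 exceed C; the tolerance eta = e / (2 m) loses at most e / 2 over m
   steps. *)
pose m := (Num.truncn (2 * C / e)).+1.
have m0 : (0 : R) < m%:R by rewrite ltr0n.
have mC : C < m%:R * (e / 2).
  have : 2 * C / e < m%:R by exact: truncnS_gt.
  rewrite ltr_pdivrMr//; lra.
have [T HT] := cvx (e / (2 * m%:R)) (divr_gt0 e0 (mulr_gt0 (ltr0Sn _ 1) m0)).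
set eta := e / _ in HT.
have etaE : m%:R * eta = e / 2 by rewrite /eta; field; rewrite gt_eqF.
have eta0 : 0 < eta by rewrite divr_gt0// mulr_gt0.
have dstep z : T <= z -> d (z - l) - eta <= d z by move=> /HT; rewrite /d; lra.
have up z j : T <= z -> d z - j%:R * eta <= d (z + j%:R * l).
  move=> Tz; elim: j => [|j IH]; first by rewrite !mul0r addr0 subr0.
  have := dstep (z + j.+1%:R * l).
  have -> : z + j.+1%:R * l - l = z + j%:R * l by rewrite -natr1; ring.
  have jl : 0 <= j.+1%:R * l by rewrite mulr_ge0// ltW.
  move=> h; have {}h : d (z + j%:R * l) - eta <= d (z + j.+1%:R * l).
    by apply: h; rewrite (le_trans Tz)// lerDl.
  rewrite -[in leLHS]natr1 mulrDl mul1r; lra.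
have tel z j : w (z + j%:R * l) - w z = \sum_(0 <= i < j) d (z + i.+1%:R * l).
  elim: j => [|j IH]; first by rewrite big_geq// mul0r addr0 subrr.
  rewrite big_nat_recr//= -IH /d.
  have -> : z + j.+1%:R * l - l = z + j%:R * l by rewrite -natr1; ring.
  by ring.
have le_m (j : nat) : (j <= m)%N -> j%:R * eta <= e / 2.
  by move=> jm; rewrite -etaE ler_pM2r// ler_nat.
(* The extra m l leaves room to look m steps back. *)
exists (T + m%:R * l) => z Tz; rewrite -/(d z).
have ml : 0 <= m%:R * l by rewrite mulr_ge0// ltW.
rewrite ler_norml; apply/andP; split; rewrite leNgt; apply/negP => dz.
- pose y := z - m%:R * l.
  have : \sum_(0 <= i < m) d (y + i.+1%:R * l) <= \sum_(0 <= i < m) (- (e / 2)).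
    rewrite !big_nat; apply: ler_sum => i /andP[_ im].
    have := up (y + i.+1%:R * l) (m - i.+1)%N.
    have -> : y + i.+1%:R * l + (m - i.+1)%:R * l = z.
      by rewrite natrB// /y; ring.
    have il : 0 <= i.+1%:R * l by rewrite mulr_ge0// ltW.
    move=> h; have {}h : d (y + i.+1%:R * l) - (m - i.+1)%:R * eta <= d z.
      by apply: h; rewrite (@le_trans _ _ y)// ?lerDl// lerBrDr.
    have := le_m (m - i.+1)%N (leq_subr _ _); lra.
  rewrite -tel sumr_const_nat subn0 -(mulr_natl (- (e / 2))).
  have /andP[] := wC (y + m%:R * l); have /andP[] := wC y; lra.
- have : \sum_(0 <= i < m) (e / 2) <= \sum_(0 <= i < m) d (z + i.+1%:R * l).
    rewrite !big_nat; apply: ler_sum => i /andP[_ im].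
    have := up z i.+1; have := le_m i.+1 im => h1 h2.
    have : d z - i.+1%:R * eta <= d (z + i.+1%:R * l) by apply: h2; rewrite (le_trans _ Tz)// lerDl.
    lra.
  rewrite -tel sumr_const_nat subn0 -(mulr_natl (e / 2)).
  have /andP[] := wC (z + m%:R * l); have /andP[] := wC z; lra.
Qed.

Lemma expR_sub1Dx_ge0_le (R : realType) (u : R) :
  expR u <= 1 + u + u ^+ 2 * expR `|u|.
Proof.
have h1 : expR u - 1 <= u * expR u.
  have := expR_ge1Dx (- u); rewrite expRN => /(ler_wpM2r (expR_ge0 u)).
  rewrite mulVf ?gt_eqF ?expR_gt0//; lra.
have h2 := expR_ge1Dx u.
have [u0|u0] := leP 0 u.
  rewrite ger0_norm//; have := ler_wpM2l u0 h1; rewrite mulrA -expr2; lra.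
rewrite ltr0_norm//.
have : u * (expR u - 1) <= u * u by rewrite ler_wnM2l//; lra.
have e1 : 1 <= expR (- u) by rewrite -expR0 ler_expR; lra.
have : u ^+ 2 * 1 <= u ^+ 2 * expR (- u) by rewrite ler_wpM2l ?sqr_ge0.
rewrite mulr1 -expr2; lra.
Qed.

(** Absorbs polynomial moments into an exponential one: take n-th roots and use 1 + u <= e^u with u
    = theta x / n. *)
Lemma pow_le_expR (R : realType) (n : nat) (a theta x : R) :
  0 <= a -> 0 < theta -> 0 <= x -> (0 < n)%N ->
  (1 + a * x) ^+ n <= (1 + n%:R * a / theta) ^+ n * expR (theta * x).
Proof.
move=> a0 t0 x0 n0; have n0' : (0 : R) < n%:R by rewrite ltr0n.
have -> : theta * x = n%:R * (theta * x / n%:R) by field; rewrite gt_eqF.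
have na0 : 0 <= n%:R * a / theta by rewrite divr_ge0 ?mulr_ge0// ltW.
have nx0 : 0 <= theta * x / n%:R by rewrite divr_ge0 ?mulr_ge0// ltW.
rewrite expRM_natl -exprMn; apply: lerXn2r.
- by rewrite nnegrE addr_ge0// mulr_ge0.
- by rewrite nnegrE mulr_ge0 ?expR_ge0// addr_ge0.
apply: (@le_trans _ _ ((1 + n%:R * a / theta) * (1 + theta * x / n%:R))); last first.
  by rewrite ler_wpM2l ?expR_ge1Dx// addr_ge0.
have -> : (1 + n%:R * a / theta) * (1 + theta * x / n%:R) =
  1 + a * x + (n%:R * a / theta + theta * x / n%:R) by field; rewrite !gt_eqF.
by rewrite lerDl addr_ge0.
Qed.

(** * Taylor estimates from bounds on derivatives *)

Section derivatives.
Context {R : realType}.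
Implicit Types (f g : R -> R) (x a b : R).

Lemma is_deriveM_pt f g x a b : is_derive x 1 f a -> is_derive x 1 g b ->
  is_derive x 1 (fun y => f y * g y) (a * g x + f x * b).
Proof.
move=> df dg; apply: is_derive_eq.
by rewrite addrC /GRing.scale/= [g x * _]mulrC.
Qed.

Lemma is_deriveD_pt f g x a b : is_derive x 1 f a -> is_derive x 1 g b ->
  is_derive x 1 (fun y => f y + g y) (a + b).
Proof. by move=> df dg; apply: is_deriveD. Qed.

Lemma is_derive_cst_pt (c x : R) : is_derive x 1 (fun _ : R => c) 0.
Proof. exact: is_derive_cst. Qed.

Lemma derive_eq f x a b : is_derive x 1 f a -> a = b -> is_derive x 1 f b.
Proof. by move=> + <-. Qed.

Lemma is_derive_affine a b x : is_derive x 1 (fun y => a * y + b) a.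
Proof.
have -> : a = a * 1 + 0 by rewrite mulr1 addr0.
apply: is_deriveD_pt.
have := @is_deriveM_pt (cst a) id x 0 1 (is_derive_cst _ _ _) (is_derive_id _ _).
by rewrite mul0r add0r !mulr1 addr0.
Qed.

Lemma is_derive_comp_pt f g x a b : is_derive x 1 g b -> is_derive (g x) 1 f a ->
  is_derive x 1 (fun y => f (g y)) (a * b).
Proof.
move=> dg df; have := @is_derive1_comp _ f g x a b df dg.
by rewrite mulrC.
Qed.

Lemma is_derive_continuous f x a : is_derive x 1 f a -> {for x, continuous f}.
Proof. by move=> df; apply/differentiable_continuous/derivable1_diffP. Qed.

Lemma MVT_norm f (df : R -> R) (M s t : R) :
  (forall y, Num.min s t <= y <= Num.max s t -> is_derive y 1 f (df y)) ->
  (forall y, Num.min s t <= y <= Num.max s t -> `|df y| <= M) ->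
  `|f t - f s| <= M * `|t - s|.
Proof.
wlog st : s t / s <= t => [H|].
  move=> D B; have [st|/ltW ts] := leP s t; first exact: (H _ _ st D B).
  rewrite distrC [X in _ <= _ * X]distrC; apply: (H _ _ ts) => y; rewrite minC maxC.
    exact: D.
  exact: B.
rewrite (min_idPl st) (max_idPr st) => D B.
have [c cst ->] : exists2 c, c \in `[s, t] & f t - f s = df c * (t - s).
  apply: MVT_segment => //.
    by move=> y; rewrite in_itv/= => /andP[y1 y2]; apply: D; rewrite !ltW.
  apply: continuous_in_subspaceT => y; rewrite inE/= in_itv/= => ys.
  exact: is_derive_continuous (D y ys).
by rewrite normrM ler_wpM2r// B//; move: cst; rewrite in_itv.
Qed.

(** Three nested mean value bounds; this costs the constant M instead of M / 6, which is immaterial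
    here. *)
Lemma taylor2_norm f f1 f2 f3 (M y b : R) :
  (forall x, is_derive x 1 f (f1 x)) -> (forall x, is_derive x 1 f1 (f2 x)) ->
  (forall x, is_derive x 1 f2 (f3 x)) -> (forall x, `|f3 x| <= M) ->
  `|f (y + b) - f y - b * f1 y - b ^+ 2 / 2 * f2 y| <= M * `|b| ^+ 3.
Proof.
move=> d0 d1 d2 B.
have M0 : 0 <= M by apply: le_trans (B 0).
have itv_norm (c x : R) : Num.min 0 c <= x <= Num.max 0 c -> `|x| <= `|c|.
  have [c0|c0] := leP 0 c => /andP[x0 xc].
    by rewrite !ger0_norm.
  by rewrite !ler0_norm ?lerN2// ltW.
have shift (g dg : R -> R) (c : R) : (forall x, is_derive x 1 g (dg x)) ->
    is_derive c 1 (fun c : R => g (y + c)) (dg (y + c)).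
  move=> D; rewrite -[dg _]mulr1; apply: is_derive_comp_pt => //.
  have -> : +%R y = (fun z => 1 * z + y) by apply/funext => z; rewrite mul1r addrC.
  exact: is_derive_affine.
have sc (k c : R) : is_derive c 1 (fun c : R => c * k) k.
  have -> : (fun c : R => c * k) = (fun z => k * z + 0).
    by apply/funext => z; rewrite addr0 mulrC.
  exact: is_derive_affine.
have scst (k c : R) : is_derive c 1 (fun _ : R => k) 0 by exact: is_derive_cst.
have R2 (c : R) : `|f2 (y + c) - f2 y| <= M * `|c|.
  have := @MVT_norm f2 f3 M y (y + c).
  have -> : y + c - y = c by ring.
  by apply => x _; exact: B.
pose r1 (c : R) := f1 (y + c) + (- f1 y + c * (- f2 y)).
have r10 : r1 0 = 0 by rewrite /r1 addr0 mul0r addr0 subrr.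
have D1 (x : R) : is_derive x 1 r1 (f2 (y + x) + (0 + - f2 y)).
  exact: (is_deriveD_pt (shift f1 f2 x d1)
    (is_deriveD_pt (scst (- f1 y) x) (sc (- f2 y) x))).
have R1 (c : R) : `|r1 c| <= M * `|c| * `|c|.
  have := @MVT_norm r1 _ (M * `|c|) 0 c (fun x _ => D1 x).
  rewrite r10 !subr0; apply.
  move=> x xc; rewrite add0r; apply: le_trans (R2 x) _.
  by rewrite ler_wpM2l// itv_norm.
pose r0 (c : R) := f (y + c) + (- f y + (c * (- f1 y) + c * c * (- (f2 y / 2)))).
have D0 (x : R) : is_derive x 1 r0 (f1 (y + x) + (0 + (- f1 y + ((1 * x + x * 1) *
    (- (f2 y / 2)) + x * x * 0)))).
  exact: (is_deriveD_pt (shift f f1 x d0) (is_deriveD_pt (scst (- f y) x)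
    (is_deriveD_pt (sc (- f1 y) x) (is_deriveM_pt
      (is_deriveM_pt (is_derive_id x 1) (is_derive_id x 1)) (scst (- (f2 y / 2)) x))))).
have := @MVT_norm r0 _ (M * `|b| * `|b|) 0 b (fun x _ => D0 x).
have -> : r0 b - r0 0 = f (y + b) - f y - b * f1 y - b ^+ 2 / 2 * f2 y.
  by rewrite /r0 addr0; ring.
rewrite subr0; have -> : M * `|b| ^+ 3 = M * `|b| * `|b| * `|b| by ring.
apply=> x xb.
have -> : f1 (y + x) + (0 + (- f1 y + ((1 * x + x * 1) * - (f2 y / 2) + x * x * 0)))
   = r1 x by rewrite /r1; field.
have xb' := itv_norm _ _ xb.
by apply: le_trans (R1 x) _; rewrite ler_pM// ?mulr_ge0// ler_wpM2l.
Qed.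

(* The heat equation turns time derivatives into space derivatives. *)
Lemma heat_regular (v : nat -> R -> R -> R) (V M : R) : 0 <= V ->
  (forall j (t y : R), (j < 3)%N -> 0 <= t -> is_derive y 1 (v j t) (v j.+1 t y)) ->
  (forall j (t y : R), (j < 3)%N -> 0 <= t ->
     is_derive t 1 (fun t : R => v j t y) (V / 2 * v j.+2 t y)) ->
  (forall j (t y : R), (j < 5)%N -> 0 <= t -> `|v j t y| <= M) ->
  exists2 M' : R, 0 < M' & [/\
    forall j (t y : R), (j < 3)%N -> 0 <= t -> `|v j t y| <= M',
    forall t t' y b : R, 0 <= t -> 0 <= t' ->
      `|v 0 t' (y + b) - v 0 t y| <= M' * (`|t' - t| + `|b|) &
    forall t t' y b : R, 0 <= t -> 0 <= t' ->
      `|v 0 t' (y + b) - (v 0 t y + b * v 1 t y +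
          (b ^+ 2 + (t' - t) * V) / 2 * v 2 t y)| <=
      M' * ((t' - t) ^+ 2 + `|t' - t| * `|b| + `|t' - t| * b ^+ 2 + `|b| ^+ 3)].
Proof.
move=> V0 dy dt B.
have M0 : 0 <= M by apply: le_trans (B 0%N 0 0 isT (lexx _)).
pose W := V / 2; have W0 : 0 <= W by rewrite divr_ge0.
have MW : 0 <= M * W by rewrite mulr_ge0.
have MW2 : 0 <= M * W ^+ 2 by rewrite mulr_ge0 ?sqr_ge0.
have time j (t t' y : R) : (j < 3)%N -> 0 <= t -> 0 <= t' ->
    `|v j t' y - v j t y| <= M * W * `|t' - t|.
  move=> j3 t0 t'0; apply: (@MVT_norm (v j ^~ y) (fun t => W * v j.+2 t y)) => x /andP[xt _].
    apply: dt => //; apply: le_trans xt; by rewrite le_min t0.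
  rewrite normrM (ger0_norm W0) mulrC ler_wpM2r// B//.
  by apply: le_trans xt; rewrite le_min t0.
have space (t y b : R) : 0 <= t -> `|v 0 t (y + b) - v 0 t y| <= M * `|b|.
  move=> t0; have := @MVT_norm (v 0 t) (v 1 t) M y (y + b).
  have -> : y + b - y = b by ring.
  by apply => x _; [exact: dy|exact: B].
exists (M + M * W + M * W ^+ 2 + 1); first by lra.
split.
- move=> j t y j3 t0; have h := B j t y (@leq_trans 3 j.+1 5 j3 isT) t0; lra.
- move=> t t' y b t0 t'0.
  have -> : v 0 t' (y + b) - v 0 t y =
    (v 0 t' (y + b) - v 0 t' y) + (v 0 t' y - v 0 t y) by ring.
  apply: le_trans (ler_normD _ _) _.
  have h1 := space t' y b t'0; have h2 := time 0%N t t' y isT t0 t'0.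
  have b0 := normr_ge0 b; have tt0 := normr_ge0 (t' - t).
  apply: le_trans (lerD h1 h2) _; rewrite -subr_ge0.
  have -> : (M + M * W + M * W ^+ 2 + 1) * (`|t' - t| + `|b|) -
     (M * `|b| + M * W * `|t' - t|) = (M + M * W ^+ 2 + 1) * `|t' - t| +
       (M * W + M * W ^+ 2 + 1) * `|b| by ring.
  by apply: addr_ge0; apply: mulr_ge0 => //; lra.
move=> t t' y b t0 t'0.
have h1 : `|v 0 t' (y + b) - v 0 t' y - b * v 1 t' y - b ^+ 2 / 2 * v 2 t' y|
    <= M * `|b| ^+ 3.
  exact: (@taylor2_norm (v 0 t') (v 1 t') (v 2 t') (v 3 t') M y b
    (fun x => dy 0%N t' x isT t'0) (fun x => dy 1%N t' x isT t'0)
    (fun x => dy 2%N t' x isT t'0) (fun x => B 3%N t' x isT t'0)).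
have h2 : `|v 0 t' y - v 0 t y - (t' - t) * (W * v 2 t y)| <=
    M * W ^+ 2 * (t' - t) ^+ 2.
  pose f (x : R) := v 0 x y + (x * (- (W * v 2 t y))).
  have pos (x : R) : Num.min t t' <= x <= Num.max t t' -> 0 <= x.
    by move=> /andP[xt _]; apply: le_trans xt; rewrite le_min t0.
  have D (x : R) : Num.min t t' <= x <= Num.max t t' ->
      is_derive x 1 f (W * v 2 x y + - (W * v 2 t y)).
    move=> /pos x0; apply: is_deriveD_pt; first exact: (dt 0%N).
    have -> : (fun z : R => z * - (W * v 2 t y)) = (fun z => - (W * v 2 t y) * z + 0).
      by apply/funext => z; rewrite addr0 mulrC.
    exact: is_derive_affine.
  have := @MVT_norm f _ (M * W ^+ 2 * `|t' - t|) t t' D.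
  have -> : f t' - f t = v 0 t' y - v 0 t y - (t' - t) * (W * v 2 t y).
    by rewrite /f; ring.
  have -> : M * W ^+ 2 * `|t' - t| * `|t' - t| = M * W ^+ 2 * (t' - t) ^+ 2.
    by rewrite -mulrA -expr2 real_normK ?num_real.
  apply=> x xt; have x0 := pos x xt.
  rewrite -mulrBr normrM (ger0_norm W0).
  have -> : M * W ^+ 2 * `|t' - t| = W * (M * W * `|t' - t|) by ring.
  rewrite ler_wpM2l//; apply: le_trans (time 2%N t x y isT t0 x0) _.
  rewrite ler_wpM2l//; move: xt.
  have [tt'|tt'] := leP t t' => /andP[xt xt'].
    by rewrite !ger0_norm ?subr_ge0// lerD2r.
  by rewrite !ler0_norm ?subr_le0// ?(ltW tt')// lerN2 lerD2r.
have h3 := time 1%N t t' y isT t0 t'0; have h4 := time 2%N t t' y isT t0 t'0.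
(* Expand in space at time t', then in time at y, and bring both space derivatives from time t' back
   to t. Moving the second one costs the fourth space derivative, whence the bounds for j < 5. *)
have -> : v 0 t' (y + b) - (v 0 t y + b * v 1 t y +
    (b ^+ 2 + (t' - t) * V) / 2 * v 2 t y) =
  (v 0 t' (y + b) - v 0 t' y - b * v 1 t' y - b ^+ 2 / 2 * v 2 t' y) +
  (v 0 t' y - v 0 t y - (t' - t) * (W * v 2 t y)) +
  b * (v 1 t' y - v 1 t y) + b ^+ 2 / 2 * (v 2 t' y - v 2 t y).
  by rewrite /W; field.
have b0 := normr_ge0 b; have tt0 := normr_ge0 (t' - t).
have k3 : `|b * (v 1 t' y - v 1 t y)| <= M * W * (`|t' - t| * `|b|).
  by rewrite normrM; have := ler_wpM2l b0 h3; lra.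
have b20 : 0 <= b ^+ 2 / 2 by rewrite divr_ge0 ?sqr_ge0.
have k4 : `|b ^+ 2 / 2 * (v 2 t' y - v 2 t y)| <= M * W * (`|t' - t| * b ^+ 2).
  rewrite normrM (ger0_norm b20).
  have := ler_wpM2l b20 h4.
  have : 0 <= M * W * (`|t' - t| * b ^+ 2) by rewrite mulr_ge0// mulr_ge0 ?sqr_ge0.
  lra.
apply: le_trans (ler_normD _ _) _; apply: le_trans (lerD (ler_normD _ _) (lexx _)) _.
apply: le_trans (lerD (lerD (ler_normD _ _) (lexx _)) (lexx _)) _.
apply: le_trans (lerD (lerD (lerD h1 h2) k3) k4) _.
have q1 : 0 <= (t' - t) ^+ 2 by exact: sqr_ge0.
have q2 : 0 <= `|t' - t| * `|b| by rewrite mulr_ge0.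
have q3 : 0 <= `|t' - t| * b ^+ 2 by rewrite mulr_ge0 ?sqr_ge0.
have q4 : 0 <= `|b| ^+ 3 by rewrite exprn_ge0.
set A1 := (t' - t) ^+ 2 in q1 *; set A2 := `|t' - t| * `|b| in q2 *.
set A3 := `|t' - t| * b ^+ 2 in q3 *; set A4 := `|b| ^+ 3 in q4 *.
rewrite -subr_ge0.
have -> : (M + M * W + M * W ^+ 2 + 1) * (A1 + A2 + A3 + A4) -
  (M * A4 + M * W ^+ 2 * A1 + M * W * A2 + M * W * A3) =
  (M + M * W + 1) * A1 + (M + M * W ^+ 2 + 1) * A2 + (M + M * W ^+ 2 + 1) * A3 +
  (M * W + M * W ^+ 2 + 1) * A4 by ring.
by do 3?apply: addr_ge0; apply: mulr_ge0 => //; lra.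
Qed.

End derivatives.

(** * The standard normal distribution function *)

Section normal_cdf.
Context {R : realType}.

Definition std_pdf : R -> R := normal_pdf 0 1.

Definition std_cdf (x : R) : R :=
  \int[lebesgue_measure]_(t in `]-oo, x]) std_pdf t.

Lemma std_pdfE x : std_pdf x = normal_peak 1 * expR (- x ^+ 2 / 2).
Proof.
rewrite /std_pdf normal_pdfE ?oner_neq0//; congr (_ * _).
by rewrite /normal_fun subr0 expr1n.
Qed.

Lemma normal_probE x : normal_prob 0 1 `]-oo, x]%classic = (std_cdf x)%:E :> \bar R.
Proof.
rewrite /std_cdf /Rintegral fineK//.
have := fin_num_measure (normal_prob 0 1 : probability _ R) `]-oo, x]%classic.
by apply; exact: measurable_itv.
Qed.

Lemma std_cdf_ge0 x : 0 <= std_cdf x.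
Proof. by rewrite -lee_fin -normal_probE. Qed.

Lemma std_cdf_le1 x : std_cdf x <= 1.
Proof.
rewrite -lee_fin -normal_probE.
exact: (@probability_le1 _ _ _ (normal_prob 0 1 : probability _ R)).
Qed.

Lemma std_cdf_homo (x y : R) : x <= y -> std_cdf x <= std_cdf y.
Proof.
move=> xy; rewrite -lee_fin -!normal_probE.
apply: (@le_measure _ _ _ (normal_prob 0 1 : probability _ R)); rewrite ?inE//.
by apply: subset_itvl; rewrite bnd_simp.
Qed.

Lemma is_derive_std_cdf (x : R) : is_derive x 1 std_cdf (std_pdf x).
Proof.
have xx1 : x < x + 1 by rewrite ltrDl.
have intf : lebesgue_measure.-integrable [set` Interval -oo%O (BRight (x + 1))]
    (EFin \o std_pdf).
  by apply: integrableS (integrable_normal_pdf 0 1) => //; exact: measurable_itv.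
have cont : {for x, continuous std_pdf}.
  by apply: continuous_normal_pdf; rewrite oner_neq0.
have [|d e] := continuous_FTC1 xx1 intf _ cont; first exact: ltNyr.
by apply: DeriveDef; rewrite // -derive1E.
Qed.

(** Under the normal law the identity is a random variable with distribution function [std_cdf],
    whose limits at infinity are then those of any [cdf]. *)
Let idR : measurableTypeR R -> R := idfun.

#[local] HB.instance Definition _ :=
  @isMeasurableFun.Build _ _ _ _ idR (@measurable_id _ _ setT).

Let cdf_idR : cdf (idR : {RV (normal_prob 0 1 : probability _ R) >-> R}) =
  EFin \o std_cdf.
Proof.
by apply/funext => x; rewrite /cdf/= /distribution/= /pushforward preimage_id normal_probE.
Qed.

Lemma std_cdf_cvgy : std_cdf x @[x --> +oo] --> (1 : R).
Proof.
have := @cvg_cdfy1 _ _ _ _ (idR : {RV (normal_prob 0 1 : probability _ R) >-> R}).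
by rewrite cdf_idR => /fine_cvgP[].
Qed.

Lemma std_cdf_cvgNy : std_cdf x @[x --> -oo] --> (0 : R).
Proof.
have := @cvg_cdfNy0 _ _ _ _ (idR : {RV (normal_prob 0 1 : probability _ R) >-> R}).
by rewrite cdf_idR => /fine_cvgP[].
Qed.

(** The derivatives of the normal distribution function, by Leibniz's rule applied to f' = - x f for
    the density f: the recursion of the Hermite polynomials. At k = 0 the coefficient k removes the
    distribution function itself. *)
Fixpoint cdf_deriv (j : nat) (x : R) : R :=
  match j with
  | 0 => std_cdf x
  | j'.+1 => match j' with
             | 0 => std_pdf x
             | k.+1 => - x * cdf_deriv j' x - k%:R * cdf_deriv k x
             end
  end.

Lemma cdf_derivSS k x :
  cdf_deriv k.+2 x = - x * cdf_deriv k.+1 x - k%:R * cdf_deriv k x.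
Proof. by []. Qed.

Lemma is_derive_std_pdf (x : R) : is_derive x 1 std_pdf (- x * std_pdf x).
Proof.
rewrite (_ : std_pdf = fun x => normal_peak 1 * expR ((- 1 / 2) * (x * x) + 0)).
  have dsq := is_deriveM_pt (is_derive_id x (1 : R)) (is_derive_id x (1 : R)).
  have daf := is_derive_comp_pt dsq (is_derive_affine (- 1 / 2) 0 _).
  have dex := is_derive_comp_pt daf (is_derive_expR _).
  by apply: (derive_eq (is_deriveM_pt (is_derive_cst_pt (normal_peak 1) x) dex)); field.
by apply/funext => y; rewrite std_pdfE; congr (_ * expR _); field.
Qed.

Lemma is_derive_cdf_deriv j (x : R) : is_derive x 1 (cdf_deriv j) (cdf_deriv j.+1 x).
Proof.
elim/ltn_ind: j x => -[|[|k]] IH x; first exact: is_derive_std_cdf.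
  apply: (derive_eq (is_derive_std_pdf x)).
  by rewrite cdf_derivSS mul0r subr0.
rewrite (_ : cdf_deriv k.+2 = fun x => (- 1 * x + 0) * cdf_deriv k.+1 x +
    - k%:R * cdf_deriv k x); last first.
  by apply/funext => y; rewrite cdf_derivSS; ring.
have d1 := is_deriveM_pt (is_derive_affine (- 1) 0 x) (IH k.+1 (leqnn _) x).
have d2 := is_deriveM_pt (is_derive_cst_pt (- k%:R) x) (IH k (leqnSn _) x).
apply: (derive_eq (is_deriveD_pt d1 d2)).
by rewrite (cdf_derivSS k.+1) -natr1; ring.
Qed.

(** The powers 2 and 4 dominate the polynomial factors of the first four derivatives. The bound is
    (1 + x^2 / 4)^2 <= e^(x^2 / 2). *)
Lemma std_pdf_moment x : (1 + x ^+ 2 + x ^+ 4) * std_pdf x <= 16 * normal_peak 1.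
Proof.
rewrite std_pdfE mulrCA mulrC; apply: ler_wpM2r; first exact: normal_peak_ge0.
rewrite mulNr expRN ler_pdivrMr ?expR_gt0//.
have -> : x ^+ 2 / 2 = 2%:R * (x ^+ 2 / 4) by field.
rewrite expRM_natl; have h := expR_ge1Dx (x ^+ 2 / 4).
have : (1 + x ^+ 2 / 4) ^+ 2 <= expR (x ^+ 2 / 4) ^+ 2.
  by rewrite lerXn2r ?nnegrE ?expR_ge0// addr_ge0// divr_ge0 ?sqr_ge0.
have -> : (1 + x ^+ 2 / 4) ^+ 2 = 1 + x ^+ 2 / 2 + x ^+ 4 / 16 by field.
have := sqr_ge0 x; lra.
Qed.

Lemma cdf_deriv_bounded : exists M : R, forall j (x : R), (j < 5)%N -> `|cdf_deriv j x| <= M.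
Proof.
have p0 : 0 <= normal_peak (1 : R) by exact: normal_peak_ge0.
exists (1 + 64 * normal_peak 1) => j x.
have f0 : 0 <= std_pdf x by exact: normal_pdf_ge0.
have h := std_pdf_moment x; set f := std_pdf x in f0 h *.
have f1 : 0 <= x ^+ 2 * f by rewrite mulr_ge0 ?sqr_ge0.
have f2 : 0 <= x ^+ 4 * f by rewrite mulr_ge0// -[4%N]/((2 * 2)%N) exprM sqr_ge0.
rewrite !mulrDl mul1r in h.
have xf : `|x * f| <= f + x ^+ 2 * f.
  have : 0 <= (x - 1) ^+ 2 * f by rewrite mulr_ge0 ?sqr_ge0.
  have : 0 <= (x + 1) ^+ 2 * f by rewrite mulr_ge0 ?sqr_ge0.
  have -> : (x + 1) ^+ 2 * f = x ^+ 2 * f + 2 * (x * f) + f by ring.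
  have -> : (x - 1) ^+ 2 * f = x ^+ 2 * f - 2 * (x * f) + f by ring.
  by move=> a b; rewrite ler_norml; apply/andP; split; lra.
have x3f : `|x ^+ 3 * f| <= x ^+ 2 * f + x ^+ 4 * f.
  have : 0 <= (x - 1) ^+ 2 * (x ^+ 2 * f) by rewrite mulr_ge0 ?sqr_ge0.
  have : 0 <= (x + 1) ^+ 2 * (x ^+ 2 * f) by rewrite mulr_ge0 ?sqr_ge0.
  have -> : (x + 1) ^+ 2 * (x ^+ 2 * f) = x ^+ 4 * f + 2 * (x ^+ 3 * f) + x ^+ 2 * f by ring.
  have -> : (x - 1) ^+ 2 * (x ^+ 2 * f) = x ^+ 4 * f - 2 * (x ^+ 3 * f) + x ^+ 2 * f by ring.
  by move=> a b; rewrite ler_norml; apply/andP; split; lra.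
move: xf x3f; rewrite !ler_norml => /andP[a1 a2] /andP[b1 b2].
case: j => [|[|[|[|[|j]]]]] // _.
- have := std_cdf_ge0 x; have := std_cdf_le1 x => c1 c0 /=.
  by apply/andP; split; lra.
- by rewrite /= -/f; apply/andP; split; lra.
- rewrite (_ : cdf_deriv 2 x = - (x * f)); last by rewrite cdf_derivSS /= -/f; ring.
  by apply/andP; split; lra.
- rewrite (_ : cdf_deriv 3 x = x ^+ 2 * f - f); last by rewrite !cdf_derivSS /= -/f; ring.
  by apply/andP; split; lra.
- rewrite (_ : cdf_deriv 4 x = 3 * (x * f) - x ^+ 3 * f); last by rewrite !cdf_derivSS /= -/f; ring.
  by apply/andP; split; lra.
Qed.

End normal_cdf.

(** * Solutions of the heat equation *)

Section heat_solutions.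
Context {R : realType} (V : R).
Hypothesis V_ge0 : 0 <= V.

(** The inverse standard deviation (h + V t)^(-1/2), in a form that the chain rule for [expR] and
    [ln] differentiates. *)
Definition inv_std (h t : R) : R := expR (- (1 / 2) * ln (h + V * t)).

(* The law of [N(0, h + V t)] evaluated at [x0 - y], and its derivatives in [y]. *)
Definition cdf_heat (h x0 : R) (j : nat) (t y : R) : R :=
  (- inv_std h t) ^+ j * cdf_deriv j (inv_std h t * (x0 - y)).

Lemma cdf_heat_space (h x0 : R) j (t y : R) :
  is_derive y 1 (cdf_heat h x0 j t) (cdf_heat h x0 j.+1 t y).
Proof.
rewrite (_ : cdf_heat h x0 j t = fun y => (- inv_std h t) ^+ j *
  cdf_deriv j ((- inv_std h t) * y + inv_std h t * x0)); last first.
  by apply/funext => z; congr (_ * cdf_deriv j _); ring.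
have dc := is_derive_comp_pt (is_derive_affine (- inv_std h t) (inv_std h t * x0) y)
  (is_derive_cdf_deriv j _).
apply: (derive_eq (is_deriveM_pt (is_derive_cst_pt ((- inv_std h t) ^+ j) y) dc)).
rewrite /cdf_heat mul0r add0r exprSr mulrA mulrAC; congr (_ * cdf_deriv j.+1 _).
by ring.
Qed.

Lemma is_derive_inv_std (h t : R) : 0 < h -> 0 <= t ->
  is_derive t 1 (inv_std h) (- (V / 2) * inv_std h t ^+ 3).
Proof.
move=> h0 t0; have pos : 0 < V * t + h by rewrite ltr_wpDl// mulr_ge0.
rewrite (_ : inv_std h = fun t => expR (- (1 / 2) * ln (V * t + h) + 0)); last first.
  by apply/funext => z; rewrite addr0 addrC.
have dln := is_derive_comp_pt (is_derive_affine V h t) (is_derive1_ln pos).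
have daf := is_derive_comp_pt dln (is_derive_affine (- (1 / 2)) 0 _).
apply: (derive_eq (is_derive_comp_pt daf (is_derive_expR _))).
rewrite addr0; set k := expR _.
have k2 : k ^+ 2 = (V * t + h)^-1.
  rewrite /k -expRM_natl -[RHS]lnK ?posrE ?invr_gt0// lnV ?posrE//; congr expR.
  by field.
by rewrite exprSr k2; field; rewrite gt_eqF.
Qed.

Lemma is_deriveXn_pt (f : R -> R) (x a : R) n : is_derive x 1 f a ->
  is_derive x 1 (fun y : R => f y ^+ n) (n%:R * f x ^+ n.-1 * a).
Proof.
move=> df; elim: n => [|n IH].
  by rewrite !mul0r; exact: is_derive_cst.
rewrite (_ : (fun y => f y ^+ n.+1) = fun y => f y * f y ^+ n); last first.
  by apply/funext => y; rewrite exprS.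
apply: (derive_eq (is_deriveM_pt df IH)).
case: n {IH} => [|n] /=; first by ring.
by rewrite -[n.+2%:R]natr1 exprS; ring.
Qed.

(** The recursion [cdf_derivSS] is the heat equation: the time derivative of the power of [inv_std]
    gives its term in k, that of the argument its term in x. *)
Lemma cdf_heat_time (h x0 : R) j (t y : R) : 0 < h -> 0 <= t ->
  is_derive t 1 (fun t : R => cdf_heat h x0 j t y) (V / 2 * cdf_heat h x0 j.+2 t y).
Proof.
move=> h0 t0; have dk := is_derive_inv_std h0 t0.
have dNk : is_derive t 1 (fun t : R => -1 * inv_std h t + 0)
    (-1 * (- (V / 2) * inv_std h t ^+ 3)).
  exact: (is_derive_comp_pt dk (is_derive_affine (-1) 0 _)).
have du : is_derive t 1 (fun t : R => (x0 - y) * inv_std h t + 0)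
    ((x0 - y) * (- (V / 2) * inv_std h t ^+ 3)).
  exact: (is_derive_comp_pt dk (is_derive_affine (x0 - y) 0 _)).
rewrite (_ : (fun t => _) = fun t => (-1 * inv_std h t + 0) ^+ j *
   cdf_deriv j ((x0 - y) * inv_std h t + 0)); last first.
  by apply/funext => z; rewrite /cdf_heat !addr0 mulN1r [(x0 - y) * _]mulrC.
apply: (derive_eq (is_deriveM_pt (is_deriveXn_pt j dNk)
  (is_derive_comp_pt du (is_derive_cdf_deriv j _)))).
rewrite /cdf_heat cdf_derivSS !addr0 mulN1r [(x0 - y) * inv_std h t]mulrC.
set k := inv_std h t; set c1 := cdf_deriv j.+1 _; set c0 := cdf_deriv j _.
case: j @c1 @c0 => [|j] c1 c0.
  by rewrite /= !mul0r expr0; ring.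
by rewrite /= !exprS; ring.
Qed.

Lemma cdf_heat_bounded (h x0 : R) : 0 < h -> exists M : R, forall j (t y : R), (j < 5)%N ->
  0 <= t -> `|cdf_heat h x0 j t y| <= M.
Proof.
move=> h0; have [M HM] := @cdf_deriv_bounded R.
have k0 : 0 < inv_std h 0 by exact: expR_gt0.
exists ((1 + inv_std h 0) ^+ 4 * M) => j t y j5 t0.
have kt : inv_std h t <= inv_std h 0.
  rewrite ler_expR ler_wnM2l ?oppr_le0// mulr0 addr0 ler_ln ?posrE//.
    by rewrite lerDl mulr_ge0.
  by rewrite ltr_wpDr// mulr_ge0.
rewrite normrM normrX normrN (ger0_norm (expR_ge0 _)); apply: ler_pM; [|by []| |exact: HM].
  by rewrite exprn_ge0// expR_ge0.
apply: (@le_trans _ _ ((1 + inv_std h 0) ^+ j)).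
  have k1 : 0 < inv_std h t by exact: expR_gt0.
  by apply: lerXn2r; rewrite ?nnegrE -?/(inv_std h t); lra.
by rewrite ler_weXn2l//; lra.
Qed.

(** The j-th space derivative of e^(- tau^2 V t / 2) f(tau y) when f' = f1 and f1' = - f, as for
    sine and cosine. The added zeros match the form of [is_derive_affine]. *)
Definition trig_heat (f f1 : R -> R) (tau : R) (j : nat) (t y : R) : R :=
  expR (- (tau ^+ 2 * V / 2) * t + 0) * tau ^+ j *
  ((-1) ^+ j./2 * (if odd j then f1 else f) (tau * y + 0)).

Section trig.
Variables (f f1 : R -> R) (tau : R).
Hypothesis df : forall x : R, is_derive x 1 f (f1 x).
Hypothesis df1 : forall x : R, is_derive x 1 f1 (- f x).
Hypothesis f_le1 : forall x : R, `|f x| <= 1.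
Hypothesis f1_le1 : forall x : R, `|f1 x| <= 1.

Lemma trig_heat_space j (t y : R) :
  is_derive y 1 (trig_heat f f1 tau j t) (trig_heat f f1 tau j.+1 t y).
Proof.
have dfj (x : R) : is_derive x 1 (if odd j then f1 else f)
    (if odd j then - f x else f1 x) by case: odd; [exact: df1|exact: df].
have dc := is_derive_comp_pt (is_derive_affine tau 0 y) (dfj _).
have d1 := is_deriveM_pt (is_derive_cst_pt ((-1) ^+ j./2) y) dc.
apply: (derive_eq (is_deriveM_pt (is_derive_cst_pt
  (expR (- (tau ^+ 2 * V / 2) * t + 0) * tau ^+ j) y) d1)).
rewrite /trig_heat /= uphalf_half (exprS tau j); case: (odd j) => /=.
  by rewrite add1n (exprS (-1)); ring.
by rewrite add0n; ring.
Qed.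

Lemma trig_heat_time j (t y : R) :
  is_derive t 1 (fun t : R => trig_heat f f1 tau j t y) (V / 2 * trig_heat f f1 tau j.+2 t y).
Proof.
have dex := is_derive_comp_pt (is_derive_affine (- (tau ^+ 2 * V / 2)) 0 t)
  (is_derive_expR _).
apply: (derive_eq (is_deriveM_pt (is_deriveM_pt dex (is_derive_cst_pt (tau ^+ j) t))
  (is_derive_cst_pt ((-1) ^+ j./2 * (if odd j then f1 else f) (tau * y + 0)) t))).
rewrite /trig_heat /= negbK !exprS; ring.
Qed.

Lemma trig_heat_bounded : exists M : R, forall j (t y : R), (j < 5)%N ->
  0 <= t -> `|trig_heat f f1 tau j t y| <= M.
Proof.
exists ((1 + `|tau|) ^+ 4) => j t y j5 t0.
rewrite /trig_heat !normrM !normrX normrN1 expr1n mul1r (ger0_norm (expR_ge0 _)).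
have b : `|(if odd j then f1 else f) (tau * y + 0)| <= 1 by case: odd.
have e1 : expR (- (tau ^+ 2 * V / 2) * t + 0) <= 1.
  rewrite -expR0 ler_expR addr0 mulNr oppr_le0 mulr_ge0// divr_ge0// mulr_ge0//.
  exact: sqr_ge0.
have t4 : `|tau| ^+ j <= (1 + `|tau|) ^+ 4.
  apply: (@le_trans _ _ ((1 + `|tau|) ^+ j)).
    by apply: lerXn2r; rewrite ?nnegrE// ?lerDr//; rewrite addr_ge0.
  by rewrite ler_weXn2l// lerDl.
have n0 := exprn_ge0 j (normr_ge0 tau).
rewrite -[leRHS]mulr1 -[X in _ <= X * 1]mul1r.
have p : expR (- (tau ^+ 2 * V / 2) * t + 0) * `|tau| ^+ j <= 1 * (1 + `|tau|) ^+ 4.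
  by apply: ler_pM; rewrite ?expR_ge0.
by apply: ler_pM; rewrite ?mulr_ge0 ?expR_ge0.
Qed.

End trig.
End heat_solutions.

(** * The random walk of the logarithms of the factors *)

Section renewal.
Context (R : realType) (P : set nat) (rho : R).
Hypothesis P_ge2 : P `<=` [set n | (2 <= n)%N].

Definition step (p : nat) : R := ln p%:R.

Definition weight (p : nat) : R :=
  if p \in P then expR (- rho * step p) else 0.

(** An expectation, as a relation since it may fail to exist. The weights need not sum to 1: they
    are also used at exponents other than the growth exponent. *)
Definition has_mean (phi : nat -> R) (m : R) : Prop :=
  \sum_(0 <= p < B) weight p * phi p @[B --> \oo] --> m.

Lemma weight_ge0 p : 0 <= weight p.
Proof. by rewrite /weight; case: ifP => // _; exact: expR_ge0. Qed.

Lemma weight_gt0 p : P p -> 0 < weight p.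
Proof. by move=> Pp; rewrite /weight mem_set// expR_gt0. Qed.

Lemma ln2_gt0 : 0 < ln (2 : R).
Proof. by apply: ln_gt0; rewrite ltr1n. Qed.

Lemma step_ge p : P p -> ln 2 <= step p.
Proof.
move=> /P_ge2/= p2; rewrite /step ler_ln ?posrE ?ler_nat ?ltr0n//.
exact: leq_trans p2.
Qed.

Lemma step_gt0 p : P p -> 0 < step p.
Proof. by move=> /step_ge; apply: lt_le_trans; exact: ln2_gt0. Qed.

Lemma eq_weight p (a b : R) : (P p -> a = b) -> weight p * a = weight p * b.
Proof.
by rewrite /weight; case: ifPn => [/set_mem Pp ->//|_ _]; rewrite !mul0r.
Qed.

Lemma ler_weight p (a b : R) : (P p -> a <= b) -> weight p * a <= weight p * b.
Proof.
rewrite /weight; case: ifPn => [/set_mem Pp /(_ Pp) ab|_ _]; last by rewrite !mul0r.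
by apply: ler_wpM2l => //; exact: expR_ge0.
Qed.

Lemma eq_has_mean phi psi m : (forall p, P p -> phi p = psi p) ->
  has_mean phi m -> has_mean psi m.
Proof.
move=> eq_phi; rewrite /has_mean.
suff -> : (fun B => \sum_(0 <= p < B) weight p * phi p) =
          (fun B => \sum_(0 <= p < B) weight p * psi p) by [].
by apply/funext => B; apply: eq_bigr => p _; apply: eq_weight => /eq_phi.
Qed.

Lemma has_meanD phi psi m m' : has_mean phi m -> has_mean psi m' ->
  has_mean (fun p => phi p + psi p) (m + m').
Proof.
move=> hm hm'; rewrite /has_mean.
under eq_fun do (under eq_bigr do rewrite mulrDr; rewrite big_split/=).
exact: cvgD.
Qed.

Lemma has_meanZ c phi m : has_mean phi m -> has_mean (fun p => c * phi p) (c * m).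
Proof.
move=> hm; rewrite /has_mean.
under eq_fun do (under eq_bigr do rewrite mulrCA; rewrite -mulr_sumr).
exact: cvgMl_tmp.
Qed.

Arguments has_meanZ _ {phi m}.

Lemma has_meanN phi m : has_mean phi m -> has_mean (fun p => - phi p) (- m).
Proof.
move=> /(has_meanZ (-1)); rewrite mulN1r; apply: eq_has_mean => p _.
by rewrite mulN1r.
Qed.

Lemma has_meanB phi psi m m' : has_mean phi m -> has_mean psi m' ->
  has_mean (fun p => phi p - psi p) (m - m').
Proof. by move=> hm /has_meanN; exact: has_meanD. Qed.

Lemma has_mean_unique phi m m' : has_mean phi m -> has_mean phi m' -> m = m'.
Proof. by move=> hm hm'; exact: (cvg_unique _ hm hm'). Qed.

Lemma has_mean_le phi psi m m' : has_mean phi m -> has_mean psi m' ->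
  (forall p, P p -> phi p <= psi p) -> m <= m'.
Proof.
move=> hm hm' le_phi; apply: (ler_cvg_to hm hm'); apply: nearW => B.
by apply: ler_sum => p _; apply: ler_weight => /le_phi.
Qed.

Lemma sum_le_has_mean phi m B : (forall p, P p -> 0 <= phi p) ->
  has_mean phi m -> \sum_(0 <= p < B) weight p * phi p <= m.
Proof.
move=> phi0 hm.
have hc : cvgn (fun B => \sum_(0 <= p < B) weight p * phi p) by apply/cvg_ex; exists m.
rewrite -(cvg_lim _ hm)//; apply: (nondecreasing_cvgn_le _ hc) => a b ab /=.
rewrite (big_cat_nat (leq0n _) ab)//= lerDl sumr_ge0// => p _.
by rewrite -(mulr0 (weight p)); apply: ler_weight => /phi0.
Qed.

Lemma has_mean_dom phi psi m : has_mean psi m ->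
  (forall p, P p -> `|phi p| <= psi p) -> exists m', has_mean phi m'.
Proof.
move=> hm dom.
have cv : cvgn (series (fun p => weight p * psi p)).
  by apply/cvg_ex; exists m; rewrite /series; exact: hm.
have psi0 p : P p -> 0 <= psi p by move=> /dom; apply: le_trans.
suff : cvgn (series (fun p => weight p * phi p)).
  by move=> /cvg_ex[m' hm']; exists m'; rewrite /has_mean; exact: hm'.
apply: normed_cvg; apply: series_le_cvg cv => n /=; first exact: normr_ge0.
- by rewrite -(mulr0 (weight n)); apply: ler_weight => /psi0.
- rewrite normrM ger0_norm ?weight_ge0//; apply: ler_weight; exact: dom.
Qed.

(** One truncation for two sums: factors p from [cutoff z] on have [step p] above z, and k from
    [cutoff z] on steps have length at least k ln 2, above z. *)
Definition cutoff (z : R) : nat := (Num.truncn (expR z)).+1.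

Lemma cutoff_gt z : expR z < (cutoff z)%:R.
Proof. exact: truncnS_gt. Qed.

Lemma le_cutoff z z' : z <= z' -> (cutoff z <= cutoff z')%N.
Proof. by move=> zz'; rewrite ltnS le_truncn// ler_expR. Qed.

Lemma step_gt p z : (cutoff z <= p)%N -> z < step p.
Proof.
move=> zp; rewrite -[ltLHS]expRK /step.
have zp' : expR z < p%:R by apply: lt_le_trans (cutoff_gt z) _; rewrite ler_nat.
by rewrite ltr_ln// posrE ?expR_gt0// (lt_trans _ zp')// expR_gt0.
Qed.

Lemma natmul_ln2_gt k z : (cutoff z <= k)%N -> z < k%:R * ln 2.
Proof.
move=> zk; rewrite -[ltLHS]expRK mulr_natl -lnXn//.
rewrite ltr_ln ?posrE ?expR_gt0 ?exprn_gt0//.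
apply: (lt_le_trans (cutoff_gt z)); rewrite -natrX ler_nat.
by rewrite (leq_trans zk)// ltnW// ltn_expl.
Qed.

(* [walk k z] is the expectation of [[S_k <= z] * e^(- rho * (z - S_k))], with
   [S_k] the sum of [k] independent steps, the step [ln p] having probability
   [weight p]; multiplied by [e^(rho * z)] it counts the sequences of [k]
   elements of [P] whose product is at most [e^z]. *)
Fixpoint walk (k : nat) (z : R) : R :=
  if k is k'.+1 then
    \sum_(0 <= p < cutoff z) weight p * walk k' (z - step p)
  else if 0 <= z then expR (- rho * z) else 0.

Lemma walk_lt k z : z < k%:R * ln 2 -> walk k z = 0.
Proof.
elim: k z => [|k IH] z /=; first by rewrite mul0r ltNge => /negbTE ->.
move=> zk; apply: big1 => p _; rewrite -[RHS](mulr0 (weight p)).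
apply: eq_weight => Pp; apply: IH; have := step_ge Pp.
by move: zk; rewrite -addn1 natrD mulrDl mul1r; lra.
Qed.

Lemma walk_lt0 k z : z < 0 -> walk k z = 0.
Proof.
by move=> z0; apply: walk_lt; rewrite (lt_le_trans z0)// mulr_ge0// ltW// ln2_gt0.
Qed.

Lemma walk_ge0 k z : 0 <= walk k z.
Proof.
elim: k z => [|k IH] z /=; first by case: ifP => // _; exact: expR_ge0.
by apply: sumr_ge0 => p _; rewrite mulr_ge0// weight_ge0.
Qed.

Lemma sum_cutoff (phi : nat -> R) z B : (cutoff z <= B)%N ->
  (forall p, P p -> z < step p -> phi p = 0) ->
  \sum_(0 <= p < B) weight p * phi p =
  \sum_(0 <= p < cutoff z) weight p * phi p.
Proof.
move=> zB phi0; rewrite (big_cat_nat (leq0n _) zB)//= [X in _ + X]big1_seq ?addr0//.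
move=> p /= ; rewrite mem_index_iota => /andP[zp _]; rewrite -[RHS](mulr0 (weight p)).
by apply: eq_weight => Pp; apply: phi0 => //; exact: step_gt.
Qed.

Lemma walkS k z B : (cutoff z <= B)%N ->
  walk k.+1 z = \sum_(0 <= p < B) weight p * walk k (z - step p).
Proof.
move=> zB; rewrite (sum_cutoff zB)//= => p Pp zp.
by rewrite walk_lt0// subr_lt0.
Qed.

Definition walk_sum (f : nat -> R) (z : R) : R :=
  \sum_(0 <= k < cutoff z) f k * walk k z.

Lemma walk_sumE f z B : (cutoff z <= B)%N ->
  walk_sum f z = \sum_(0 <= k < B) f k * walk k z.
Proof.
move=> zB; rewrite (big_cat_nat (leq0n _) zB)//= [X in _ + X]big1_seq ?addr0//.
move=> k /= ; rewrite mem_index_iota => /andP[zk _].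
by rewrite walk_lt ?mulr0//; exact: natmul_ln2_gt.
Qed.

Lemma walk_sum_lt0 f z : z < 0 -> walk_sum f z = 0.
Proof. by move=> z0; apply: big1 => k _; rewrite walk_lt0 ?mulr0. Qed.

(** Splits off the empty sequence, and otherwise the first step p, after which the walk restarts at
    z - [step p] with its index shifted by one. *)
Lemma walk_sum_renewal f z B : (cutoff z <= B)%N ->
  walk_sum f z = f 0%N * walk 0 z +
    \sum_(0 <= p < B) weight p * walk_sum (fun k => f k.+1) (z - step p).
Proof.
move=> zB; rewrite (@walk_sumE _ _ B.+1) ?leqW// big_nat_recl//; congr (_ + _).
under eq_bigr => k _ do rewrite (walkS _ zB) mulr_sumr.
rewrite exchange_big/=; apply: eq_bigr => p _.
under eq_bigr do rewrite mulrCA; rewrite -mulr_sumr; apply: eq_weight => Pp.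
rewrite (@walk_sumE _ _ B)//; apply: leq_trans zB; apply: le_cutoff.
by rewrite gerBl ltW// step_gt0.
Qed.

Lemma eq_walk_sum f g z : (forall k, f k = g k) -> walk_sum f z = walk_sum g z.
Proof. by move=> fg; apply: eq_bigr => k _; rewrite fg. Qed.

Lemma ler_walk_sum f g z :
  (forall k, k%:R * ln 2 <= z -> f k <= g k) -> walk_sum f z <= walk_sum g z.
Proof.
move=> fg; apply: ler_sum => k _.
have [kz|kz] := leP (k%:R * ln 2) z; last by rewrite walk_lt// !mulr0.
by apply: ler_wpM2r; [exact: walk_ge0|exact: fg].
Qed.

Lemma walk_sumD f g z :
  walk_sum (fun k => f k + g k) z = walk_sum f z + walk_sum g z.
Proof. by rewrite -big_split; apply: eq_bigr => k _ /=; rewrite mulrDl. Qed.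

Lemma walk_sumZ c f z : walk_sum (fun k => c * f k) z = c * walk_sum f z.
Proof. by rewrite mulr_sumr; apply: eq_bigr => k _; rewrite mulrA. Qed.

Lemma walk_sumB f g z :
  walk_sum (fun k => f k - g k) z = walk_sum f z - walk_sum g z.
Proof.
rewrite -mulN1r -walk_sumZ -walk_sumD; apply: eq_walk_sum => k.
by rewrite mulN1r.
Qed.

Lemma ler_norm_walk_sum f z : `|walk_sum f z| <= walk_sum (fun k => `|f k|) z.
Proof.
apply: le_trans (ler_norm_sum _ _ _) _; apply: ler_sum => k _.
by rewrite normrM (ger0_norm (walk_ge0 _ _)).
Qed.

Definition walk_mass : R -> R := walk_sum (fun=> 1).

Lemma walk_massE z B : (cutoff z <= B)%N ->
  walk_mass z = \sum_(0 <= k < B) walk k z.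
Proof.
by move=> zB; rewrite /walk_mass (walk_sumE _ zB); apply: eq_bigr => k _; rewrite mul1r.
Qed.

Lemma walk_mass_ge0 z : 0 <= walk_mass z.
Proof. by apply: sumr_ge0 => k _; rewrite mul1r walk_ge0. Qed.

Lemma walk_mass_renewal z B : (cutoff z <= B)%N ->
  walk_mass z = walk 0 z + \sum_(0 <= p < B) weight p * walk_mass (z - step p).
Proof. by move=> zB; rewrite /walk_mass (walk_sum_renewal _ zB) mul1r. Qed.

(** Monotonicity of counts: a larger bound on the product admits more sequences. It is the only
    regularity in z that is available, since the counts jump. *)
Lemma walk_expR_homo k z z' : z <= z' ->
  expR (rho * z) * walk k z <= expR (rho * z') * walk k z'.
Proof.
elim: k z z' => [|k IH] z z' zz' /=.
  case: ifPn => [z0|_].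
    by rewrite (le_trans z0 zz') -!expRD !mulNr !subrr.
  by rewrite mulr0; case: ifP => // _; rewrite mulr_ge0// expR_ge0.
rewrite -!/(walk k.+1 _) (walkS _ (le_cutoff zz')) (walkS _ (leqnn (cutoff z'))).
rewrite !mulr_sumr; apply: ler_sum => p _; rewrite !(mulrCA _ (weight p)).
apply: ler_weight => Pp.
have e y : expR (rho * y) = expR (rho * step p) * expR (rho * (y - step p)).
  by rewrite -expRD; congr expR; ring.
rewrite (e z) (e z') -!mulrA ler_pM2l ?expR_gt0//; apply: IH; lra.
Qed.

Lemma walk_mass_expR_homo z z' : z <= z' ->
  expR (rho * z) * walk_mass z <= expR (rho * z') * walk_mass z'.
Proof.
move=> zz'; rewrite /walk_mass (@walk_sumE _ _ (cutoff z')) ?le_cutoff//.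
rewrite /walk_sum !mulr_sumr; apply: ler_sum => k _.
by rewrite !mul1r; exact: walk_expR_homo.
Qed.

(** Induction on the number of blocks of length ln 2 above z0, since each step descends by at least
    one block. States are abstract so that they can carry a second coordinate moved by the drift,
    and S restricts them to invariant shifts. *)
Lemma max_principle (I : Type) (S : I -> Prop) (pos : I -> R)
    (next : I -> nat -> I) (u : I -> R) (b : R -> R) (z0 : R) :
  (forall i p, S i -> P p -> S (next i p)) ->
  (forall i p, S i -> P p -> pos (next i p) = pos i - step p) ->
  (forall i, S i -> pos i < z0 -> u i <= b (pos i)) ->
  (forall i, S i -> z0 <= pos i ->
     (forall p, P p -> u (next i p) <= b (pos i - step p)) -> u i <= b (pos i)) ->
  forall i, S i -> u i <= b (pos i).
Proof.
move=> nextS pos_next below above.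
suff H n i : S i -> pos i < z0 + n%:R * ln 2 -> u i <= b (pos i).
  move=> i Si; pose n := (Num.truncn (Num.max 0 ((pos i - z0) / ln 2))).+1.
  apply: (H n) => //; rewrite -ltrBlDl -ltr_pdivrMr ?ln2_gt0//.
  apply: le_lt_trans (truncnS_gt _); by rewrite le_max lexx orbT.
elim: n i => [|n IH] i Si; first by rewrite mul0r addr0; exact: below.
move=> iz; have [iz0|iz0] := ltP (pos i) z0; first exact: below.
apply: above => // p Pp; rewrite -pos_next//; apply: IH; first exact: nextS.
rewrite pos_next//; have := step_ge Pp.
by move: iz; rewrite -addn1 natrD mulrDl mul1r; lra.
Qed.

(** * The barrier, and two-sided bounds on the total mass *)

Context (theta l1 l2 m1 : R).
Hypothesis theta_gt0 : 0 < theta.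
Hypothesis theta_le : theta <= rho.
Hypothesis mean_1 : has_mean (fun=> 1) 1.
Hypothesis mean_step : has_mean step m1.
Hypothesis mean_expR1 : has_mean (fun p => expR (theta * step p)) l1.
Hypothesis mean_expR2 : has_mean (fun p => expR (2 * theta * step p)) l2.

Lemma mean_step_gt0 : 0 < m1.
Proof.
apply: lt_le_trans ln2_gt0 _; rewrite -(mulr1 (ln 2)).
apply: has_mean_le (has_meanZ (ln 2) mean_1) mean_step _ => p Pp.
by rewrite mulr1; exact: step_ge.
Qed.

Lemma mean_expR1_gt1 : 1 < l1.
Proof.
have : 1 + theta * m1 <= l1.
  apply: has_mean_le mean_expR1 _; first exact: has_meanD mean_1 (has_meanZ theta mean_step).
  by move=> p _; exact: expR_ge1Dx.
by apply: lt_le_trans; rewrite ltrDl mulr_gt0// mean_step_gt0.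
Qed.

Lemma mean_expR2_ge1 : 1 <= l2.
Proof.
apply: has_mean_le mean_1 mean_expR2 _ => p Pp.
by rewrite -expR0 ler_expR !mulr_ge0// ltW// step_gt0.
Qed.

(** The solution c of 2 c (l1 - 1) = l2. With x <= 1, the average drop x (2 c (l1 - 1) - x (l2 - 1))
    of the squared term is then at least x, which is what the source terms consume. *)
Definition barrier_coef : R := l2 / (2 * (l1 - 1)).

Lemma barrier_coefE : 2 * barrier_coef * (l1 - 1) = l2.
Proof.
rewrite /barrier_coef; field; have := mean_expR1_gt1.
by move=> h; rewrite subr_eq0 gt_eqF.
Qed.

Lemma barrier_coef_ge0 : 0 <= barrier_coef.
Proof.
have := mean_expR1_gt1; have := mean_expR2_ge1 => h2 h1.
by rewrite divr_ge0//; lra.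
Qed.

(* The square makes the barrier large far below [z0], where a step may land,
   while above [z0] it is dominated by the decreasing cross term, which is
   superharmonic because [1 < l1]. *)
Definition barrier (eps beta D K z0 z : R) : R :=
  eps + beta * (z - z0 + K) + D * (barrier_coef - expR (theta * (z0 - z))) ^+ 2.

(** Each parameter pays for one kind of error: eps for an initial discrepancy, the linear term for a
    source beta m1 at every step, and D for a source decaying like e^(- theta z). *)
Lemma barrier_superharmonic eps beta D K z0 z : 0 <= D -> z0 <= z ->
  exists2 M, has_mean (fun p => barrier eps beta D K z0 (z - step p)) M &
    M + beta * m1 + D * expR (theta * (z0 - z)) <= barrier eps beta D K z0 z.
Proof.
move=> D0 z0z; set x := expR _; set c := barrier_coef.
exists ((eps + beta * (z - z0 + K) + D * c ^+ 2) * 1 + (- beta) * m1 +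
        ((- 2 * c * D * x) * l1 + (D * x ^+ 2) * l2)).
  apply: eq_has_mean; last first.
    apply: (has_meanD (has_meanD (has_meanZ _ mean_1) (has_meanZ _ mean_step))
       (has_meanD (has_meanZ _ mean_expR1) (has_meanZ _ mean_expR2))).
  move=> p _; rewrite /barrier -/c.
  have -> : expR (theta * (z0 - (z - step p))) = x * expR (theta * step p).
    by rewrite /x -expRD; congr expR; ring.
  have -> : expR (2 * theta * step p) = expR (theta * step p) ^+ 2.
    by rewrite -expRM_natl; congr expR; ring.
  by ring.
rewrite /barrier -/c -/x; have x1 : x <= 1.
  by rewrite -expR0 ler_expR pmulr_rle0// subr_le0.
have x0 : 0 < x by exact: expR_gt0.
have := barrier_coefE; rewrite -/c => cE; have := mean_expR2_ge1 => l21.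
rewrite -subr_ge0.
have -> : eps + beta * (z - z0 + K) + D * (c - x) ^+ 2 -
  ((eps + beta * (z - z0 + K) + D * c ^+ 2) * 1 + - beta * m1 +
    (- 2 * c * D * x * l1 + D * x ^+ 2 * l2) + beta * m1 + D * x) =
  D * x * (2 * c * (l1 - 1) - x * (l2 - 1) - 1) by ring.
rewrite cE !mulr_ge0//; first exact: ltW.
have : x * (l2 - 1) <= 1 * (l2 - 1) by apply: ler_wpM2r; lra.
lra.
Qed.

(** Nonnegativity lets the finite sum of the renewal equation be bounded by the full mean. *)
Lemma barrier_step eps beta D K z0 z B : 0 <= D -> z0 <= z ->
  (forall p, P p -> 0 <= barrier eps beta D K z0 (z - step p)) ->
  \sum_(0 <= p < B) weight p * barrier eps beta D K z0 (z - step p) +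
    beta * m1 + D * expR (theta * (z0 - z)) <= barrier eps beta D K z0 z.
Proof.
move=> D0 z0z b0; have [M hM] := barrier_superharmonic eps beta K D0 z0z.
by apply: le_trans; rewrite -!addrA lerD2r; exact: sum_le_has_mean.
Qed.

Lemma barrier_le eps beta D K z0 z : 0 <= D -> z0 <= z ->
  barrier eps beta D K z0 z <=
  eps + beta * (z - z0 + K) + D * (barrier_coef + 1) ^+ 2.
Proof.
move=> D0 z0z; rewrite lerD2l ler_wpM2l//.
have x1 : expR (theta * (z0 - z)) <= 1.
  by rewrite -expR0 ler_expR pmulr_rle0// subr_le0.
have := expR_gt0 (theta * (z0 - z)); have := barrier_coef_ge0 => c0 x0.
rewrite -subr_ge0 subr_sqr mulr_ge0//; lra.
Qed.

(** Below z0 - K the exponential x is at least 2 c, so that |c - x| >= x / 2. *)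
Lemma barrier_far D K z0 z : 0 <= D -> 2 * barrier_coef <= expR (theta * K) ->
  z <= z0 - K ->
  D / 4 * expR (2 * theta * (z0 - z)) <=
  D * (barrier_coef - expR (theta * (z0 - z))) ^+ 2.
Proof.
move=> D0 cK zK; rewrite -mulrA ler_wpM2l//; set x := expR (theta * _).
have -> : expR (2 * theta * (z0 - z)) = x ^+ 2.
  by rewrite -expRM_natl; congr expR; ring.
have : 2 * barrier_coef <= x.
  by apply: le_trans cK _; rewrite ler_expR ler_pM2l//; lra.
have := barrier_coef_ge0; set c := barrier_coef => c0 cx; rewrite -subr_ge0.
have -> : (c - x) ^+ 2 - 4^-1 * x ^+ 2 =
  (x - 2 * c) * (3 / 4 * x + - (c / 2)) by field.
by rewrite mulr_ge0//; lra.
Qed.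

Lemma walk0_le z : walk 0 z <= expR (- theta * z).
Proof.
rewrite /=; case: ifPn => [z0|_]; last exact: expR_ge0.
by rewrite ler_expR !mulNr lerN2 ler_wpM2r.
Qed.

Definition mass_bound : R := (barrier_coef + 1) ^+ 2.

Lemma mass_bound_ge1 : 1 <= mass_bound.
Proof.
have c0 := barrier_coef_ge0; have : 0 <= (barrier_coef + 1) * barrier_coef.
  by rewrite mulr_ge0//; lra.
rewrite /mass_bound expr2; lra.
Qed.

Lemma walk_mass_le z : walk_mass z <= mass_bound.
Proof.
have [z0|z0] := ltP z 0.
  by rewrite /walk_mass walk_sum_lt0// (le_trans _ mass_bound_ge1).
(* The source [walk 0] is at most e^(- theta z), the slack of the barrier for D = 1 and z0 = 0. *)
pose b := barrier 0 0 1 0 0.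
have b0 y : 0 <= b y by rewrite /b /barrier mul0r !add0r mul1r sqr_ge0.
apply: (@le_trans _ _ (b z)); last first.
  by apply: le_trans (barrier_le _ _ _ _ z0) _ => //; rewrite mul0r !add0r mul1r.
apply: (@max_principle R (fun=> True) id (fun z p => z - step p) walk_mass b 0)
  => // [y _ y0|y _ y0 IH].
  by rewrite /walk_mass walk_sum_lt0.
rewrite (walk_mass_renewal (leqnn (cutoff y))).
have := @barrier_step 0 0 1 0 0 y (cutoff y) ler01 y0 (fun p _ => b0 _).
apply: le_trans; rewrite mul0r addr0 mul1r addrC lerD//.
  by apply: ler_sum => p _; apply: ler_weight; exact: IH.
by apply: le_trans (walk0_le _) _; rewrite ler_expR; lra.
Qed.

(** The maximum principle applied to a - [walk_mass], where a is a lower bound of the mass on an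
    initial window. *)
Lemma walk_mass_ge : exists2 c, 0 < c & forall z, 0 <= z -> c <= walk_mass z.
Proof.
have c0 := barrier_coef_ge0; set c := barrier_coef in c0 *.
(* On [0, K] the term [walk 0] alone is at least a. As e^(theta K) = 4 (c + 1), the D below makes
   the barrier at least a at negative positions, yet at most a / 4 beyond K. *)
pose K := ln (4 * (c + 1)) / theta; pose a := expR (- rho * K).
have eK : expR (theta * K) = 4 * (c + 1).
  rewrite /K mulrC divfK ?gt_eqF// lnK// posrE; lra.
have K0 : 0 <= K by rewrite divr_ge0 ?ln_ge0 ?(ltW theta_gt0)//; lra.
have a0 : 0 < a by exact: expR_gt0.
pose D := a * (4 * (4 * (c + 1)) ^- 2).
have c10 : 0 < c + 1 by lra.
have D0 : 0 <= D by rewrite !mulr_ge0 ?invr_ge0 ?exprn_ge0 ?ltW//; lra.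
have DE : D * (c + 1) ^+ 2 = a / 4 by rewrite /D; field; lra.
have near_ge z : 0 <= z -> z <= K -> a <= walk_mass z.
  move=> z0 zK; rewrite (walk_mass_renewal (leqnn (cutoff z))) /= z0.
  rewrite (@le_trans _ _ (expR (- rho * z)))//.
    by rewrite ler_expR !mulNr lerN2 ler_pM2l// (lt_le_trans theta_gt0).
  rewrite lerDl sumr_ge0// => p _.
  by rewrite mulr_ge0 ?weight_ge0// walk_mass_ge0.
have rho_gt0 : 0 < rho by exact: lt_le_trans theta_le.
pose b := barrier 0 0 D K K.
have b0 y : 0 <= b y by rewrite /b /barrier mul0r !add0r mulr_ge0// sqr_ge0.
have H z : a - walk_mass z <= b z.
  apply: (@max_principle R (fun=> True) id (fun z p => z - step p)
    (fun z => a - walk_mass z) b K) => // [y _ yK|y _ yK IH].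
    have [y0|y0] := leP 0 y.
      by apply: le_trans (b0 _); rewrite subr_le0 near_ge// ltW.
    rewrite /walk_mass walk_sum_lt0// subr0 /b /barrier mul0r !add0r.
    apply: le_trans (@barrier_far D K K y D0 _ _); last 2 first.
    - by rewrite eK -/c; lra.
    - by rewrite subrr ltW.
    have : expR (2 * theta * K) <= expR (2 * theta * (K - y)).
      by rewrite ler_expR ler_pM2l ?mulr_gt0//; lra.
    have -> : expR (2 * theta * K) = (4 * (c + 1)) ^+ 2.
      by rewrite -eK -expRM_natl; congr expR; ring.
    have D40 : 0 <= D / 4 by rewrite divr_ge0.
    move=> /(ler_wpM2l D40); apply: le_trans.
    by rewrite le_eqVlt; apply/orP; left; rewrite /D; apply/eqP; field; lra.
  have [M hM MB] := @barrier_superharmonic 0 0 D K K y D0 yK.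
  (* Only the full series of weights reproduces the constant a, hence a passage to the limit instead
     of [barrier_step]. *)
  suff : a - walk_mass y <= a + (M + (- a) * 1).
    rewrite mulr1 addrCA subrr addr0 => /le_trans; apply; apply: le_trans MB.
    by rewrite mul0r addr0 lerDl mulr_ge0// expR_ge0.
  have cvg_r : a + \sum_(0 <= p < B) weight p *
       (barrier 0 0 D K K (y - step p) + (- a) * 1) @[B --> \oo] --> a + (M + (- a) * 1).
    by apply: cvgD; [exact: cvg_cst|exact: has_meanD hM (has_meanZ (- a) mean_1)].
  apply: (ler_cvg_to (cvg_cst (a - walk_mass y)) cvg_r).
  exists (cutoff y) => // B /= yB; rewrite lerD2l (walk_mass_renewal yB).
  apply: (@le_trans _ _ (\sum_(0 <= p < B) weight p * (- walk_mass (y - step p)))).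
    under [leRHS]eq_bigr do rewrite mulrN.
    by rewrite sumrN lerN2 lerDr; exact: (walk_ge0 0).
  apply: ler_sum => p _; apply: ler_weight => Pp; have := IH p Pp; rewrite /b; lra.
exists (a / 2) => [|z z0]; first lra.
have [zK|zK] := leP z K; first by apply: le_trans (near_ge _ z0 zK); lra.
have := H z; have := @barrier_le 0 0 D K K z D0 (ltW zK).
rewrite -/c mul0r !add0r DE /b; lra.
Qed.

(** Exponential Markov inequality: for fixed k the contribution of k steps vanishes as z grows. *)
Lemma walk_le_expR k z : walk k z <= l1 ^+ k * expR (- theta * z).
Proof.
elim: k z => [|k IH] z; first by rewrite mul1r; exact: walk0_le.
rewrite (walkS k (leqnn (cutoff z))) exprSr -mulrA.
apply: (@le_trans _ _ (\sum_(0 <= p < cutoff z)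
   weight p * (l1 ^+ k * expR (- theta * z) * expR (theta * step p)))).
  apply: ler_sum => p _; apply: ler_weight => Pp; apply: le_trans (IH _) _.
  by rewrite -mulrA -expRD; rewrite le_eqVlt; apply/orP; left; apply/eqP; congr (_ * expR _); ring.
rewrite [l1 * _]mulrC mulrA.
apply: sum_le_has_mean; last exact: has_meanZ.
move=> p Pp; rewrite !mulr_ge0 ?expR_ge0// exprn_ge0//.
by rewrite (le_trans ler01)// ltW// mean_expR1_gt1.
Qed.

(** The number of steps tends to infinity: less than K steps carry an exponentially small mass by
    [walk_le_expR], and otherwise the factor is below 1 / K. This controls the error in
    [walk_mass_almost_convex]. *)
Lemma walk_sum_inv_to0 (e : R) : 0 < e -> exists T : R, forall z : R, T <= z ->
  walk_sum (fun k => k.+1%:R^-1) z <= e.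
Proof.
move=> e0; pose C := mass_bound; have C1 : 1 <= C by exact: mass_bound_ge1.
pose K := (Num.truncn (2 * C / e)).+1.
have KC : C * K%:R^-1 <= e / 2.
  have : 2 * C / e < K%:R by exact: truncnS_gt.
  rewrite ltr_pdivrMr// => h.
  by rewrite ler_pdivrMr ?ltr0n//; lra.
pose A := K%:R * l1 ^+ K.
have l11 := mean_expR1_gt1.
have A0 : 0 < A by rewrite mulr_gt0 ?ltr0n// exprn_gt0// (lt_trans ltr01).
exists (ln (2 * A / e) / theta) => z Tz.
have small : A * expR (- theta * z) <= e / 2.
  have : 2 * A / e <= expR (theta * z).
    have Ae : 0 < 2 * A / e by rewrite divr_gt0// mulr_gt0.
    rewrite -(@lnK _ (2 * A / e))//.
    by rewrite ler_expR [theta * z]mulrC -ler_pdivrMr.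
  rewrite ler_pdivrMr// mulNr expRN => h.
  by rewrite ler_pdivrMr ?expR_gt0//; lra.
have [KB zB] : (K <= maxn K (cutoff z))%N /\ (cutoff z <= maxn K (cutoff z))%N.
  by rewrite leq_maxl leq_maxr.
rewrite (walk_sumE _ zB); set B := maxn _ _ in KB zB *.
rewrite (big_cat_nat (leq0n _) KB)/=.
have h1 : \sum_(0 <= k < K) k.+1%:R^-1 * walk k z <= e / 2.
  apply: le_trans small.
  have -> : A * expR (- theta * z) = \sum_(0 <= k < K) (l1 ^+ K * expR (- theta * z)).
    by rewrite sumr_const_nat subn0 -[RHS]mulr_natl mulrA.
  rewrite !big_nat; apply: ler_sum => k /andP[_ kK].
  apply: (@le_trans _ _ (1 * walk k z)).
    by rewrite ler_wpM2r ?walk_ge0// invf_le1 ?ltr0n// ler1n.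
  rewrite mul1r; apply: le_trans (walk_le_expR _ _) _.
  by rewrite ler_wpM2r ?expR_ge0// ler_weXn2l ?(ltW l11)// ltnW.
have h2 : \sum_(K <= k < B) k.+1%:R^-1 * walk k z <= e / 2.
  apply: le_trans KC; apply: (@le_trans _ _ (walk_mass z * K%:R^-1)); last first.
    by rewrite ler_wpM2r ?invr_ge0// walk_mass_le.
  rewrite /walk_mass (walk_sumE _ zB) (big_cat_nat (leq0n _) KB)/= mulrDl.
  rewrite -[leLHS]add0r lerD//.
    by rewrite mulr_ge0 ?invr_ge0// sumr_ge0// => k _; rewrite mul1r walk_ge0.
  rewrite mulr_suml !big_nat; apply: ler_sum => k /andP[Kk _]; rewrite mul1r mulrC.
  by rewrite ler_wpM2l ?walk_ge0// lef_pV2 ?posrE ?ltr0n// ler_nat ltnW.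
lra.
Qed.

(** * Almost convexity of the total mass along one step *)

Section shift_by_step.
Variable p0 : nat.
Hypothesis Pp0 : P p0.
Let w0 := weight p0.
Let s0 := step p0.

(* The expectation of [(a - B)^2 [S_k <= z] e^(- rho * (z - S_k))], with [B] the
   number of steps of [S_k] equal to [s0]; exchangeability of the steps gives
   the first two moments of [B]. *)
Let moment (k : nat) (a z : R) : R :=
  a ^+ 2 * walk k z - 2 * a * (k%:R * walk k.-1 (z - s0)) * w0 +
  k%:R * (k%:R - 1) * walk k.-2 (z - s0 - s0) * w0 ^+ 2 +
  k%:R * walk k.-1 (z - s0) * w0.

(** Nonnegativity of a mean square, by conditioning on the first step: a step p0 adds one to B,
    which amounts to replacing a by a - 1, and any other step leaves a unchanged. *)
Lemma moment_ge0 k a z : 0 <= moment k a z.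
Proof.
elim: k a z => [|k IH] a z.
  rewrite /moment !mul0r !mulr0 mul0r subr0 !addr0.
  by rewrite mulr_ge0 ?sqr_ge0//; exact: (walk_ge0 0).
pose B := maxn p0.+1 (cutoff z).
have zB : (cutoff z <= B)%N by rewrite leq_maxr.
have pB : (p0 < B)%N by rewrite leq_maxl.
have s00 : 0 <= s0 by rewrite ltW// step_gt0.
have B1 : (cutoff (z - s0) <= B)%N by apply: leq_trans zB; apply: le_cutoff; lra.
have B2 : (cutoff (z - s0 - s0) <= B)%N by apply: leq_trans B1; apply: le_cutoff; lra.
suff -> : moment k.+1 a z = \sum_(0 <= p < B) weight p *
   (moment k a (z - step p) + (p == p0)%:R *
     (moment k (a - 1) (z - s0) - moment k a (z - s0))).
  apply: sumr_ge0 => p _; rewrite mulr_ge0 ?weight_ge0//.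
  case: eqP => [->|_]; last by rewrite mul0r addr0.
  by rewrite mul1r -/s0 addrC subrK.
under eq_bigr do rewrite mulrDr; rewrite big_split/=.
have -> : \sum_(0 <= p < B) weight p * ((p == p0)%:R *
     (moment k (a - 1) (z - s0) - moment k a (z - s0))) =
   w0 * (moment k (a - 1) (z - s0) - moment k a (z - s0)).
  rewrite (bigD1_seq p0) ?iota_uniq ?mem_index_iota//= eqxx mul1r big1 ?addr0//.
  by move=> p /negbTE ->; rewrite mul0r mulr0.
(* The factors k and k (k - 1) vanish exactly where the predecessors [k.-1] and [k.-2] are
   truncated. *)
have e1 : k%:R * \sum_(0 <= p < B) weight p * walk k.-1 (z - s0 - step p) =
    k%:R * walk k (z - s0).
  by case: k {IH} => [|k]; [rewrite !mul0r|rewrite -(walkS k B1)].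
have e2 : k%:R * (k%:R - 1) *
    \sum_(0 <= p < B) weight p * walk k.-2 (z - s0 - s0 - step p) =
    k%:R * (k%:R - 1) * walk k.-1 (z - s0 - s0).
  case: k {IH e1} => [|[|k]]; rewrite ?subrr ?mulr0 ?mul0r//.
  by rewrite -(walkS k B2).
have -> : \sum_(0 <= p < B) weight p * moment k a (z - step p) =
  a ^+ 2 * walk k.+1 z - 2 * a * (k%:R * walk k (z - s0)) * w0 +
  k%:R * (k%:R - 1) * walk k.-1 (z - s0 - s0) * w0 ^+ 2 +
  k%:R * walk k (z - s0) * w0.
  rewrite -e1 -e2 (walkS k zB) !(mulr_sumr, mulr_suml) -sumrN.
  rewrite -!big_split/=.
  apply: eq_bigr => p _; rewrite /moment.
  have -> : z - step p - s0 = z - s0 - step p by ring.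
  have -> : z - s0 - step p - s0 = z - s0 - s0 - step p by ring.
  by ring.
rewrite /moment /= -natr1; ring.
Qed.

(** For k steps take a = w0 k, the expected number of steps s0, divide the mean square by a^2 and
    sum over k. The second difference appears, up to the term 1 / (w0 k) contributed by the variance
    of B. *)
Lemma walk_mass_almost_convex z :
  - (w0^-1 * walk_sum (fun k => k.+1%:R^-1) (z - s0)) <=
  walk_mass z - 2 * walk_mass (z - s0) + walk_mass (z - s0 - s0).
Proof.
have s00 : 0 <= s0 by rewrite ltW// step_gt0.
have w00 : 0 < w0 by exact: weight_gt0.
pose B := cutoff z.
have B0 : (cutoff z <= B.+1)%N by [].
have B1 : (cutoff (z - s0) <= B)%N by apply: le_cutoff; lra.
have B2 : (cutoff (z - s0 - s0) <= B)%N by apply: le_cutoff; lra.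
have term j : 0 <= walk j.+1 z - 2 * walk j (z - s0) +
   (1 - j.+1%:R^-1) * walk j.-1 (z - s0 - s0) +
   w0^-1 * (j.+1%:R^-1 * walk j (z - s0)).
  have j0 : (0 : R) < j.+1%:R by rewrite ltr0n.
  have := moment_ge0 j.+1 (w0 * j.+1%:R) z.
  rewrite -(pmulr_lge0 _ (_ : 0 < (w0 * j.+1%:R) ^- 2)); last first.
    by rewrite invr_gt0 exprn_gt0// mulr_gt0.
  congr (0 <= _); rewrite /moment /=; field.
  by rewrite !gt_eqF.
have : 0 <= \sum_(0 <= j < B) (walk j.+1 z - 2 * walk j (z - s0) +
   (1 - j.+1%:R^-1) * walk j.-1 (z - s0 - s0) +
   w0^-1 * (j.+1%:R^-1 * walk j (z - s0))) by apply: sumr_ge0 => j _.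
rewrite 2!big_split/= sumrB -!mulr_sumr -(walk_sumE _ B1).
have -> : \sum_(0 <= j < B) walk j.+1 z = walk_mass z - walk 0 z.
  by rewrite (walk_massE B0) [in RHS]big_nat_recl// addrAC subrr add0r.
have -> : \sum_(0 <= j < B) walk j (z - s0) = walk_mass (z - s0).
  by rewrite (walk_massE B1).
(* At j = 0 the truncated predecessor yields a spurious [walk 0], but its coefficient is 1 - 1. *)
have : \sum_(0 <= j < B) (1 - j.+1%:R^-1) * walk j.-1 (z - s0 - s0) <=
    walk_mass (z - s0 - s0).
  rewrite (walk_massE B2) /B /cutoff big_nat_recl// invr1 subrr mul0r add0r.
  rewrite [leRHS]big_nat_recr//=.
  rewrite -[leLHS]addr0 lerD// ?walk_ge0//; apply: ler_sum => j _.
  by rewrite ler_piMl ?walk_ge0// gerBl invr_ge0.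
have := walk_ge0 0 z; lra.
Qed.

End shift_by_step.

(** * Asymptotic invariance of the total mass under shifts *)

Lemma walk_mass_shift_step p (e : R) : P p -> 0 < e ->
  exists T : R, forall z : R, T <= z -> `|walk_mass z - walk_mass (z - step p)| <= e.
Proof.
move=> Pp; apply: (@almost_convex_shift _ walk_mass mass_bound).
- exact: step_gt0.
- by move=> z; rewrite walk_mass_ge0 walk_mass_le.
- move=> d d0; have w0 := weight_gt0 Pp.
  have [T HT] := walk_sum_inv_to0 (mulr_gt0 w0 d0).
  exists (T + step p) => z Tz; apply: le_trans (walk_mass_almost_convex Pp z).
  rewrite lerN2 mulrC ler_pdivrMr// mulrC; apply: HT; lra.
Qed.

(** These shifts form a group containing every step. In the lattice case it is not all of R, so
    invariance is a predicate on g and not a theorem for every g. *)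
Definition shift_invariant (g : R) : Prop := forall e : R, 0 < e ->
  exists T : R, forall z : R, T <= z -> `|walk_mass (z - g) - walk_mass z| <= e.

Lemma shift_invariant_step p : P p -> shift_invariant (step p).
Proof.
move=> Pp e /(walk_mass_shift_step Pp)[T HT]; exists T => z /HT.
by rewrite distrC.
Qed.

Lemma shift_invariant0 : shift_invariant 0.
Proof. by move=> e e0; exists 0 => z _; rewrite subr0 subrr normr0 ltW. Qed.

Lemma shift_invariantN g : shift_invariant g -> shift_invariant (- g).
Proof.
move=> hg e /hg[T HT]; exists (T - g) => z Tz.
have /HT : T <= z - - g by lra.
by rewrite distrC; have -> : z - - g - g = z by ring.
Qed.

Lemma shift_invariantD g h :
  shift_invariant g -> shift_invariant h -> shift_invariant (g + h).
Proof.
move=> hg hh e e0; have [T HT] := hg (e / 2) ltac:(lra).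
have [T' HT'] := hh (e / 2) ltac:(lra).
exists (Num.max (T + h) T') => z; rewrite ge_max => /andP[Tz T'z].
have h1 : `|walk_mass (z - h - g) - walk_mass (z - h)| <= e / 2 by apply: HT; lra.
have h2 := HT' z T'z.
have -> : z - (g + h) = z - h - g by ring.
rewrite (le_trans (ler_distD (walk_mass (z - h)) _ _))//; lra.
Qed.

Lemma shift_invariantMn g n : shift_invariant g -> shift_invariant (n%:R * g).
Proof.
move=> hg; elim: n => [|n IH]; first by rewrite mul0r; exact: shift_invariant0.
by rewrite -natr1 mulrDl mul1r; exact: shift_invariantD.
Qed.

Lemma eventually_all (n : nat) (Q : nat -> R -> Prop) :
  (forall i, (i < n)%N -> exists T : R, forall z : R, T <= z -> Q i z) ->
  exists T : R, forall z : R, T <= z -> forall i, (i < n)%N -> Q i z.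
Proof.
elim: n => [|n IH] H; first by exists 0.
have [T HT] := IH (fun i ni => H i (ltnW ni)).
have [T' HT'] := H n (leqnn _).
exists (Num.max T T') => z; rewrite ge_max => /andP[Tz T'z] i.
by rewrite ltnS leq_eqVlt => /predU1P[->|]; [exact: HT'|exact: HT].
Qed.

(* Either the group of invariant shifts has an element in [(0, eta]], whose
   multiples approximate every shift, or its elements are [eta]-separated, and
   only finitely many lie in [[0, K]]. *)
Lemma shift_invariant_uniform (K e : R) : 0 <= K -> 0 < e ->
  exists T : R, forall z : R, T <= z -> forall s : R, 0 <= s -> s <= K -> shift_invariant s ->
    `|walk_mass (z - s) - walk_mass z| <= e.
Proof.
move=> K0 e0; have C1 := mass_bound_ge1; set C := mass_bound in C1.
have rho_gt0 : 0 < rho by exact: lt_le_trans theta_le.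
have e4C : 0 < e / (4 * C) by rewrite divr_gt0//; lra.
(* Since e^(rho z) [walk_mass] z is nondecreasing, the mass may jump up, but over a length eta it
   drops by at most C (e^(rho eta) - 1) = e / 4. *)
pose eta := ln (1 + e / (4 * C)) / rho.
have eta0 : 0 < eta by rewrite divr_gt0// ln_gt0//; lra.
have etaE : C * (expR (rho * eta) - 1) <= e / 2.
  rewrite /eta mulrC [rho * _]mulrC divfK ?gt_eqF// lnK ?posrE; last lra.
  have -> : (1 + e / (4 * C) - 1) * C = e / 4 by field; lra.
  lra.
have mono z s s' : s <= s' -> s' <= s + eta ->
    walk_mass (z - s') - e / 2 <= walk_mass (z - s).
  move=> ss' s's; have := @walk_mass_expR_homo (z - s') (z - s) ltac:(lra).
  have -> : expR (rho * (z - s)) = expR (rho * (s' - s)) * expR (rho * (z - s')).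
    by rewrite -expRD; congr expR; ring.
  rewrite -mulrA mulrCA ler_pM2l ?expR_gt0// => h.
  have wC := walk_mass_le (z - s); have w0 := walk_mass_ge0 (z - s).
  have x1 : expR (rho * (s' - s)) <= expR (rho * eta).
    by rewrite ler_expR ler_pM2l//; lra.
  have x2 : 1 <= expR (rho * eta) by rewrite -expR0 ler_expR mulr_ge0// ltW.
  have : expR (rho * (s' - s)) * walk_mass (z - s) <=
         expR (rho * eta) * walk_mass (z - s) by rewrite ler_wpM2r.
  have : (expR (rho * eta) - 1) * walk_mass (z - s) <= (expR (rho * eta) - 1) * C.
    by rewrite ler_wpM2l//; lra.
  lra.
have [[g [hg g0 geta]]|nog] := pselect (exists g, [/\ shift_invariant g, 0 < g & g <= eta]).
  pose n := (Num.truncn (K / g)).+2.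
  have [T HT] : exists T : R, forall z : R, T <= z -> forall i, (i < n.+1)%N ->
      `|walk_mass (z - i%:R * g) - walk_mass z| <= e / 2.
    apply: eventually_all => i _; apply: (shift_invariantMn i hg); lra.
  exists T => z Tz s s0 sK hs.
  pose i := Num.truncn (s / g).
  have sg0 : 0 <= s / g by rewrite divr_ge0// ltW.
  have /andP[i1 i2] := truncn_itv sg0.
  rewrite -/i in i1 i2; rewrite ler_pdivlMr// in i1; rewrite ltr_pdivrMr// in i2.
  have ni : (i < n)%N.
    by rewrite /n ltnS leqW// le_truncn// ler_wpM2r// invr_ge0 ltW.
  have := HT z Tz i (ltnW ni); have := HT z Tz i.+1 ni.
  rewrite !ler_distl => /andP[a1 a2] /andP[b1 b2].
  rewrite -natr1 mulrDl mul1r in i2 a1 a2.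
  (* s lies between consecutive multiples of g, where the mass is known within e / 2; one-sided
     continuity costs another e / 2 on each side. *)
  have := mono z (i%:R * g) s i1 ltac:(lra).
  have := mono z s (i%:R * g + g) ltac:(lra) ltac:(lra).
  move=> c1 c2; apply/andP; split; lra.
pose n := (Num.truncn (K / eta)).+1.
pose cell i s := [/\ shift_invariant s, i%:R * eta <= s & s < i.+1%:R * eta].
have [T HT] : exists T : R, forall z : R, T <= z -> forall i, (i < n)%N ->
    forall s, cell i s -> `|walk_mass (z - s) - walk_mass z| <= e.
  apply: eventually_all => i _.
  have [[g gi]|no] := pselect (exists g, cell i g); last first.
    by exists 0 => z _ s si; exfalso; apply: no; exists s.
  have [hg g1 g2] := gi; have [T HT] := hg _ e0.
  exists T => z Tz s [hs s1 s2]; suff -> : s = g by exact: HT.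
  rewrite -natr1 mulrDl mul1r in s2 g2.
  apply/eqP/negP => /negP sg; apply: nog.
  have [lt_sg|lt_gs|eq_sg] := ltgtP s g; last by rewrite eq_sg eqxx in sg.
  - exists (g - s); split; [|lra|lra].
    exact: shift_invariantD hg (shift_invariantN hs).
  - exists (s - g); split; [|lra|lra].
    exact: shift_invariantD hs (shift_invariantN hg).
exists T => z Tz s s0 sK hs; apply: (HT z Tz (Num.truncn (s / eta))).
  by rewrite ltnS le_truncn// ler_wpM2r// invr_ge0 ltW.
have sg0 : 0 <= s / eta by rewrite divr_ge0// ltW.
have /andP[i1 i2] := truncn_itv sg0.
by split => //; rewrite -?ler_pdivlMr// -ltr_pdivrMr.
Qed.

(** Upgrades invariance under bounded shifts to all z beyond L. On the window [L - K, L] it is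
    [shift_invariant_uniform]; the maximum principle propagates it upwards, and landings below the
    window are charged to the D-part of the barrier. *)
Lemma walk_mass_asymp_const (e : R) : 0 < e -> exists T : R, forall L z : R,
  T <= L -> L <= z -> shift_invariant (z - L) -> `|walk_mass z - walk_mass L| <= e.
Proof.
move=> e0; have C1 := mass_bound_ge1; set C := mass_bound in C1.
have c0 := barrier_coef_ge0; set c := barrier_coef in c0.
(* A is e^(theta K): at least 2 c for [barrier_far], and so large that D = 8 C / A^2 dominates C
   below the window while D (c + 1)^2 <= e / 2 above L. *)
pose A := 2 * c + 1 + 16 * C * (c + 1) ^+ 2 / e.
have A2 : 0 <= 16 * C * (c + 1) ^+ 2 / e.
  by rewrite divr_ge0 ?(ltW e0)// mulr_ge0 ?sqr_ge0// mulr_ge0//; lra.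
have A1 : 1 <= A by rewrite /A; lra.
pose K := ln A / theta.
have eK : expR (theta * K) = A.
  by rewrite /K mulrC divfK ?gt_eqF// lnK// posrE; lra.
have K0 : 0 <= K by rewrite divr_ge0 ?ln_ge0 ?(ltW theta_gt0).
have [T HT] := @shift_invariant_uniform K (e / 2) K0 ltac:(lra).
pose D := 8 * C * A ^- 2.
have A0 : 0 < A by lra.
have D0 : 0 < D by rewrite /D divr_gt0 ?exprn_gt0//; lra.
have DE : D * (c + 1) ^+ 2 <= e / 2.
  have A3 : 16 * C * (c + 1) ^+ 2 / e <= A by rewrite lerDr; lra.
  rewrite ler_pdivrMr// in A3.
  rewrite /D mulrAC ler_pdivrMr ?exprn_gt0//.
  have : A * e <= A ^+ 2 * e by rewrite ler_pM2r// ler_eXnr.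
  lra.
have rho_gt0 : 0 < rho by exact: lt_le_trans theta_le.
(* The last bound gives e^(- rho L) <= D, so the source [walk 0] fits into the slack of the
   barrier. *)
exists (Num.max T (Num.max 0 (- ln D / rho))) => L z.
rewrite !ge_max => /and3P[TL L0 DL].
have gD : expR (- rho * L) <= D.
  rewrite -[leRHS]lnK// ler_expR; move: DL; rewrite ler_pdivrMr// mulNr; lra.
pose b := barrier (e / 2) 0 D K L.
have b0 y : 0 <= b y.
  rewrite /b /barrier mul0r addr0; apply: addr_ge0; first lra.
  by rewrite mulr_ge0 ?sqr_ge0// ltW.
pose S y := shift_invariant (y - L).
have SS y p : S y -> P p -> S (y - step p).
  move=> Sy Pp; rewrite /S addrAC.
  exact: shift_invariantD Sy (shift_invariantN (shift_invariant_step Pp)).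
pose u (y : R) : R := `|walk_mass y - walk_mass L|.
have uC y : u y <= C.
  rewrite ler_distl; have := walk_mass_le y; have := walk_mass_le L.
  have := walk_mass_ge0 y; have := walk_mass_ge0 L; rewrite -/C => *.
  by apply/andP; split; lra.
move=> Lz Sz; have : u z <= b z.
  apply: (@max_principle R S id (fun z p => z - step p) u b L)
    => // [y Sy yL|y Sy yL IH].
    have [yK|yK] := leP (L - K) y.
      apply: (@le_trans _ _ (e / 2)).
        have := HT L TL (L - y) ltac:(lra) ltac:(lra) _.
        rewrite subKr; apply; rewrite -opprB; exact: shift_invariantN.
      by rewrite /b /barrier mul0r addr0 lerDl mulr_ge0 ?sqr_ge0// ltW.
    apply: le_trans (uC y) _; rewrite /b /barrier mul0r addr0 -[leLHS]add0r.
    rewrite lerD//; first lra.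
    have cA : 2 * barrier_coef <= expR (theta * K) by rewrite eK /A -/c; lra.
    apply: le_trans (barrier_far (ltW D0) cA (ltW yK)).
    have : A ^+ 2 <= expR (2 * theta * (L - y)).
      rewrite -eK -expRM_natl ler_expR mulrA ler_pM2l ?mulr_gt0//; lra.
    have -> : C = D / 8 * A ^+ 2 by rewrite /D; field; lra.
    move=> h; apply: ler_pM => //; [lra|exact: sqr_ge0|lra].
  have [M hM MB] := @barrier_superharmonic (e / 2) 0 D K L y (ltW D0) yL.
  rewrite mul0r addr0 in MB.
  (* Subtracting a constant from the truncated renewal equation leaves the missing weight as an
     error, which vanishes in the limit. *)
  have cvg_l : (walk 0 y + \sum_(0 <= B < n) weight B * b (y - step B)) +
      `|walk_mass L| * (1 - \sum_(0 <= B < n) weight B * 1) @[n --> \oo] -->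
      walk 0 y + M + `|walk_mass L| * (1 - 1).
    apply: cvgD; first by apply: cvgD; [exact: cvg_cst|exact: hM].
    apply: cvgMl_tmp; apply: cvgB; [exact: cvg_cst|exact: mean_1].
  apply: le_trans (_ : walk 0 y + M + `|walk_mass L| * (1 - 1) <= _); last first.
    rewrite subrr mulr0 addr0; apply: le_trans MB; rewrite addrC lerD2l.
    rewrite /= (le_trans L0 yL).
    have -> : - rho * y = (- rho * L) + (rho * (L - y)) by ring.
    rewrite expRD; apply: ler_pM; rewrite ?expR_ge0// ler_expR.
    by rewrite ler_wnM2r// subr_le0.
  apply: (ler_cvg_to (cvg_cst (u y)) cvg_l).
  exists (cutoff y) => // B /= yB; rewrite /u (walk_mass_renewal yB).
  have -> : walk 0 y + \sum_(0 <= p < B) weight p * walk_mass (y - step p) -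
     walk_mass L = walk 0 y + \sum_(0 <= p < B) weight p *
       (walk_mass (y - step p) - walk_mass L) -
     walk_mass L * (1 - \sum_(0 <= p < B) weight p * 1).
    under [X in _ = _ + X - _]eq_bigr do rewrite mulrBr.
    rewrite sumrB -[X in _ + (_ - X)]mulr_suml.
    under [X in 1 - X]eq_bigr do rewrite mulr1.
    by ring.
  have tail : 0 <= 1 - \sum_(0 <= p < B) weight p * 1.
    by rewrite subr_ge0; apply: sum_le_has_mean mean_1.
  rewrite (le_trans (ler_normB _ _))// normrM (ger0_norm tail) lerD2r.
  rewrite (le_trans (ler_normD _ _))// (ger0_norm (walk_ge0 0 _)) lerD2l.
  rewrite (le_trans (ler_norm_sum _ _ _))//; apply: ler_sum => p _.
  rewrite normrM (ger0_norm (weight_ge0 p)); apply: ler_weight => Pp.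
  exact: IH.
move=> /le_trans; apply.
have := @barrier_le (e / 2) 0 D K L z (ltW D0) Lz; rewrite -/c mul0r addr0 -/b; lra.
Qed.

(** * Exponential moments of the centred number of steps *)

Context (l4 m2 : R).
Hypothesis theta4_le : 4 * theta <= rho.
Hypothesis mean_expR4 : has_mean (fun p => expR (4 * theta * step p)) l4.
Hypothesis mean_step2 : has_mean (fun p => step p ^+ 2) m2.

(** The increment of k - z / m1 when a step p is prepended; its mean is 0. *)
Definition drift p : R := 1 - step p / m1.
Definition slope : R := 1 + m1^-1.

Lemma invm1_gt0 : 0 < m1^-1.
Proof. by rewrite invr_gt0 mean_step_gt0. Qed.

Lemma slope_ge1 : 1 <= slope.
Proof. by rewrite lerDl ltW// invm1_gt0. Qed.

Lemma norm_drift_le p : P p -> `|drift p| <= 1 + slope * step p.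
Proof.
move=> Pp; have i0 := invm1_gt0; have x0 := step_gt0 Pp.
have y0 : 0 <= step p / m1 by rewrite mulr_ge0// ltW.
by rewrite ler_norml /drift /slope mulrDl mul1r [m1^-1 * _]mulrC; apply/andP; split; lra.
Qed.

Lemma step_le_affine p : P p -> step p <= 1 + slope * step p.
Proof.
move=> Pp; have i0 := invm1_gt0; have x0 := step_gt0 Pp.
have y0 : 0 <= step p / m1 by rewrite mulr_ge0// ltW.
rewrite /slope mulrDl mul1r [m1^-1 * _]mulrC; lra.
Qed.

Lemma mean_drift : has_mean drift 0.
Proof.
have := has_meanB mean_1 (has_meanZ m1^-1 mean_step).
rewrite mulVf ?gt_eqF ?mean_step_gt0// subrr; apply: eq_has_mean => p _.
by rewrite /drift mulrC.
Qed.

(** Used with d = 1 / s and d = - 1 / s at z = s^2, where the bound does not depend on s. The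
    barrier is e^(A d^2 y) (c - e^(- theta y))^2, whose first factor absorbs the second order effect
    of the tilt by d. *)
Lemma walk_sum_exp_le : exists d0 A C : R, [/\ 0 < d0, 0 <= A, 0 <= C &
  forall d z : R, `|d| <= d0 -> 0 <= z ->
    walk_sum (fun k => expR (d * (k%:R - z / m1))) z <= C * expR (A * d ^+ 2 * z)].
Proof.
have m10 := mean_step_gt0; have i0 := invm1_gt0; have l11 := mean_expR1_gt1.
have l21 := mean_expR2_ge1.
have a1 := slope_ge1; set a := slope in a1.
have aE : a = 1 + m1^-1 by [].
have l40 : 0 <= l4.
  rewrite -(mul0r 1); apply: has_mean_le (has_meanZ 0 mean_1) mean_expR4 _.
  by move=> p _; rewrite mul0r expR_ge0.
clearbody a; have t0 := theta_gt0.
have [e1 e1E] : exists e1 : R, e1 = expR 1 by exists (expR 1).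
have e10 : 0 < e1 by rewrite e1E expR_gt0.
have [G GE] : exists G : R, G = e1 * (1 + 2%:R * a / theta) ^+ 2 by eexists.
have [G1 G1E] : exists G1 : R, G1 = 1 + 1%:R * a / theta by eexists.
have G0 : 0 <= G by rewrite GE mulr_ge0 ?sqr_ge0// ltW.
have G10 : 0 < G1 by rewrite G1E ltr_pwDl// divr_ge0// ?mulr_ge0//; lra.
(* With this A the terms - A d^2 m1 and d^2 G l2 of the mean cancel; the c below leaves a full e^(-
   theta y) for the source. *)
have [A AE] : exists A : R, A * m1 = G * l2.
  by exists (G * l2 / m1); rewrite divfK// gt_eqF.
have A0 : 0 <= A by rewrite -(pmulr_lge0 _ m10) AE mulr_ge0//; lra.
have [c cE] : exists c : R, c * (l1 - 1) = e1 * l4 + 1.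
  by exists ((e1 * l4 + 1) / (l1 - 1)); rewrite divfK// gt_eqF//; lra.
have el0 : 0 <= e1 * l4 by rewrite mulr_ge0// ltW.
have c0 : 0 <= c by rewrite -(@pmulr_lge0 _ (l1 - 1)) ?cE; lra.
(* The first bounds give |u| <= 1 + theta s for the exponent u below; the last keeps the error in
   the cross term below half of its gain l1 - 1. *)
pose d0 := Num.min (Num.min 1 (A + 1)^-1) (Num.min (theta / a) ((l1 - 1) / (2 * G1 * l2))).
have d00 : 0 < d0.
  rewrite /d0 !lt_min ltr01 invr_gt0 divr_gt0//= ?divr_gt0 ?mulr_gt0//; lra.
exists d0, A, ((c + 1) ^+ 2); split => //; first exact: sqr_ge0.
move=> d z; rewrite /d0 !le_min => /andP[/andP[d1 dA] /andP[dt dl]] z0.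
have dA1 : `|d| * A <= 1.
  have : `|d| * (A + 1) <= 1 by rewrite -ler_pdivlMr ?div1r//; lra.
  by have := normr_ge0 d; rewrite mulrDr mulr1; lra.
have dta : `|d| * a <= theta by rewrite -ler_pdivlMr//; lra.
have dl1 : `|d| * G1 * l2 <= (l1 - 1) / 2.
  move: dl; rewrite ler_pdivlMr; last by rewrite !mulr_gt0//; lra.
  lra.
have dn := normr_ge0 d.
pose x (y : R) := expR (- theta * y).
pose b y := expR (A * d ^+ 2 * y) * (c - x y) ^+ 2.
have b0 y : 0 <= b y by rewrite mulr_ge0 ?expR_ge0 ?sqr_ge0.
have x01 (y : R) : 0 <= y -> 0 < x y <= 1.
  by move=> y0; rewrite expR_gt0 -expR0 ler_expR mulNr oppr_le0 mulr_ge0// ltW.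
apply: (@le_trans _ _ (b z)); last first.
  rewrite /b mulrC ler_wpM2r ?expR_ge0//; have /andP[xz0 xz1] := x01 z z0.
  rewrite -subr_ge0 subr_sqr mulr_ge0//; lra.
apply: (@max_principle R (fun=> True) id (fun z p => z - step p)
  (fun z => walk_sum (fun k => expR (d * (k%:R - z / m1))) z) b 0)
  => // [y _ y0|y _ y0 IH]; first by rewrite walk_sum_lt0.
have /andP[xy0 xy1] := x01 y y0.
rewrite (walk_sum_renewal _ (leqnn (cutoff y))).
set E := expR (A * d ^+ 2 * y).
have E1 : 1 <= E by rewrite /E -expR0 ler_expR mulr_ge0// mulr_ge0 ?sqr_ge0.
have src : expR (d * (0%:R - y / m1)) * walk 0 y <= E * x y.
  apply: (@le_trans _ _ (1 * x y)); last by rewrite ler_pM2r.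
  rewrite /= y0 mul1r -expRD ler_expR.
  have : - d * (y / m1) <= theta * y.
    apply: (@le_trans _ _ (`|d| * (y / m1))).
      by rewrite ler_wpM2r ?divr_ge0 ?(ltW m10)// -normrN ler_norm.
    rewrite mulrA mulrAC ler_wpM2r//; apply: le_trans dta.
    by rewrite ler_wpM2l// aE; lra.
  have := ler_wpM2r y0 theta4_le; have : 0 <= theta * y by rewrite mulr_ge0// ltW.
  lra.
(* In the expansion of (c - x t)^2, with t = e^(theta s), each monomial gets its own estimate of
   e^u: second order for c^2, first order from below for the negative cross term, and the crude e1 t
   for the last. *)
pose psi p := c ^+ 2 * (1 + d * drift p - A * d ^+ 2 * step p +
     d ^+ 2 * G * expR (2 * theta * step p)) +
   (- (2 * c * x y) * expR (theta * step p) +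
    2 * c * x y * `|d| * G1 * expR (2 * theta * step p)) +
   x y ^+ 2 * e1 * expR (4 * theta * step p).
have term p : P p -> expR (d * drift p) * b (y - step p) <= E * psi p.
  move=> Pp; have s0 := step_gt0 Pp; set s := step p in s0 *.
  pose u := d * drift p - A * d ^+ 2 * s.
  pose t := expR (theta * s).
  have t1 : 1 <= t by rewrite -expR0 ler_expR mulr_ge0// ltW.
  have -> : expR (d * drift p) * b (y - s) = E * (expR u * (c - x y * t) ^+ 2).
    have -> : x y * t = x (y - s) by rewrite /x /t -expRD; congr expR; ring.
    by rewrite /b mulrA mulrA -!expRD; congr (expR _ * _); rewrite /u; ring.
  have E0 : 0 <= E by exact: expR_ge0.
  apply: (ler_wpM2l E0).
  have as0 : 0 <= a * s by rewrite mulr_ge0// ?ltW//; lra.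
  have ub : `|u| <= `|d| * (1 + a * s).
    rewrite /u (le_trans (ler_normB _ _))//.
    have -> : `|A * d ^+ 2 * s| = `|d| * ((`|d| * A) * s).
      by rewrite !normrM (ger0_norm A0) (gtr0_norm s0); ring.
    rewrite normrM.
    rewrite -mulrDr ler_wpM2l//.
    have : `|drift p| <= 1 + m1^-1 * s.
      have y1 : 0 <= m1^-1 * s by rewrite mulr_ge0// ltW.
      by rewrite ler_norml /drift -/s [s / m1]mulrC; apply/andP; split; lra.
    have : `|d| * A * s <= 1 * s by rewrite ler_wpM2r// ltW.
    rewrite aE mulrDl; lra.
  have ub2 : `|u| <= 1 + theta * s.
    apply: le_trans ub _; rewrite mulrDr mulr1 mulrA lerD//.
    by rewrite ler_wpM2r// ltW.
  have t2 : expR (2 * theta * s) = t ^+ 2.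
    by rewrite /t -expRM_natl; congr expR; ring.
  have t4 : expR (4 * theta * s) = t ^+ 4.
    by rewrite /t -expRM_natl; congr expR; ring.
  have eu : expR `|u| <= e1 * t by rewrite e1E /t -expRD ler_expR.
  have euu : expR u <= e1 * t.
    by apply: le_trans eu; rewrite ler_expR ler_norm.
  have up : expR u <= 1 + u + d ^+ 2 * G * t ^+ 2.
    apply: le_trans (expR_sub1Dx_ge0_le u) _; rewrite lerD2l.
    apply: (@le_trans _ _ ((`|d| * (1 + a * s)) ^+ 2 * (e1 * t))).
      apply: ler_pM => //; rewrite ?sqr_ge0 ?expR_ge0// -[leLHS]real_normK ?num_real//.
      by apply: lerXn2r; rewrite ?nnegrE// mulr_ge0//; lra.
    have := @pow_le_expR R 2 a theta s ltac:(lra) theta_gt0 (ltW s0) isT.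
    rewrite -/t => h.
    have et0 : 0 <= e1 * t by rewrite mulr_ge0 ?expR_ge0// ltW.
    have := ler_wpM2l (sqr_ge0 d) (ler_wpM2r et0 h).
    rewrite exprMn real_normK ?num_real// GE.
    have -> : d ^+ 2 * (e1 * (1 + 2%:R * a / theta) ^+ 2) * t ^+ 2 =
      d ^+ 2 * ((1 + 2%:R * a / theta) ^+ 2 * t * (e1 * t)) by ring.
    by rewrite -(mulrA (d ^+ 2)).
  have low : 1 - `|d| * G1 * t <= 1 + u.
    rewrite lerD2l lerNl; apply: (@le_trans _ _ `|u|).
      by rewrite -normrN ler_norm.
    apply: le_trans ub _; rewrite -mulrA ler_wpM2l//.
    have := @pow_le_expR R 1 a theta s ltac:(lra) theta_gt0 (ltW s0) isT.
    by rewrite !expr1 -G1E.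
  rewrite /psi -/s t2 t4 -/t.
  have -> : expR u * (c - x y * t) ^+ 2 = c ^+ 2 * expR u +
     (- (2 * c * x y * t) * expR u) + x y ^+ 2 * (t ^+ 2 * expR u) by ring.
  apply: lerD; [apply: lerD|].
  - apply: ler_wpM2l; first exact: sqr_ge0.
    by move: up; rewrite /u -/s; lra.
  - have h : 1 - `|d| * G1 * t <= expR u by apply: le_trans low (expR_ge1Dx u).
    have q0 : 0 <= 2 * c * x y * t by rewrite mulr_ge0 ?expR_ge0// mulr_ge0 ?(ltW xy0)// mulr_ge0.
    by have := ler_wpM2l q0 h; lra.
  - rewrite -mulrA ler_wpM2l ?sqr_ge0//.
    apply: (@le_trans _ _ (t ^+ 2 * (e1 * t))).
      by rewrite ler_wpM2l ?sqr_ge0.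
    have -> : t ^+ 2 * (e1 * t) = e1 * t ^+ 3 by ring.
    rewrite ler_wpM2l ?(ltW e10)//.
    by rewrite ler_weXn2l.
pose Mpsi := c ^+ 2 * (1 + d * 0 - A * d ^+ 2 * m1 + d ^+ 2 * G * l2) +
   (- (2 * c * x y) * l1 + 2 * c * x y * `|d| * G1 * l2) + x y ^+ 2 * e1 * l4.
have meanpsi : has_mean psi Mpsi.
  apply: has_meanD; [apply: has_meanD|exact: has_meanZ].
    apply: has_meanZ; apply: has_meanD; last exact: has_meanZ.
    apply: has_meanB; last exact: has_meanZ.
    by apply: has_meanD; [exact: mean_1|apply: has_meanZ; exact: mean_drift].
  by apply: has_meanD; exact: has_meanZ.
have psiE : Mpsi + x y <= (c - x y) ^+ 2.
  have -> : Mpsi = c ^+ 2 + x y * (- (2 * c) * l1 + 2 * c * (`|d| * G1 * l2) +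
      x y * (e1 * l4)).
    rewrite /Mpsi; have -> : A * d ^+ 2 * m1 = d ^+ 2 * (A * m1) by ring.
    by rewrite AE; ring.
  rewrite -subr_ge0.
  have -> : (c - x y) ^+ 2 - (c ^+ 2 + x y * (- (2 * c) * l1 +
     2 * c * (`|d| * G1 * l2) + x y * (e1 * l4)) + x y) =
     x y * (2 * (c * (l1 - 1)) - 2 * c * (`|d| * G1 * l2) - x y * (e1 * l4)
       + x y - 1) by ring.
  rewrite mulr_ge0 ?(ltW xy0)//.
  have h1 : c * (`|d| * G1 * l2) <= c * ((l1 - 1) / 2) by rewrite ler_wpM2l.
  have h2 : x y * (e1 * l4) <= 1 * (e1 * l4).
    by rewrite ler_wpM2r// mulr_ge0// ltW.
  have h3 : c * ((l1 - 1) / 2) = (e1 * l4 + 1) / 2 by rewrite -cE; ring.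
  rewrite cE; lra.
rewrite /b -/E.
apply: (@le_trans _ _ (E * (Mpsi + x y))); last first.
  by rewrite ler_wpM2l// expR_ge0.
rewrite [leRHS]mulrDr [leLHS]addrC; apply: lerD; last exact: src.
apply: (@le_trans _ _ (\sum_(0 <= p < cutoff y) weight p * (E * psi p))).
  apply: ler_sum => p _; apply: ler_weight => Pp; apply: le_trans (term p Pp).
  have := IH p Pp; move=> /(ler_wpM2l (expR_ge0 (d * drift p))); apply: le_trans.
  rewrite -walk_sumZ le_eqVlt; apply/orP; left; apply/eqP/eq_walk_sum => k.
  by rewrite -expRD -natr1; congr expR; rewrite /drift; ring.
apply: sum_le_has_mean; last exact: has_meanZ.
by move=> p Pp; apply: le_trans (term p Pp); rewrite mulr_ge0 ?expR_ge0.
Qed.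

(** The variance of the drift divided by the mean step, that is, the variance gained per unit of
    z. *)
Definition limit_variance : R := (m1^-1 ^+ 2 * m2 - 1) / m1.

Lemma mean_drift2 : has_mean (fun p => drift p ^+ 2) (limit_variance * m1).
Proof.
have m10 := mean_step_gt0.
have := has_meanD (has_meanB mean_1 (has_meanZ (2 * m1^-1) mean_step))
  (has_meanZ (m1^-1 ^+ 2) mean_step2).
have -> : 1 - 2 * m1^-1 * m1 + m1^-1 ^+ 2 * m2 = limit_variance * m1.
  by rewrite /limit_variance; field; rewrite gt_eqF.
by apply: eq_has_mean => p _; rewrite /drift; ring.
Qed.

Lemma limit_variance_ge0 : 0 <= limit_variance.
Proof.
have m10 := mean_step_gt0; rewrite -(pmulr_lge0 _ m10) -(mul0r 1).
apply: has_mean_le (has_meanZ 0 mean_1) mean_drift2 _ => p _.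
by rewrite mul0r sqr_ge0.
Qed.

Lemma has_mean_cutoff phi z : (forall p, P p -> z < step p -> phi p = 0) ->
  has_mean phi (\sum_(0 <= p < cutoff z) weight p * phi p).
Proof.
move=> phi0; apply: cvg_near_cst; exists (cutoff z) => // B /= zB.
exact: sum_cutoff.
Qed.

(** * Comparison with the heat equation *)

Section heat.
Context (v v1 v2 : R -> R -> R) (M : R).
Hypothesis M_gt0 : 0 < M.
Hypothesis v_le : forall t y : R, 0 <= t -> `|v t y| <= M.
Hypothesis v1_le : forall t y : R, 0 <= t -> `|v1 t y| <= M.
Hypothesis v2_le : forall t y : R, 0 <= t -> `|v2 t y| <= M.
Hypothesis v_lip : forall t t' y b : R, 0 <= t -> 0 <= t' ->
  `|v t' (y + b) - v t y| <= M * (`|t' - t| + `|b|).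
(* Second order expansion, with [v_t = limit_variance / 2 * v_yy]. *)
Hypothesis v_taylor : forall t t' y b : R, 0 <= t -> 0 <= t' ->
  `|v t' (y + b) - (v t y + b * v1 t y +
      (b ^+ 2 + (t' - t) * limit_variance) / 2 * v2 t y)| <=
  M * ((t' - t) ^+ 2 + `|t' - t| * `|b| + `|t' - t| * b ^+ 2 + `|b| ^+ 3).

Definition heat_err : R :=
  M * (4 + limit_variance) * (1 + 5%:R * slope / theta) ^+ 5 * l1.

(** The first order term has mean 0 because the drift is centred; the second order terms cancel
    because the variance of the drift is [limit_variance] times the mean step. What remains is of
    order s^-3; the factor dl accounts for steps longer than z. *)
Lemma heat_step (dl s z y : R) : 0 < dl -> dl <= 1 -> 1 <= s -> dl * s <= z ->
  `|\sum_(0 <= p < cutoff z) weight p *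
      (if 0 <= z - step p then v ((z - step p) / s ^+ 2) (y + drift p / s) else 0) -
    v (z / s ^+ 2) y| <= heat_err / (dl * s) ^+ 3.
Proof.
move=> dl0 dl1 s1 sz; have m10 := mean_step_gt0; have a1 := slope_ge1.
have V0 := limit_variance_ge0; set V := limit_variance in V0 *.
have s0 : 0 < s by lra.
have ds0 : 0 < dl * s by rewrite mulr_gt0.
have z0 : 0 < z by exact: lt_le_trans sz.
pose t := z / s ^+ 2; have s20 : 0 < s ^+ 2 by rewrite exprn_gt0.
have t0 : 0 <= t by rewrite divr_ge0 ?ltW.
pose phi p := if 0 <= z - step p then v ((z - step p) / s ^+ 2) (y + drift p / s) else 0.
have mphi : has_mean phi (\sum_(0 <= p < cutoff z) weight p * phi p).
  by apply: has_mean_cutoff => p _ zp; rewrite /phi leNgt subr_lt0 zp.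
(* The Taylor polynomial of phi p, with mean exactly v t y. *)
pose psi p := v t y * 1 + v1 t y / s * drift p +
  (v2 t y / 2 / s ^+ 2 * drift p ^+ 2 + - (v2 t y / 2 / s ^+ 2 * V) * step p).
have mpsi : has_mean psi (v t y).
  have -> : v t y = v t y * 1 + v1 t y / s * 0 +
    (v2 t y / 2 / s ^+ 2 * (V * m1) + - (v2 t y / 2 / s ^+ 2 * V) * m1) by ring.
  apply: has_meanD; first apply: has_meanD.
  - by apply: has_meanZ; exact: mean_1.
  - by apply: has_meanZ; exact: mean_drift.
  - apply: has_meanD; first by apply: has_meanZ; exact: mean_drift2.
    by apply: has_meanZ; exact: mean_step.
pose Q := M * (4 + V) * (1 + 5%:R * slope / theta) ^+ 5 / (dl * s) ^+ 3.
have bnd p : P p -> `|phi p - psi p| <= Q * expR (theta * step p).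
  move=> Pp; have x0 := step_gt0 Pp; set x := step p in x0 *.
  have hb := norm_drift_le Pp; have xb := step_le_affine Pp.
  rewrite -/x in hb xb; set h := drift p in hb *.
  set r := 1 + slope * x in hb xb.
  have r1 : 1 <= r by rewrite /r lerDl mulr_ge0 ?(ltW x0)//; lra.
  have r0 : 0 <= r by lra.
  suff H : `|phi p - psi p| <= M * (4 + V) * r ^+ 5 / (dl * s) ^+ 3.
    apply: le_trans H _; rewrite /Q.
    have := @pow_le_expR R 5 slope theta x ltac:(lra) theta_gt0 (ltW x0) isT.
    rewrite -/r => h5.
    have q0 : 0 <= M * (4 + V) / (dl * s) ^+ 3.
      by rewrite divr_ge0 ?mulr_ge0 ?exprn_ge0 ?(ltW M_gt0) ?(ltW ds0)//; lra.
    by have := ler_wpM2l q0 h5; lra.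
  have hn0 := normr_ge0 h.
  have s2V : s ^- 2 <= 1 by rewrite invf_le1// exprn_ege1.
  have sV : s^-1 <= 1 by rewrite invf_le1.
  have sV0 : 0 < s^-1 by rewrite invr_gt0.
  have s2V0 : 0 < s ^- 2 by rewrite invr_gt0.
  have h2 : h ^+ 2 <= r ^+ 2.
    by rewrite -[leLHS]real_normK ?num_real// lerXn2r ?nnegrE.
  rewrite /phi -/x; case: ifPn => zx.
    have h3 : `|h| ^+ 3 <= r ^+ 3 by rewrite lerXn2r ?nnegrE.
    have := @v_taylor t ((z - x) / s ^+ 2) y (h / s) t0 ltac:(by rewrite divr_ge0// ltW).
    have -> : (z - x) / s ^+ 2 - t = - (x / s ^+ 2) by rewrite /t; ring.
    have -> : psi p = v t y + h / s * v1 t y +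
        ((h / s) ^+ 2 + - (x / s ^+ 2) * V) / 2 * v2 t y.
      by rewrite /psi -/h -/x; field; rewrite gt_eqF.
    move=> /le_trans; apply.
    rewrite normrN !normrM !normfV (ger0_norm (ltW x0)) (ger0_norm (ltW s20)) (gtr0_norm s0).
    have p1 : (- (x / s ^+ 2)) ^+ 2 <= r ^+ 3 / s ^+ 3.
      have -> : (- (x / s ^+ 2)) ^+ 2 = x ^+ 2 * s^-1 / s ^+ 3 by field; rewrite gt_eqF.
      rewrite ler_pM2r ?invr_gt0 ?exprn_gt0//.
      rewrite (@le_trans _ _ (r ^+ 2 * 1))//.
        apply: ler_pM => //; rewrite ?sqr_ge0 ?(ltW sV0)//.
        by rewrite lerXn2r ?nnegrE// ltW.
      by rewrite mulr1 ler_weXn2l.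
    have p2 : x / s ^+ 2 * (`|h| / s) <= r ^+ 3 / s ^+ 3.
      have -> : x / s ^+ 2 * (`|h| / s) = x * `|h| / s ^+ 3 by field; rewrite gt_eqF.
      rewrite ler_pM2r ?invr_gt0 ?exprn_gt0//.
      rewrite (@le_trans _ _ (r ^+ 2))//; last by rewrite ler_weXn2l.
      by rewrite expr2 ler_pM// ltW.
    have p3 : x / s ^+ 2 * (h / s) ^+ 2 <= r ^+ 3 / s ^+ 3.
      have -> : x / s ^+ 2 * (h / s) ^+ 2 = x * h ^+ 2 * s^-1 / s ^+ 3.
        by field; rewrite gt_eqF.
      rewrite ler_pM2r ?invr_gt0 ?exprn_gt0//.
      rewrite -[leRHS]mulr1; apply: ler_pM => //; rewrite ?(ltW sV0)//.
        by rewrite mulr_ge0 ?sqr_ge0// ltW.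
      by rewrite exprS; apply: ler_pM; rewrite ?sqr_ge0// ltW.
    have p4 : (`|h| / s) ^+ 3 <= r ^+ 3 / s ^+ 3.
      by rewrite exprMn exprVn ler_pM2r ?invr_gt0 ?exprn_gt0.
    have p5 : r ^+ 3 / s ^+ 3 <= r ^+ 5 / (dl * s) ^+ 3.
      apply: ler_pM; rewrite ?exprn_ge0 ?invr_ge0 ?exprn_ge0 ?(ltW s0)//.
        by rewrite ler_weXn2l.
      rewrite lef_pV2 ?posrE ?exprn_gt0// lerXn2r ?nnegrE ?(ltW ds0) ?(ltW s0)//.
      by rewrite ler_piMl// ltW.
    have -> : M * (4 + V) * r ^+ 5 / (dl * s) ^+ 3 =
      M * ((4 + V) * (r ^+ 5 / (dl * s) ^+ 3)) by ring.
    rewrite ler_wpM2l ?(ltW M_gt0)//.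
    have q0 : 0 <= r ^+ 5 / (dl * s) ^+ 3.
      by rewrite divr_ge0 ?exprn_ge0// ltW.
    have vq := mulr_ge0 V0 q0; set q := r ^+ 5 / _ in p5 q0 vq *.
    have -> : (4 + V) * q = q + q + q + q + V * q by ring.
    rewrite -[leLHS]addr0; apply: lerD vq.
    by do 3?apply: lerD; [exact: le_trans p1 p5|exact: le_trans p2 p5|
      exact: le_trans p3 p5|exact: le_trans p4 p5].
  rewrite -ltNge subr_lt0 in zx.
  rewrite sub0r normrN.
  (* Here the step overshoots z and phi p is 0. The polynomial psi p is of order r^2, and r >= x > z
     >= dl s, so the factor (r / (dl s))^3 >= 1 pays for it. *)
  apply: (@le_trans _ _ (M * (4 + V) * r ^+ 2 * 1)); last first.
    have -> : M * (4 + V) * r ^+ 5 / (dl * s) ^+ 3 =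
       M * (4 + V) * r ^+ 2 * (r / (dl * s)) ^+ 3 by field; rewrite !gt_eqF.
    rewrite ler_wpM2l ?mulr_ge0 ?sqr_ge0 ?(ltW M_gt0)//; first lra.
    rewrite exprn_ege1// ler_pdivlMr// mul1r; lra.
  have b1 := v_le y t0; have b2 := v1_le y t0; have b3 := v2_le y t0.
  rewrite /psi -/h -/x -/t mulr1.
  have -> : v t y + v1 t y / s * h + (v2 t y / 2 / s ^+ 2 * h ^+ 2 +
     - (v2 t y / 2 / s ^+ 2 * V) * x) = v t y + v1 t y * (s^-1 * h) +
     v2 t y * (s ^- 2 * (h ^+ 2 - V * x) / 2) by field; rewrite gt_eqF.
  have r2 : r <= r ^+ 2 by rewrite ler_eXnr.
  have r20 : 1 <= r ^+ 2 by lra.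
  have c1 : `|s^-1 * h| <= r ^+ 2.
    rewrite normrM (gtr0_norm sV0); apply: le_trans r2.
    by apply: le_trans hb; rewrite ler_piMl.
  have c2 : `|s ^- 2 * (h ^+ 2 - V * x) / 2| <= (1 + V) * r ^+ 2.
    rewrite -mulrA normrM (gtr0_norm s2V0).
    apply: (@le_trans _ _ (1 * `|(h ^+ 2 - V * x) / 2|)); first by rewrite ler_wpM2r.
    have Vx : 0 <= V * x by rewrite mulr_ge0// ltW.
    have Vx2 : V * x <= V * r ^+ 2 by rewrite ler_wpM2l//; lra.
    have hh := sqr_ge0 h.
    by rewrite mul1r ler_norml; apply/andP; split; lra.
  rewrite mulr1 (le_trans (ler_normD _ _))//.
  have -> : M * (4 + V) * r ^+ 2 = M * r ^+ 2 + M * r ^+ 2 +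
      M * ((1 + V) * r ^+ 2) + M * r ^+ 2 by ring.
  have Mr : 0 <= M * r ^+ 2 by rewrite mulr_ge0 ?sqr_ge0// ltW.
  have k1 : `|v1 t y * (s^-1 * h)| <= M * r ^+ 2 by rewrite normrM ler_pM.
  have k2 : `|v2 t y * (s ^- 2 * (h ^+ 2 - V * x) / 2)| <= M * ((1 + V) * r ^+ 2).
    by rewrite normrM ler_pM.
  have k0 : `|v t y| <= M * r ^+ 2 by apply: le_trans b1 _; rewrite ler_peMr// ltW.
  have := ler_normD (v t y) (v1 t y * (s^-1 * h)); lra.
have mbnd := has_meanZ Q mean_expR1.
have -> : heat_err / (dl * s) ^+ 3 = Q * l1 by rewrite /heat_err /Q -/V; ring.
rewrite -/t -[X in X - _]/(\sum_(0 <= p < cutoff z) weight p * phi p) ler_norml.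
have mB := has_meanB mphi mpsi.
apply/andP; split.
  apply: has_mean_le (has_meanN mbnd) mB _ => p /bnd.
  by rewrite ler_norml => /andP[].
by apply: has_mean_le mB mbnd _ => p /bnd; rewrite ler_norml => /andP[].
Qed.

(** With L = s^2, the walk sum started at (z, y) is compared with [walk_mass] L times v (z / L) y.
    Each step from z >= dl s costs O(s^-3) by [heat_step] and there are O(s^2) of them, so a barrier
    of slope of order s^-3 suffices. *)
Lemma heat_limit (e : R) : 0 < e -> exists s0 : R, forall s : R, s0 <= s ->
  `|walk_sum (fun k => v 0 ((k%:R - s ^+ 2 / m1) / s)) (s ^+ 2) -
    walk_mass (s ^+ 2) * v 1 0| <= e.
Proof.
move=> e0; have C1 := mass_bound_ge1; have wC := walk_mass_le.
set C := mass_bound in C1 wC; clearbody C.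
have c0 := barrier_coef_ge0; have m10 := mean_step_gt0; have i0 := invm1_gt0.
have t0 := theta_gt0; have M0 := M_gt0; have l20 := ln2_gt0.
have il0 : 0 < (ln (2 : R))^-1 by rewrite invr_gt0.
have CM0 : 0 < C * M by rewrite mulr_gt0//; lra.
(* dl measures the initial zone z < dl s, on which v moves by a multiple of dl only. *)
have [dl [dl0 dl1 dlE]] : exists dl : R, [/\ 0 < dl, dl <= 1 &
    dl * (C * M * ((ln 2)^-1 + m1^-1 + 1)) <= e / 8].
  have q0 : 0 < C * M * ((ln 2)^-1 + m1^-1 + 1) by rewrite mulr_gt0//; lra.
  set q := C * M * _ in q0 *.
  exists (Num.min 1 (e / 8 / q)); split.
  - by rewrite lt_min ltr01 !divr_gt0.
  - by rewrite ge_min lexx.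
  - by rewrite -ler_pdivlMr// ge_min lexx orbT.
have e80 : 0 < e / 8 / M by rewrite !divr_gt0.
have [T HT] := walk_mass_asymp_const e80.
have [T0 [T00 HT0]] : exists T0 : R, 0 <= T0 /\ forall L z : R, T0 <= z -> z <= L ->
    shift_invariant (L - z) -> `|walk_mass z - walk_mass L| <= e / 8 / M.
  exists (Num.max T 0); split; first by rewrite le_max lexx orbT.
  by move=> L z; rewrite ge_max => /andP[Tz _] zL hs; rewrite distrC; exact: HT.
(* For every K >= Ks, [barrier_far] applies and the D-part of the barrier is at most e / 4 above
   z0. *)
have [Ks [Ks1 Ks2]] : exists Ks : R, 2 * barrier_coef <= expR (theta * Ks) /\
    16 * (C * M) * expR (- (2 * theta * Ks)) * (barrier_coef + 1) ^+ 2 <= e / 4.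
  set c := barrier_coef in c0 *.
  have W0 : 0 <= 64 * (C * M) * (c + 1) ^+ 2 / e.
    by rewrite divr_ge0 ?(ltW e0)// mulr_ge0 ?sqr_ge0// mulr_ge0// ltW.
  set W := 64 * _ * _ / _ in W0.
  have [A AE] : exists A : R, A = 2 * c + 1 + W by eexists.
  have A1 : 1 <= A by lra.
  have eA : expR (theta * (ln A / theta)) = A.
    by rewrite mulrC divfK ?gt_eqF// lnK// posrE; lra.
  exists (ln A / theta); rewrite eA; split; first lra.
  have -> : - (2 * theta * (ln A / theta)) = - (2%:R * (theta * (ln A / theta))) by ring.
  rewrite expRN expRM_natl eA mulrAC ler_pdivrMr ?exprn_gt0//; last lra.
  have WA : W <= A by lra.
  rewrite /W ler_pdivrMr// in WA.
  have : A * e <= A ^+ 2 * e by rewrite ler_pM2r// ler_eXnr.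
  lra.
have V0 := limit_variance_ge0; have a1 := slope_ge1.
have h0 : 0 <= heat_err.
  rewrite /heat_err mulr_ge0//; last by have := mean_expR1_gt1; lra.
  rewrite mulr_ge0// ?exprn_ge0//; last first.
    by rewrite addr_ge0// divr_ge0 ?mulr_ge0// ?ltW//; lra.
  by rewrite mulr_ge0// ?ltW//; lra.
(* With beta = N / s^3, beta m1 is the error of one step and beta L = N / s the total error. *)
have [N NE] : exists N : R, N * m1 = C * heat_err / dl ^+ 3.
  by exists (C * heat_err / dl ^+ 3 / m1); rewrite divfK// gt_eqF.
have N0 : 0 <= N.
  rewrite -(pmulr_lge0 _ m10) NE divr_ge0 ?exprn_ge0 ?(ltW dl0)// mulr_ge0//; lra.
exists (Num.max (Num.max 1 ((T0 + Ks) / dl))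
  (Num.max (N / (e / 4)) (N / (8 * (C * M) * theta)))) => s.
have CMt : 0 < 8 * (C * M) * theta by rewrite mulr_gt0// mulr_gt0.
rewrite !ge_max => /andP[/andP[s1 sK] /andP[sN sN']].
rewrite ler_pdivrMr// in sK; rewrite ler_pdivrMr ?divr_gt0// in sN.
rewrite ler_pdivrMr// in sN'.
have s0 : 0 < s by lra.
have [L LE] : exists L : R, L = s ^+ 2 by eexists.
have L0 : 0 < L by rewrite LE exprn_gt0.
have [z0 z0E] : exists z0 : R, z0 = dl * s by eexists.
(* This puts the far zone of the barrier exactly below T0, where nothing is known about the mass. *)
have [K KE] : exists K : R, K = z0 - T0 by eexists.
have [beta bE] : exists beta : R, beta = N / s ^+ 3 by eexists.
have s3 : s <= s ^+ 3 by rewrite ler_eXnr.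
have beta0 : 0 <= beta by rewrite bE divr_ge0 ?exprn_ge0// ltW.
have betaL : beta * L <= e / 4.
  rewrite bE LE; have -> : N / s ^+ 3 * s ^+ 2 = N / s by field; rewrite gt_eqF.
  by rewrite ler_pdivrMr//; lra.
have betaC : beta <= 8 * (C * M) * theta.
  rewrite bE ler_pdivrMr ?exprn_gt0//; apply: le_trans sN' _.
  by rewrite mulrC ler_pM2l.
have betam : beta * m1 = C * (heat_err / (dl * s) ^+ 3).
  rewrite bE mulrAC NE; field; by rewrite !gt_eqF.
have KsK : Ks <= K by rewrite KE z0E; lra.
have [D DE] : exists D : R, D = 16 * (C * M) * expR (- (2 * theta * K)) by eexists.
have D0 : 0 < D by rewrite DE mulr_gt0 ?expR_gt0// mulr_gt0.
have DKs : D * (barrier_coef + 1) ^+ 2 <= e / 4.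
  apply: le_trans Ks2; rewrite ler_wpM2r ?sqr_ge0// DE ler_wpM2l//.
    by rewrite mulr_ge0// ltW.
  by rewrite ler_expR lerN2 ler_pM2l// mulr_gt0.
have cK : 2 * barrier_coef <= expR (theta * K).
  by apply: le_trans Ks1 _; rewrite ler_expR ler_pM2l.
pose b := barrier (e / 4) beta D K z0.
(* The linear part is negative there; beta <= 8 C M theta lets the exponential outweigh it through
   e^u >= 1 + u. *)
have bfar y : y < T0 -> 4 * (C * M) <= b y.
  move=> yT; rewrite /b /barrier.
  have := @barrier_far D K z0 y (ltW D0) cK; rewrite KE => /(_ ltac:(lra)).
  have -> : D / 4 * expR (2 * theta * (z0 - y)) =
     4 * (C * M) * expR (2 * theta * (T0 - y)).
    rewrite DE; have -> : 2 * theta * (z0 - y) = 2 * theta * K + 2 * theta * (T0 - y).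
      by rewrite KE; ring.
    by rewrite expRD expRN; field; rewrite gt_eqF ?expR_gt0.
  have := expR_ge1Dx (2 * theta * (T0 - y)).
  move=> /(ler_wpM2l (_ : 0 <= 4 * (C * M))) -/(_ ltac:(lra)).
  have : beta * (T0 - y) <= 8 * (C * M) * theta * (T0 - y).
    by rewrite ler_wpM2r//; lra.
  have -> : beta * (y - z0 + (z0 - T0)) = - (beta * (T0 - y)) by ring.
  lra.
have bnear y : T0 <= y -> e / 4 <= b y.
  move=> yT; rewrite /b /barrier -addrA lerDl addr_ge0//.
    by rewrite mulr_ge0// KE; lra.
  by rewrite mulr_ge0 ?sqr_ge0// ltW.
have b0 y : 0 <= b y.
  have [/bnear|/bfar] := leP T0 y; first by apply: le_trans; lra.
  by apply: le_trans; lra.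
have [cst cstE] : exists cst : R, cst = walk_mass L by eexists.
have cst0 : 0 <= cst by rewrite cstE walk_mass_ge0.
have cstC : cst <= C by rewrite cstE.
pose V (z y : R) : R := walk_sum (fun k => v 0 (y + (k%:R - z / m1) / s)) z.
pose H (z y : R) : R := if 0 <= z then cst * v (z / L) y else 0.
pose u (zy : R * R) : R := `|V zy.1 zy.2 - H zy.1 zy.2|.
pose S (zy : R * R) := zy.1 <= L /\ shift_invariant (L - zy.1).
pose next (zy : R * R) p := (zy.1 - step p, zy.2 + drift p / s).
have V_le z y : `|V z y| <= C * M.
  apply: le_trans (ler_norm_walk_sum _ _) _.
  apply: (@le_trans _ _ (walk_sum (fun=> M * 1) z)).
    by apply: ler_walk_sum => k _; rewrite mulr1 v_le.
  by rewrite walk_sumZ mulrC ler_wpM2r// ltW.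
have H_le z y : `|H z y| <= C * M.
  rewrite /H; case: ifPn => [z00|_]; last by rewrite normr0 ltW.
  by rewrite normrM (ger0_norm cst0) ler_pM// v_le// divr_ge0// ltW.
(* Three replacements: the argument of v 0 by y, since k and z are O(dl s); [walk_mass] z by
   [walk_mass] L, by asymptotic constancy; and v (z / L) by v 0. *)
have near_le z y : T0 <= z -> z < z0 -> z <= L -> shift_invariant (L - z) ->
    `|V z y - H z y| <= e / 4.
  move=> Tz zz0 zL Sz; have zz : 0 <= z by lra.
  rewrite /H zz.
  have -> : V z y - cst * v (z / L) y = (V z y - v 0 y * walk_mass z) +
     (v 0 y * (walk_mass z - cst)) - cst * (v (z / L) (y + 0) - v 0 y).
    by rewrite addr0; ring.
  have h1 : `|V z y - v 0 y * walk_mass z| <=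
      M * (dl * ((ln 2)^-1 + m1^-1)) * C.
    rewrite /walk_mass -walk_sumZ -walk_sumB.
    apply: le_trans (ler_norm_walk_sum _ _) _.
    apply: (@le_trans _ _ (walk_sum (fun=> M * (dl * ((ln 2)^-1 + m1^-1)) * 1) z)).
      apply: ler_walk_sum => k kz; rewrite !mulr1.
      have := @v_lip 0 0 y ((k%:R - z / m1) / s) (lexx 0) (lexx 0).
      rewrite subrr normr0 add0r => /le_trans; apply; rewrite ler_pM2l//.
      rewrite normrM normfV (gtr0_norm s0) ler_pdivrMr//.
      have kz' : k%:R <= z / ln 2 by rewrite ler_pdivlMr.
      have zm : 0 <= z / m1 by rewrite divr_ge0// ltW.
      have zd : z * ((ln 2)^-1 + m1^-1) <= dl * s * ((ln 2)^-1 + m1^-1).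
        by rewrite ler_wpM2r//; lra.
      have k0 : (0 : R) <= k%:R by [].
      rewrite ler_norml; apply/andP; split; lra.
    rewrite walk_sumZ ler_wpM2l// mulr_ge0 ?(ltW M0)// mulr_ge0 ?(ltW dl0)//; lra.
  have h2 : `|v 0 y * (walk_mass z - cst)| <= e / 8.
    rewrite normrM; have hT := HT0 L z Tz zL Sz; rewrite -cstE in hT.
    have -> : e / 8 = M * (e / 8 / M) by rewrite [RHS]mulrC divfK// gt_eqF.
    by apply: ler_pM => //; exact: v_le.
  have h3 : `|cst * (v (z / L) (y + 0) - v 0 y)| <= C * (M * dl).
    rewrite normrM (ger0_norm cst0); apply: ler_pM => //.
    have zL0 : 0 <= z / L by rewrite divr_ge0// ltW.
    have := @v_lip 0 (z / L) y 0 (lexx 0) zL0.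
    move=> /le_trans; apply; rewrite normr0 addr0 subr0 ler_pM2l//.
    rewrite ger0_norm// ler_pdivrMr// LE.
    have : dl * s <= dl * s ^+ 2 by rewrite ler_pM2l// ler_eXnr.
    lra.
  apply: le_trans (ler_normB _ _) _.
  have := ler_normD (V z y - v 0 y * walk_mass z) (v 0 y * (walk_mass z - cst)).
  lra.
have main zy : S zy -> u zy <= b zy.1.
  apply: (@max_principle (R * R) S fst next u b z0) => {zy}
    [[z y] p|//|[z y]|[z y]] /=.
  - move=> [/= zL Sz] Pp; have sp := step_gt0 Pp; split => /=; first lra.
    have -> : L - (z - step p) = L - z + step p by ring.
    by apply: shift_invariantD => //; exact: shift_invariant_step.
  - move=> [/= zL Sz] zz0; rewrite /u /=.
    have [zneg|zpos] := ltP z 0.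
      by rewrite /V walk_sum_lt0// /H (leNgt 0 z) zneg subrr normr0.
    have [Tz|zT] := leP T0 z.
      by apply: le_trans (bnear _ Tz); exact: near_le.
    apply: le_trans (bfar _ zT); apply: le_trans (ler_normB _ _) _.
    have := V_le z y; have := H_le z y; lra.
  - move=> [/= zL Sz] zz0 IH; have z00 : 0 < z0 by rewrite z0E mulr_gt0.
    have zpos : 0 < z by exact: lt_le_trans zz0.
    rewrite /u /=.
    pose phi p := if 0 <= z - step p
      then v ((z - step p) / s ^+ 2) (y + drift p / s) else 0.
    have VE : V z y = v 0 (y + (0%:R - z / m1) / s) * walk 0 z +
       \sum_(0 <= p < cutoff z) weight p * V (z - step p) (y + drift p / s).
      rewrite /V (walk_sum_renewal _ (leqnn (cutoff z))); congr (_ + _).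
      apply: eq_bigr => p _; congr (_ * _); apply: eq_walk_sum => k.
      by congr (v 0 _); rewrite /drift -natr1; field; rewrite !gt_eqF.
    have HE : \sum_(0 <= p < cutoff z) weight p * H (z - step p) (y + drift p / s) =
       cst * \sum_(0 <= p < cutoff z) weight p * phi p.
      rewrite mulr_sumr; apply: eq_bigr => p _; rewrite mulrCA; congr (_ * _).
      by rewrite /H /phi LE; case: ifP => _; rewrite ?mulr0.
    have hs := @heat_step dl s z y dl0 dl1 s1 ltac:(lra).
    rewrite -LE in hs.
    have -> : V z y - H z y = v 0 (y + (0%:R - z / m1) / s) * walk 0 z +
      \sum_(0 <= p < cutoff z) weight p *
        (V (z - step p) (y + drift p / s) - H (z - step p) (y + drift p / s)) +
      cst * (\sum_(0 <= p < cutoff z) weight p * phi p - v (z / L) y).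
      under [X in _ = _ + X + _]eq_bigr do rewrite mulrBr.
      by rewrite sumrB HE VE /H (ltW zpos); ring.
    have src : `|v 0 (y + (0%:R - z / m1) / s) * walk 0 z| <=
        D * expR (theta * (z0 - z)).
      rewrite normrM (ger0_norm (walk_ge0 0 _)) /= (ltW zpos).
      apply: (@le_trans _ _ (M * expR (- rho * z))).
        by rewrite ler_wpM2r ?expR_ge0// v_le.
      rewrite DE -mulrA; apply: ler_pM; rewrite ?expR_ge0 ?(ltW M0)//.
        have : 1 * M <= C * M by rewrite ler_pM2r.
        lra.
      rewrite -expRD ler_expR.
      have : 4 * theta * z <= rho * z by rewrite ler_pM2r.
      have : theta * K <= theta * z by rewrite ler_pM2l// KE; lra.
      have : 0 <= theta * z0 by rewrite mulr_ge0 ?ltW.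
      have : 0 <= theta * z by rewrite mulr_ge0 ?ltW.
      lra.
    have sm : `|\sum_(0 <= p < cutoff z) weight p *
        (V (z - step p) (y + drift p / s) - H (z - step p) (y + drift p / s))| <=
        \sum_(0 <= p < cutoff z) weight p * b (z - step p).
      apply: le_trans (ler_norm_sum _ _ _) _; apply: ler_sum => p _.
      rewrite normrM (ger0_norm (weight_ge0 p)); apply: ler_weight => Pp.
      exact: IH.
    have he : `|cst * (\sum_(0 <= p < cutoff z) weight p * phi p - v (z / L) y)| <=
        beta * m1.
      rewrite normrM (ger0_norm cst0) betam; apply: ler_pM => //.
      by move: hs; rewrite /phi LE.
    have := @barrier_step (e / 4) beta D K z0 z (cutoff z) (ltW D0) zz0 (fun p _ => b0 _).
    rewrite -/b; apply: le_trans.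
    apply: le_trans (ler_normD _ _) _; apply: (@le_trans _ _ (
       `|v 0 (y + (0%:R - z / m1) / s) * walk 0 z| +
       `|\sum_(0 <= p < cutoff z) weight p *
        (V (z - step p) (y + drift p / s) - H (z - step p) (y + drift p / s))| +
       `|cst * (\sum_(0 <= p < cutoff z) weight p * phi p - v (z / L) y)|)).
      by rewrite lerD2r ler_normD.
    lra.
have SL : S (L, 0) by split => //=; rewrite subrr; exact: shift_invariant0.
have := main (L, 0) SL; rewrite /u /V /H /= (ltW L0) divff ?gt_eqF//.
have -> : walk_sum (fun k => v 0 (0 + (k%:R - L / m1) / s)) L =
   walk_sum (fun k => v 0 ((k%:R - s ^+ 2 / m1) / s)) (s ^+ 2).
  by rewrite LE; apply: eq_walk_sum => k; rewrite add0r.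
rewrite cstE LE -LE => /le_trans; apply.
have z0L : z0 <= L.
  rewrite z0E LE expr2 ler_pM2r//; lra.
have := @barrier_le (e / 4) beta D K z0 L (ltW D0) z0L; rewrite -/b.
have : beta * (L - z0 + K) <= beta * L by rewrite ler_wpM2l// KE; lra.
lra.
Qed.

End heat.

(** * Limits of the rescaled means *)

Definition scaled_mean (f : R -> R) (s : R) : R :=
  walk_sum (fun k => f ((k%:R - s ^+ 2 / m1) / s)) (s ^+ 2) / walk_mass (s ^+ 2).

Definition tends (g : R -> R) (l : R) : Prop :=
  forall e : R, 0 < e -> exists s0 : R, forall s : R, s0 <= s -> `|g s - l| <= e.

Lemma walk_mass_sqr_gt0 s : 0 < walk_mass (s ^+ 2).
Proof.
by have [c c0 cw] := walk_mass_ge; apply: lt_le_trans (cw _ (sqr_ge0 s)).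
Qed.

Lemma scaled_mean_le f g s : (forall y, f y <= g y) ->
  scaled_mean f s <= scaled_mean g s.
Proof.
move=> fg; rewrite ler_pM2r ?invr_gt0 ?walk_mass_sqr_gt0//.
by apply: ler_walk_sum => k _.
Qed.

Lemma scaled_meanD f g s :
  scaled_mean (fun y => f y + g y) s = scaled_mean f s + scaled_mean g s.
Proof. by rewrite /scaled_mean walk_sumD mulrDl. Qed.

Lemma scaled_meanZ c f s : scaled_mean (fun y => c * f y) s = c * scaled_mean f s.
Proof. by rewrite /scaled_mean walk_sumZ mulrA. Qed.

Lemma scaled_mean1 s : scaled_mean (fun=> 1) s = 1.
Proof. by rewrite /scaled_mean divff// gt_eqF// walk_mass_sqr_gt0. Qed.

Lemma scaled_mean_cst c s : scaled_mean (fun=> c) s = c.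
Proof.
rewrite -[RHS]mulr1 -(scaled_mean1 s) -scaled_meanZ.
by congr (scaled_mean _ _); apply/funext => y; rewrite mulr1.
Qed.

Lemma scaled_mean_dist f g h s : (forall y, `|f y - g y| <= h y) ->
  `|scaled_mean f s - scaled_mean g s| <= scaled_mean h s.
Proof.
move=> fgh; rewrite ler_norml; apply/andP; split.
  rewrite lerBrDr addrC -lerBrDr opprK -scaled_meanD; apply: scaled_mean_le => y.
  by have := fgh y; rewrite ler_norml => /andP[]; lra.
rewrite lerBlDr -scaled_meanD; apply: scaled_mean_le => y.
by have := fgh y; rewrite ler_norml => /andP[]; lra.
Qed.

Lemma heat_family_limit (v : nat -> R -> R -> R) (M : R) :
  (forall j (t y : R), (j < 3)%N -> 0 <= t -> is_derive y 1 (v j t) (v j.+1 t y)) ->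
  (forall j (t y : R), (j < 3)%N -> 0 <= t ->
     is_derive t 1 (fun t : R => v j t y) (limit_variance / 2 * v j.+2 t y)) ->
  (forall j (t y : R), (j < 5)%N -> 0 <= t -> `|v j t y| <= M) ->
  tends (scaled_mean (v 0 0)) (v 0 1 0).
Proof.
move=> dy dt B e e0.
have [M' M'0 [b lip tay]] := heat_regular limit_variance_ge0 dy dt B.
have [c c0 cw] := walk_mass_ge.
have [s0 H] := @heat_limit (v 0%N) (v 1%N) (v 2%N) M' M'0 (fun t y => b 0%N t y isT)
  (fun t y => b 1%N t y isT) (fun t y => b 2%N t y isT) lip tay (e * c) (mulr_gt0 e0 c0).
exists s0 => s /H h; have w0 := walk_mass_sqr_gt0 s.
have -> : scaled_mean (v 0 0) s - v 0 1 0 =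
  (walk_sum (fun k => v 0%N 0 ((k%:R - s ^+ 2 / m1) / s)) (s ^+ 2) -
    walk_mass (s ^+ 2) * v 0%N 1 0) / walk_mass (s ^+ 2).
  by rewrite /scaled_mean; field; rewrite gt_eqF.
rewrite normrM normfV (gtr0_norm w0) ler_pdivrMr//; apply: le_trans h _.
by rewrite ler_pM2l// cw// sqr_ge0.
Qed.

(** The factor is the characteristic function at tau of the centred normal law with variance
    [limit_variance]. *)
Lemma scaled_mean_trig (f f1 : R -> R) (tau : R) :
  (forall x : R, is_derive x 1 f (f1 x)) -> (forall x : R, is_derive x 1 f1 (- f x)) ->
  (forall x : R, `|f x| <= 1) -> (forall x : R, `|f1 x| <= 1) ->
  tends (scaled_mean (fun y => f (tau * y)))
    (expR (- (tau ^+ 2 * limit_variance / 2)) * f 0).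
Proof.
move=> df df1 fb f1b.
have V0 := limit_variance_ge0.
have [M HM] : exists M : R, forall j (t y : R), (j < 5)%N -> 0 <= t ->
    `|trig_heat limit_variance f f1 tau j t y| <= M by apply: trig_heat_bounded.
have dy j (t y : R) : is_derive y 1 (trig_heat limit_variance f f1 tau j t)
    (trig_heat limit_variance f f1 tau j.+1 t y) by apply: trig_heat_space.
have dt j (t y : R) : is_derive t 1 (fun t => trig_heat limit_variance f f1 tau j t y)
    (limit_variance / 2 * trig_heat limit_variance f f1 tau j.+2 t y).
  by apply: trig_heat_time.
have := @heat_family_limit (trig_heat limit_variance f f1 tau) M
  (fun j t y _ _ => dy j t y) (fun j t y _ _ => dt j t y) HM.
rewrite /trig_heat /= !expr0 !mulr1 mul1r !mulr0 !addr0.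
have -> : (fun y => expR 0 * (1 * f (tau * y + 0))) = (fun y => f (tau * y)).
  by apply/funext => y; rewrite expR0 !mul1r addr0.
by rewrite ?mulr1.
Qed.

Lemma scaled_mean_expR_le : exists C s1 : R, [/\ 0 <= C, 0 < s1 & forall s : R, s1 <= s ->
  scaled_mean (fun y => expR y + expR (- y)) s <= C].
Proof.
have [d0 [A [C [d00 A0 C0 H]]]] := walk_sum_exp_le.
have [c c0 cw] := walk_mass_ge.
pose B := C * expR A / c.
have B0 : 0 <= B by rewrite divr_ge0 ?(ltW c0)// mulr_ge0 ?expR_ge0.
exists (B + B), d0^-1; split; [by lra|by rewrite invr_gt0|].
move=> s s1; have s0 : 0 < s by apply: lt_le_trans s1; rewrite invr_gt0.
have w0 := walk_mass_sqr_gt0 s.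
suff K (d : R) : `|d| = s^-1 -> walk_sum (fun k => expR (d * (k%:R - s ^+ 2 / m1))) (s ^+ 2) /
    walk_mass (s ^+ 2) <= B.
  rewrite scaled_meanD; apply: lerD.
    apply: le_trans (K s^-1 _); last by rewrite gtr0_norm// invr_gt0.
    rewrite ler_pM2r ?invr_gt0//; apply: ler_walk_sum => k _.
    by rewrite ler_expR mulrC.
  apply: le_trans (K (- s^-1) _); last by rewrite normrN gtr0_norm// invr_gt0.
  rewrite ler_pM2r ?invr_gt0//; apply: ler_walk_sum => k _.
  by rewrite ler_expR mulNr lerN2 mulrC.
move=> dE; rewrite /B ler_pdivrMr//.
apply: le_trans (H d (s ^+ 2) _ (sqr_ge0 s)) _.
  by rewrite dE invf_ple ?posrE.
have -> : A * d ^+ 2 * s ^+ 2 = A.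
  by rewrite -(real_normK (num_real d)) dE -mulrA exprVn mulVf ?mulr1// expf_neq0// gt_eqF.
rewrite mulrAC ler_pdivlMr// ler_wpM2l//; first by rewrite mulr_ge0 ?expR_ge0.
by rewrite cw// sqr_ge0.
Qed.

Lemma norm_cube_le (y : R) : `|y| ^+ 3 <= 27 * (expR y + expR (- y)).
Proof.
have h : `|y| ^+ 3 <= 27 * expR `|y|.
  have e : expR `|y| = expR (`|y| / 3) ^+ 3.
    by rewrite -expRM_natl; congr expR; field.
  have : (`|y| / 3) ^+ 3 <= expR (`|y| / 3) ^+ 3.
    apply: lerXn2r; rewrite ?nnegrE ?expR_ge0 ?divr_ge0//.
    by apply: le_trans (expR_ge1Dx _); rewrite lerDr.
  by rewrite e exprMn exprVn; lra.
apply: le_trans h _; rewrite ler_wpM2l//.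
have [y0|y0] := leP 0 y; first by rewrite ger0_norm// lerDl expR_ge0.
by rewrite ltr0_norm// lerDr expR_ge0.
Qed.

Lemma is_deriveN_pt (f : R -> R) (x a : R) : is_derive x 1 f a ->
  is_derive x 1 (fun y : R => - f y) (- a).
Proof.
move=> df; rewrite (_ : (fun y : R => - f y) = (fun y => -1 * f y + 0)).
  apply: (derive_eq (is_derive_comp_pt df (is_derive_affine (-1) 0 _))).
  by rewrite mulN1r.
by apply/funext => z; rewrite mulN1r addr0.
Qed.

Lemma sin_taylor (x : R) : `|sin x - x| <= `|x| ^+ 3.
Proof.
have cb (y : R) : `|- cos y| <= 1 by rewrite normrN cos_max.
have := @taylor2_norm R sin cos (fun x => - sin x) (fun x => - cos x) 1 0 x
  (@is_derive_sin R) (@is_derive_cos R) (fun y => is_deriveN_pt (is_derive_sin y)) cb.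
rewrite add0r sin0 cos0 mul1r.
by have -> : sin x - 0 - x * 1 - x ^+ 2 / 2 * - 0 = sin x - x by ring.
Qed.

Lemma cos_taylor (x : R) : `|cos x - 1 + x ^+ 2 / 2| <= `|x| ^+ 3.
Proof.
have sb (y : R) : `|- - sin y| <= 1 by rewrite opprK sin_max.
have := @taylor2_norm R cos (fun x => - sin x) (fun x => - cos x) (fun x => - - sin x) 1 0 x
  (@is_derive_cos R) (fun y => is_deriveN_pt (is_derive_sin y))
  (fun y => is_deriveN_pt (is_derive_cos y)) sb.
by rewrite add0r sin0 cos0 oppr0 mulr0 subr0 mulrN1 opprK mul1r.
Qed.

(** y is replaced by sin (tau y) / tau, whose mean tends to 0. The error tau^2 |y|^3 has mean
    O(tau^2) by [scaled_mean_expR_le], so tau is fixed small before s grows. *)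
Lemma scaled_mean_id : tends (scaled_mean id) 0.
Proof.
move=> e e0; have [C [s1 [C0 s10 HC]]] := scaled_mean_expR_le.
pose tau := Num.min 1 (e / (2 * (27 * C + 1))).
have D0 : 0 < 2 * (27 * C + 1) by lra.
have tau0 : 0 < tau by rewrite lt_min ltr01 divr_gt0.
have tau1 : tau <= 1 by rewrite ge_min lexx.
have tauE : tau * (27 * C) <= e / 2.
  have : tau <= e / (2 * (27 * C + 1)) by rewrite ge_min lexx orbT.
  by rewrite ler_pdivlMr//; lra.
have [s2 H2] := @scaled_mean_trig sin cos tau (@is_derive_sin R) (@is_derive_cos R)
  (@sin_max R) (@cos_max R) (e / 2 * tau) (mulr_gt0 (divr_gt0 e0 (ltr0Sn _ 1)) tau0).
exists (Num.max s1 s2) => s; rewrite ge_max => /andP[/HC hC /H2].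
rewrite sin0 mulr0 !subr0 => h2.
have h1 : `|scaled_mean id s - scaled_mean (fun y => tau^-1 * sin (tau * y)) s| <= e / 2.
  apply: (@le_trans _ _ (scaled_mean (fun y => tau ^+ 2 * 27 * (expR y + expR (- y))) s)).
    apply: scaled_mean_dist => y.
    have -> : id y - tau^-1 * sin (tau * y) = - (tau^-1 * (sin (tau * y) - tau * y)).
      by rewrite /=; field; rewrite gt_eqF.
    rewrite normrN normrM normfV (gtr0_norm tau0) mulrC ler_pdivrMr//.
    apply: le_trans (sin_taylor _) _; rewrite normrM (gtr0_norm tau0) exprMn.
    have := norm_cube_le y; have t3 : 0 <= tau ^+ 3 by rewrite exprn_ge0// ltW.
    move=> /(ler_wpM2l t3); lra.
  rewrite scaled_meanZ.
  have t2 : tau ^+ 2 <= tau by rewrite expr2 ler_piMl// ltW.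
  have t20 : 0 <= tau ^+ 2 * 27 by rewrite mulr_ge0// sqr_ge0.
  have := ler_wpM2l t20 hC.
  have : tau ^+ 2 * (27 * C) <= tau * (27 * C) by rewrite ler_wpM2r//; lra.
  lra.
rewrite scaled_meanZ in h1.
have h3 : `|tau^-1 * scaled_mean (fun y => sin (tau * y)) s| <= e / 2.
  by rewrite normrM normfV (gtr0_norm tau0) mulrC ler_pdivrMr.
have := ler_normD (scaled_mean id s - tau^-1 * scaled_mean (fun y => sin (tau * y)) s)
  (tau^-1 * scaled_mean (fun y => sin (tau * y)) s).
rewrite subrK; lra.
Qed.

(** y^2 is replaced by (2 / tau^2) (1 - cos (tau y)) with error 2 tau |y|^3; the limit (2 / tau^2)
    (1 - e^(- tau^2 V / 2)) is within O(tau) of V. *)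
Lemma scaled_mean_sqr : tends (scaled_mean (fun y => y ^+ 2)) limit_variance.
Proof.
move=> e e0; have [C [s1 [C0 s10 HC]]] := scaled_mean_expR_le.
have V0 := limit_variance_ge0; set V := limit_variance in V0 *.
(* 54 is twice the constant of [norm_cube_le]; the other term bounds the second order remainder of
   the exponential. *)
pose Q := 54 * C + V ^+ 2 / 2 * expR (V / 2).
have Q0 : 0 <= V ^+ 2 / 2 * expR (V / 2).
  by rewrite mulr_ge0 ?expR_ge0// divr_ge0 ?sqr_ge0.
have D0 : 0 < 3 * (Q + 1) by rewrite /Q; lra.
pose tau := Num.min 1 (e / (3 * (Q + 1))).
have tau0 : 0 < tau by rewrite lt_min ltr01 divr_gt0.
have tau1 : tau <= 1 by rewrite ge_min lexx.
have tauE : tau * Q <= e / 3.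
  have : tau <= e / (3 * (Q + 1)) by rewrite ge_min lexx orbT.
  by rewrite ler_pdivlMr//; lra.
have t20 : 0 < tau ^+ 2 by rewrite exprn_gt0.
have t2 : tau ^+ 2 <= tau by rewrite expr2 ler_piMl// ltW.
have e6 : 0 < e / 6 * tau ^+ 2 by rewrite mulr_gt0// divr_gt0.
have sb (x : R) : `|- sin x| <= 1 by rewrite normrN sin_max.
have [s2 H2] := @scaled_mean_trig cos (fun x => - sin x) tau (@is_derive_cos R)
  (fun y => is_deriveN_pt (is_derive_sin y)) (@cos_max R) sb _ e6.
exists (Num.max s1 s2) => s; rewrite ge_max => /andP[/HC hC /H2].
rewrite cos0 mulr1 => h2.
pose k : R := 2 / tau ^+ 2.
have k0 : 0 < k by rewrite divr_gt0.
have h1 : `|scaled_mean (fun y => y ^+ 2) s -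
     scaled_mean (fun y => k + (- k) * cos (tau * y)) s| <= tau * (54 * C).
  apply: (@le_trans _ _ (scaled_mean (fun y => tau * 54 * (expR y + expR (- y))) s)).
    apply: scaled_mean_dist => y.
    have -> : y ^+ 2 - (k + - k * cos (tau * y)) =
       k * (cos (tau * y) - 1 + (tau * y) ^+ 2 / 2).
      by rewrite /k; field; rewrite gt_eqF.
    rewrite normrM (gtr0_norm k0).
    apply: (@le_trans _ _ (k * (`|tau * y| ^+ 3))).
      by rewrite ler_pM2l// cos_taylor.
    rewrite normrM (gtr0_norm tau0).
    have -> : k * (tau * `|y|) ^+ 3 = 2 * tau * `|y| ^+ 3.
      by rewrite /k; field; rewrite gt_eqF.
    have t2' : 0 <= 2 * tau by rewrite mulr_ge0// ltW.
    have := ler_wpM2l t2' (norm_cube_le y); lra.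
  rewrite scaled_meanZ -mulrA ler_wpM2l ?(ltW tau0)//; lra.
rewrite scaled_meanD scaled_mean_cst scaled_meanZ in h1.
pose X : R := tau ^+ 2 * V / 2; rewrite -/V -/X in h2.
have X0 : 0 <= X by rewrite /X divr_ge0// mulr_ge0// ltW.
have h3 : `|k * (1 - expR (- X)) - V| <= tau * (V ^+ 2 / 2 * expR (V / 2)).
  have kX : k * X = V by rewrite /k /X; field; rewrite gt_eqF.
  have a1 := expR_ge1Dx (- X).
  have a2 := expR_sub1Dx_ge0_le (- X); rewrite normrN (ger0_norm X0) sqrrN in a2.
  have b1 : k * (1 - X - expR (- X)) <= 0 by rewrite pmulr_rle0//; lra.
  have b2 : - (k * (X ^+ 2 * expR X)) <= k * (1 - X - expR (- X)).
    by rewrite -mulrN ler_pM2l//; lra.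
  have b3 : k * (X ^+ 2 * expR X) <= tau * (V ^+ 2 / 2 * expR (V / 2)).
    have -> : k * (X ^+ 2 * expR X) = tau ^+ 2 * (V ^+ 2 / 2 * expR X).
      by rewrite /k /X; field; rewrite gt_eqF.
    have V20 : 0 <= V ^+ 2 / 2 by rewrite divr_ge0 ?sqr_ge0.
    apply: ler_pM; [exact: ltW|by rewrite mulr_ge0 ?expR_ge0|exact: t2|].
    rewrite ler_wpM2l// ler_expR /X ler_pM2r ?invr_gt0//.
    have t21 : tau ^+ 2 <= 1 by lra.
    by have := ler_wpM2r V0 t21; rewrite mul1r.
  rewrite ler_norml; apply/andP; split; lra.
have h4 : `|k * (scaled_mean (fun y => cos (tau * y)) s - expR (- X))| <= e / 3.
  rewrite normrM (gtr0_norm k0).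
  have -> : e / 3 = k * (e / 6 * tau ^+ 2) by rewrite /k; field; rewrite gt_eqF.
  by rewrite ler_pM2l.
move: h1 h3 h4; rewrite /Q mulrDr in tauE; rewrite !ler_norml.
move=> /andP[u1 u2] /andP[v1 v2] /andP[x1 x2]; apply/andP; split; lra.
Qed.

Lemma scaled_mean_cdf_heat (h x0 : R) : 0 < h ->
  tends (scaled_mean (cdf_heat limit_variance h x0 0 0))
    (cdf_heat limit_variance h x0 0 1 0).
Proof.
move=> h0; have V0 := limit_variance_ge0.
have [M HM] : exists M : R, forall j (t y : R), (j < 5)%N -> 0 <= t ->
    `|cdf_heat limit_variance h x0 j t y| <= M by apply: cdf_heat_bounded.
have dy j (t y : R) : is_derive y 1 (cdf_heat limit_variance h x0 j t)
    (cdf_heat limit_variance h x0 j.+1 t y) by apply: cdf_heat_space.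
have dt j (t y : R) : 0 <= t ->
    is_derive t 1 (fun t => cdf_heat limit_variance h x0 j t y)
    (limit_variance / 2 * cdf_heat limit_variance h x0 j.+2 t y).
  by move=> t0; apply: cdf_heat_time.
exact: (@heat_family_limit (cdf_heat limit_variance h x0) M
  (fun j t y _ _ => dy j t y) (fun j t y _ t0 => dt j t y t0) HM).
Qed.

Lemma inv_std_sqr (V x : R) : 0 < x -> inv_std V (x ^+ 2) 0 = x^-1.
Proof.
move=> x0; rewrite /inv_std mulr0 addr0 lnXn//.
have -> : - (1 / 2) * (ln x *+ 2) = - ln x by rewrite mulr2n; field.
by rewrite expRN lnK.
Qed.

(** The indicator of y <= a lies, up to the tails beyond K, between normal distribution functions of
    variance h centred at a - d and a + d. With h = (d / K)^2 their limits merge as d tends to 0. *)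
Lemma scaled_mean_cdf (a : R) : 0 < limit_variance ->
  tends (scaled_mean (fun y => (y <= a)%R%:R))
    (std_cdf (a * expR (- (1 / 2) * ln limit_variance))).
Proof.
move=> V0 e e0; have heat := scaled_mean_cdf_heat.
move: limit_variance V0 heat => V V0 heat.
have e40 : 0 < e / 4 by lra.
have [K K0 [KP KN]] : exists2 K : R, 0 < K &
    1 - std_cdf K <= e / 4 /\ std_cdf (- K) <= e / 4.
  have [A [_ HA]] := (@cvgrPdist_le _ _ _ _ _ _ _).1 (@std_cdf_cvgy R) (e / 4) e40.
  have [A' [_ HA']] := (@cvgrPdist_le _ _ _ _ _ _ _).1 (@std_cdf_cvgNy R) (e / 4) e40.
  exists (Num.max 1 (Num.max (A + 1) (1 - A'))); first by rewrite lt_max ltr01.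
  set K := Num.max 1 _.
  have KA : A + 1 <= K by rewrite /K !le_max lexx !orbT.
  have KA' : 1 - A' <= K by rewrite /K !le_max lexx !orbT.
  split.
    have /HA : A < K by lra.
    by rewrite ler_norml => /andP[].
  have /HA' : - K < A' by lra.
  by rewrite sub0r normrN ler_norml => /andP[].
(* The limit std_cdf ((a + d) / sqrt (h + V)) as a function of d, in a shape whose
   differentiability, hence continuity, at 0 follows from the chain rule. *)
pose g (d : R) := std_cdf ((1 * d + a) * expR (- (1 / 2) * ln (K ^- 2 * (d * d) + V) + 0)).
have gpos : 0 < K ^- 2 * (0 * 0) + V by rewrite mulr0 mulr0 add0r.
have dg : exists l : R, is_derive (0 : R) 1 g l.
  have d1 := is_deriveM_pt (is_derive_id (0 : R) (1 : R)) (is_derive_id (0 : R) (1 : R)).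
  have d2 := is_derive_comp_pt d1 (is_derive_affine (K ^- 2) V _).
  have d3 := is_derive_comp_pt d2 (is_derive1_ln gpos).
  have d4 := is_derive_comp_pt d3 (is_derive_affine (- (1 / 2)) 0 _).
  have d5 := is_derive_comp_pt d4 (is_derive_expR _).
  have d6 := is_deriveM_pt (is_derive_affine 1 a 0) d5.
  by eexists; exact: (is_derive_comp_pt d6 (is_derive_std_cdf _)).
have g0 : g 0 = std_cdf (a * expR (- (1 / 2) * ln V)).
  by rewrite /g !mulr0 !add0r addr0.
have [d d0 [gd gNd]] : exists2 d : R, 0 < d &
    `|g 0 - g d| <= e / 4 /\ `|g 0 - g (- d)| <= e / 4.
  have [l /is_derive_continuous cg] := dg.
  have [r /= r0 Hr] := (@cvgrPdist_le _ _ _ _ _ _ _).1 cg (e / 4) e40.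
  exists (r / 2); first by rewrite divr_gt0.
  by split; apply: Hr; rewrite /ball_/= ?opprK ?sub0r ?normrN ?add0r gtr0_norm; lra.
have dK0 : 0 < d / K by rewrite divr_gt0.
have [h [h0 inv0 hE]] : exists h : R,
    [/\ 0 < h, inv_std V h 0 * d = K & h = K ^- 2 * d ^+ 2].
  exists ((d / K) ^+ 2); split; first exact: exprn_gt0.
    by rewrite (inv_std_sqr _ dK0) invf_div divfK// gt_eqF.
  by rewrite exprMn exprVn mulrC.
have i0 : 0 < inv_std V h 0 by exact: expR_gt0.
have lim (c : R) : c ^+ 2 = d ^+ 2 -> cdf_heat V h (a + c) 0 1 0 = g c.
  move=> cd; rewrite /cdf_heat expr0 mul1r subr0 /= /g /inv_std mulr1 mul1r addr0.
  have -> : h + V = K ^- 2 * (c * c) + V.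
    by rewrite -expr2 cd hE.
  by congr std_cdf; ring.
clearbody g; clear dg gpos.
have [s1 H1] := heat h (a + d) h0 _ e40.
have [s2 H2] := heat h (a - d) h0 _ e40.
exists (Num.max s1 s2) => s; rewrite ge_max => /andP[/H1 h1 /H2 h2].
rewrite lim// in h1; rewrite lim ?sqrrN// in h2.
have up : scaled_mean (fun y => (y <= a)%R%:R) s <=
    scaled_mean (cdf_heat V h (a + d) 0 0) s + (1 - std_cdf K).
  rewrite -[X in _ + X](scaled_mean_cst _ s) -scaled_meanD.
  apply: scaled_mean_le => y; rewrite /cdf_heat expr0 mul1r /=.
  have c0 := std_cdf_ge0 (inv_std V h 0 * (a + d - y)); have c1 := std_cdf_le1 K.
  have [ya|ya] /= := leP y a; last lra.
  have : std_cdf K <= std_cdf (inv_std V h 0 * (a + d - y)).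
    by apply: std_cdf_homo; rewrite -inv0 ler_pM2l//; lra.
  lra.
have low : scaled_mean (cdf_heat V h (a - d) 0 0) s + (- std_cdf (- K)) <=
    scaled_mean (fun y => (y <= a)%R%:R) s.
  rewrite -[X in _ + X](scaled_mean_cst _ s) -scaled_meanD.
  apply: scaled_mean_le => y; rewrite /cdf_heat expr0 mul1r /=.
  have c1 := std_cdf_le1 (inv_std V h 0 * (a - d - y)); have c0 := std_cdf_ge0 (- K).
  have [ya|ya] /= := leP y a; first lra.
  have : std_cdf (inv_std V h 0 * (a - d - y)) <= std_cdf (- K).
    by apply: std_cdf_homo; rewrite -inv0 -mulrN ler_pM2l//; lra.
  lra.
rewrite -g0; move: h1 h2 gd gNd; rewrite !ler_norml.
move=> /andP[p1 p2] /andP[q1 q2] /andP[r1 r2] /andP[t1 t2]; apply/andP; split; lra.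
Qed.

(** * Factorizations as walks *)

Fixpoint factor_lists (k : nat) (z : R) : seq factors :=
  if k is k'.+1 then
    [seq (p :: t : factors) | p <- [seq p <- iota 0 (cutoff z) | p \in P],
                              t <- factor_lists k' (z - step p)]
  else if 0 <= z then [:: [::]] else [::].

Lemma factor_listsS k z : factor_lists k.+1 z =
  [seq (p :: t : factors) | p <- [seq p <- iota 0 (cutoff z) | p \in P],
                            t <- factor_lists k (z - step p)].
Proof. by []. Qed.

(** Both sides obey the same recursion, because e^(rho [step p]) [weight p] = 1 for p in [P]. *)
Lemma size_factor_lists k z :
  (size (factor_lists k z))%:R = expR (rho * z) * walk k z.
Proof.
elim: k z => [|k IH] z.
  rewrite /=; case: ifP => _; last by rewrite mulr0.
  by rewrite -expRD mulNr subrr expR0.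
rewrite factor_listsS size_allpairs_dep sumnE big_map natr_sum big_filter.
rewrite (walkS k (leqnn _)) mulr_sumr /index_iota subn0 [RHS](bigID (fun p => p \in P)).
rewrite [X in _ = _ + X]big1 ?addr0; last first.
  by move=> p /negbTE Pp; rewrite /weight Pp mul0r mulr0.
apply: eq_bigr => p Pp; rewrite IH /weight Pp mulrA -expRD.
by congr (expR _ * _); ring.
Qed.

Lemma mem_factor_lists k z (t : factors) : (t \in factor_lists k z) =
  [&& size t == k, all (fun p => p \in P) t & (\prod_(m <- t) m)%N%:R <= expR z].
Proof.
elim: k z t => [|k IH] z t.
  rewrite /=; case: ifPn => z0.
    rewrite inE; case: t => [|p t]//=.
    by rewrite big_nil -expR0 ler_expR z0.
  by case: t => [|p t]//=; rewrite big_nil -expR0 ler_expR (negbTE z0).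
rewrite factor_listsS; apply/allpairsPdep/idP => [[p [t' [pP t'F ->]]]|].
  move: pP; rewrite mem_filter => /andP[Pp _].
  move: t'F; rewrite IH => /and3P[/eqP <- aP prodt].
  rewrite /= eqxx Pp aP/= big_cons natrM.
  have p0 : (0 : R) < p%:R.
    by rewrite ltr0n; apply: leq_trans (P_ge2 (set_mem Pp)).
  rewrite mulrC -ler_pdivlMr//.
  by move: prodt; rewrite expRD expRN /step lnK// posrE.
case: t => [//|p t] /and3P[/eqP[st] /andP[Pp aP] prodt].
have {}aP : all (fun p => p \in P) t := aP.
have p0 : (0 : R) < p%:R.
  by rewrite ltr0n; apply: leq_trans (P_ge2 (set_mem Pp)).
have pr : (\prod_(m <- t) m)%N%:R <= expR (z - step p).
  rewrite expRD expRN /step lnK ?posrE// ler_pdivlMr// mulrC -natrM.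
  by move: prodt; rewrite big_cons.
exists p, t; split => //; last by rewrite IH st eqxx aP.
rewrite mem_filter Pp mem_iota add0n leq0n !andTb.
(* A first factor beyond the cutoff would leave z - [step p] < 0, whereas the other factors have
   product at least 1. *)
rewrite ltnNge; apply/negP => /step_gt zp.
have : (1 : R) <= (\prod_(m <- t) m)%N%:R.
  rewrite ler1n big_seq prodn_cond_gt0// => m mt.
  by move/allP: aP => /(_ _ mt) /set_mem/P_ge2 /ltnW.
move=> /le_trans/(_ pr); rewrite -expR0 ler_expR; lra.
Qed.

Lemma uniq_factor_lists k z : uniq (factor_lists k z).
Proof.
elim: k z => [|k IH] z; first by rewrite /=; case: ifP.
apply: allpairs_uniq_dep => [|p _|[p t] [q u] _ _ [-> ->]]//.
by rewrite filter_uniq// iota_uniq.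
Qed.

Definition all_factor_lists (z : R) : seq factors :=
  [seq t | k <- iota 0 (cutoff z), t <- factor_lists k z].

Lemma uniq_all_factor_lists z : uniq (all_factor_lists z).
Proof.
apply: allpairs_uniq_dep => [|k _|x y]; first exact: iota_uniq.
  exact: uniq_factor_lists.
move=> /allpairsPdep[k [t [_ tF ->]]] /allpairsPdep[j [u [_ uF ->]]] tu.
move: tF uF; rewrite !mem_factor_lists => /and3P[/eqP <- _ _] /and3P[/eqP <- _ _].
by move: tu => /= ->.
Qed.

Lemma mem_all_factor_lists z (t : factors) : (t \in all_factor_lists z) =
  all (fun p => p \in P) t && ((\prod_(m <- t) m)%N%:R <= expR z).
Proof.
apply/allpairsPdep/idP => [[k [t' [_ + ->]]]|].
  by rewrite mem_factor_lists => /and3P[_ -> ->].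
move=> /andP[aP pr]; exists (size t), t; split => //; last first.
  by rewrite mem_factor_lists eqxx aP.
rewrite mem_iota add0n leq0n andTb ltnNge; apply/negP => zt.
have two (u : seq nat) : all (fun p => p \in P) u ->
    (2 ^ size u <= \prod_(m <- u) m)%N.
  elim: u => [|p u IH] /=; first by rewrite big_nil.
  move=> /andP[Pp /IH h]; rewrite big_cons expnS leq_mul//.
  exact: P_ge2 (set_mem Pp).
have := two t aP; rewrite -(ler_nat R) => /le_trans/(_ pr).
apply/negP; rewrite -ltNge; apply: lt_le_trans (cutoff_gt z) _.
by rewrite ler_nat (leq_trans zt)// ltnW// ltn_expl.
Qed.

Lemma sum_all_factor_lists (f : nat -> R) z :
  \sum_(t <- all_factor_lists z) f (size t) = expR (rho * z) * walk_sum f z.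
Proof.
rewrite /all_factor_lists big_allpairs_dep /walk_sum mulr_sumr /index_iota subn0.
apply: eq_bigr => k _; rewrite mulrCA -size_factor_lists.
rewrite (eq_big_seq (fun=> f k)); last first.
  by move=> t; rewrite mem_factor_lists => /and3P[/eqP ->].
by rewrite big_const_seq count_predT iter_addr_0 mulr_natr.
Qed.

Lemma factorizations_uptoE N : (0 < N)%N ->
  factorizations_upto P N = [set` all_factor_lists (ln N%:R)].
Proof.
move=> N0; have N0' : (0 : R) < N%:R by rewrite ltr0n.
apply/seteqP; split => t /=.
  move=> [n /= /andP[n1 nN] [tP tn]]; rewrite mem_all_factor_lists lnK ?posrE//.
  rewrite tn ler_nat nN andbT; apply/allP => m mt; exact/mem_set/tP.
rewrite mem_all_factor_lists lnK ?posrE// ler_nat => /andP[/allP aP prN].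
exists (\prod_(m <- t) m)%N => /=; last first.
  by split => // m mt; apply/set_mem/aP.
rewrite prN andbT big_seq prodn_cond_gt0// => m mt.
by have /set_mem/P_ge2/ltnW := aP m mt.
Qed.

Lemma counting_seq (L : seq factors) (S : set factors) : uniq L ->
  counting (S `&` [set` L]) = ((\sum_(t <- L) \1_S t : R)%:E)%E :> \bar R.
Proof.
move=> uL; have -> : S `&` [set` L] = [set` [fset t in [seq t <- L | t \in S]]%fset].
  apply/seteqP; split => t /=; rewrite !inE/= mem_filter.
    by move=> [St tL]; rewrite mem_set.
  by move=> /andP[/set_mem].
rewrite /counting asboolT//.
rewrite set_fsetK card_fseq undup_id ?filter_uniq// size_filter.
congr EFin; rewrite -sum1_count natr_sum big_mkcond/=; apply: eq_bigr => t _.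
by rewrite indicE; case: ifP.
Qed.

(** * The law of the number of factors *)

Section uniform.
Variable N : nat.
Hypothesis N_gt0 : (0 < N)%N.
Let L := all_factor_lists (ln N%:R).
Let z : R := ln N%:R.

Let z_ge0 : 0 <= z.
Proof. by rewrite ln_ge0// ler1n. Qed.

Let size_L : (size L)%:R = expR (rho * z) * walk_mass z.
Proof.
rewrite -(sum_all_factor_lists (fun=> 1)) big_const_seq count_predT iter_addr_0.
by [].
Qed.

Let mass_gt0 : 0 < walk_mass z.
Proof. by have [c c0 cw] := walk_mass_ge; apply: lt_le_trans (cw _ z_ge0). Qed.

Lemma uniform_factorizationE (S : set factors) :
  uniform_factorization R P N S =
  ((\sum_(t <- L) \1_S t) / (size L)%:R)%:E.
Proof.
have e (S' : set factors) :
    mrestr counting (measurable_factorizations_upto P N) S' =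
    ((\sum_(t <- L) \1_S' t : R)%:E)%E.
  by rewrite /mrestr factorizations_uptoE// counting_seq// uniq_all_factor_lists.
have eT : \sum_(t <- L) \1_[set: factors] t = (size L)%:R :> R.
  under eq_bigr do rewrite indicT.
  by rewrite big_const_seq count_predT iter_addr_0.
rewrite /uniform_factorization /= /mnormalize /=.
rewrite (_ : mrestr _ _ [set: factors] = (size L)%:R%:E); last by rewrite -eT; exact: e.
rewrite eqe gt_eqF/=; first exact: (congr1 (fun x => x * _)%E (e S)).
by rewrite size_L mulr_gt0 ?expR_gt0.
Qed.

Lemma uniform_factorization_size (f : nat -> bool) (S : set factors) :
  (forall t, S t <-> f (size t)) ->
  uniform_factorization R P N S = (walk_sum (fun k => (f k)%:R) z / walk_mass z)%:E.
Proof.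
move=> Sf; rewrite uniform_factorizationE; congr EFin.
have -> : \sum_(t <- L) \1_S t = \sum_(t <- L) (f (size t))%:R :> R.
  apply: eq_bigr => t _; rewrite indicE; congr (nat_of_bool _)%:R.
  by apply/idP/idP => [/set_mem/Sf|/Sf/mem_set].
rewrite (sum_all_factor_lists (fun k => (f k)%:R)) size_L -/z; field.
by rewrite gt_eqF ?mass_gt0//= gt_eqF ?expR_gt0.
Qed.

Lemma integral_uniform_factorization (f : nat -> R) : (forall k, 0 <= f k) ->
  (\int[uniform_factorization R P N]_t (f (size t))%:E)%E =
  (walk_sum f z / walk_mass z)%:E.
Proof.
move=> f0.
pose n := size L.
(* The uniform law is written as a multiple of a sum of Dirac masses, against which the integral is
   a finite sum. *)
pose m_ (i : nat) : {measure set factors -> \bar R} := dirac (nth ([::] : factors) L i).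
have n0 : 0 <= (n%:R : R)^-1 by rewrite invr_ge0.
pose mu := mscale (NngNum n0) (msum m_ n).
rewrite (@eq_measure_integral _ _ _ setT mu); last first.
  move=> S _ _; apply: (eq_trans (uniform_factorizationE S)).
  rewrite /mu /mscale/= /msum/=.
  rewrite mulrC EFinM; congr (_ * _)%E.
  rewrite (big_nth ([::] : factors)) big_mkord -sumEFin; apply: eq_bigr => i _.
  by [].
rewrite ge0_integral_mscale//; last by move=> t _; rewrite lee_fin.
rewrite ge0_integral_measure_sum//; last by move=> t _; rewrite lee_fin.
have -> : (\sum_(i < n) \int[m_ i]_t (f (size t))%:E)%E =
    (\sum_(t <- L) f (size t))%:E.
  rewrite (big_nth ([::] : factors)) big_mkord -sumEFin; apply: eq_bigr => i _.
  by rewrite /m_ integral_dirac//= diracT mul1e.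
rewrite /= sum_all_factor_lists -EFinM -/z; congr EFin.
rewrite /n size_L; field.
by rewrite gt_eqF ?mass_gt0//= gt_eqF ?expR_gt0.
Qed.

End uniform.

Lemma tends_nat (g : R -> R) (l : R) : tends g l ->
  forall e : R, 0 < e -> \forall N \near \oo, [/\ (1 < N)%N,
    Num.sqrt (ln N%:R) > 0 :> R, Num.sqrt (ln N%:R) ^+ 2 = ln N%:R :> R &
    `|g (Num.sqrt (ln N%:R)) - l| <= e].
Proof.
move=> gl e /gl[s0 H]; exists (maxn 2 (cutoff (s0 ^+ 2))) => // N /=.
rewrite geq_max => /andP[N2 /step_gt]; rewrite /step => h.
have l0 : (0 : R) < ln N%:R by rewrite ln_gt0// ltr1n.
split => //; first by rewrite sqrtr_gt0.
  by rewrite sqr_sqrtr// ltW.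
apply: H; apply: le_trans (ler_norm s0) _.
by rewrite -sqrtr_sqr ler_sqrt// ltW.
Qed.

Lemma tends_cvg (g : R -> R) (l : R) : tends g l ->
  g (Num.sqrt (ln N%:R)) @[N --> \oo] --> l.
Proof.
move=> gl; apply/cvgrPdist_le => e e0.
by apply: filterS (tends_nat gl e0) => N [_ _ _]; rewrite distrC.
Qed.

Lemma walk_sum_id_scaled (s : R) : 0 < s ->
  walk_sum (fun k => k%:R) (s ^+ 2) / walk_mass (s ^+ 2) =
  s ^+ 2 / m1 + s * scaled_mean id s.
Proof.
move=> s0; have m10 := mean_step_gt0; have w0 := walk_mass_sqr_gt0 s.
rewrite (@eq_walk_sum _ (fun k => s ^+ 2 / m1 * 1 +
    s * ((k%:R - s ^+ 2 / m1) / s))); last first.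
  by move=> k; field; rewrite !gt_eqF.
rewrite walk_sumD !walk_sumZ -/(walk_mass (s ^+ 2)) /scaled_mean.
by field; rewrite !gt_eqF.
Qed.

Lemma walk_sum_sqr_scaled (s : R) : 0 < s ->
  walk_sum (fun k => (k%:R - (s ^+ 2 / m1 + s * scaled_mean id s)) ^+ 2) (s ^+ 2) /
    walk_mass (s ^+ 2) =
  s ^+ 2 * (scaled_mean (fun y => y ^+ 2) s - scaled_mean id s ^+ 2).
Proof.
move=> s0; have m10 := mean_step_gt0; have w0 := walk_mass_sqr_gt0 s.
set E1 := scaled_mean id s.
rewrite (@eq_walk_sum _ (fun k => s ^+ 2 * (((k%:R - s ^+ 2 / m1) / s) ^+ 2 +
    (- 2 * E1 * ((k%:R - s ^+ 2 / m1) / s) + E1 ^+ 2 * 1)))); last first.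
  by move=> k; field; rewrite !gt_eqF.
rewrite walk_sumZ walk_sumD walk_sumD !walk_sumZ -/(walk_mass (s ^+ 2)).
have -> : walk_sum (fun k => (k%:R - s ^+ 2 / m1) / s) (s ^+ 2) =
    E1 * walk_mass (s ^+ 2) by rewrite /E1 /scaled_mean divfK// gt_eqF.
rewrite /scaled_mean; clearbody E1.
by field; rewrite !gt_eqF.
Qed.

Lemma expectation_uniform_factorization N : (0 < N)%N ->
  ('E_(uniform_factorization R P N)[@nb_factors R])%E =
  (walk_sum (fun k => k%:R) (ln N%:R) / walk_mass (ln N%:R))%:E.
Proof.
move=> N0; rewrite unlock.
exact: (integral_uniform_factorization N0 (fun k => ler0n R k)).
Qed.

Lemma variance_uniform_factorization N (m : R) : (0 < N)%N ->
  ('E_(uniform_factorization R P N)[@nb_factors R])%E = m%:E ->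
  ('V_(uniform_factorization R P N)[@nb_factors R])%E =
  (walk_sum (fun k => (k%:R - m) ^+ 2) (ln N%:R) / walk_mass (ln N%:R))%:E.
Proof.
move=> N0 Em; rewrite /variance unlock Em /= unlock.
have sq (k : nat) : 0 <= (k%:R - m) ^+ 2 by exact: sqr_ge0.
exact: (integral_uniform_factorization N0 sq).
Qed.

Lemma sqrtr_expR_ln (x : R) : 0 < x -> Num.sqrt x = expR (1 / 2 * ln x).
Proof.
move=> x0; rewrite -[in LHS](lnK x0).
have -> : expR (ln x) = expR (1 / 2 * ln x) ^+ 2.
  by rewrite -expRM_natl; congr expR; field.
by rewrite sqrtr_sqr gtr0_norm// expR_gt0.
Qed.

Lemma uniform_factorization_clt : 0 < limit_variance ->
  cvg_in_distribution
    (fun N => standardized_nb_factors m1^-1 (Num.sqrt limit_variance) N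
              : {RV (uniform_factorization R P N) >-> R})
    (@normal_prob R 0 1).
Proof.
move=> V0 x _.
suff H : cdf (standardized_nb_factors m1^-1 (Num.sqrt limit_variance) N
    : {RV (uniform_factorization R P N) >-> R}) x @[N --> \oo] --> (std_cdf x)%:E.
  by move: H; rewrite -normal_probE.
have sV : 0 < Num.sqrt limit_variance by rewrite sqrtr_gt0.
have lim := tends_cvg (scaled_mean_cdf (x * Num.sqrt limit_variance) V0).
(* The threshold x sqrt V is multiplied by V^(-1/2) in the limit law, which leaves [std_cdf x]. *)
rewrite -mulrA {2}(sqrtr_expR_ln V0) -expRD in lim.
rewrite mulNr addrN expR0 mulr1 in lim.
have eq_cdf : \forall N \near \oo,
    cdf (standardized_nb_factors m1^-1 (Num.sqrt limit_variance) N
      : {RV (uniform_factorization R P N) >-> R}) x =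
    (scaled_mean (fun y => (y <= x * Num.sqrt limit_variance)%R%:R)
      (Num.sqrt (ln N%:R)))%:E.
  apply: filterS (tends_nat (scaled_mean_cdf 0 V0) ltr01) => N [N1 s0 s2 _].
  rewrite /cdf /distribution /pushforward.
  rewrite (@uniform_factorization_size N (ltnW N1) (fun k =>
    (k%:R - ln N%:R / m1) / Num.sqrt (ln N%:R) <= x * Num.sqrt limit_variance)).
    by rewrite /scaled_mean s2.
  move=> t; rewrite /= in_itv/= /standardized_nb_factors /nb_factors.
  rewrite [m1^-1 * _]mulrC ler_pdivrMr ?mulr_gt0// ler_pdivrMr//.
  by rewrite -mulrA.
apply/fine_cvgP; split; first by apply: filterS eq_cdf => N ->.
apply: cvg_trans lim; apply: near_eq_cvg.
by apply: filterS eq_cdf => N /= ->.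
Qed.

Lemma uniform_factorization_mean :
  (fun N : nat => fine 'E_(uniform_factorization R P N)[@nb_factors R])
    ~_\oo (fun N : nat => m1^-1 * ln N%:R).
Proof.
have m10 := mean_step_gt0; have i0 := invm1_gt0.
apply/eqaddoP => e e0.
have TT : tends (fun s => scaled_mean id s / s) 0.
  move=> d d0; have [s0 H] := scaled_mean_id d0.
  exists (Num.max 1 s0) => s; rewrite ge_max => /andP[s1 /H].
  rewrite !subr0 (normrM (scaled_mean id s)) normfV => h.
  rewrite ler_pdivrMr ?normr_gt0 ?gt_eqF//; last lra.
  apply: le_trans h _; rewrite ler_peMr ?(ltW d0)//.
  by apply: le_trans s1 (ler_norm _).
have ei : 0 < e * m1^-1 by rewrite mulr_gt0.
apply: filterS (tends_nat TT ei) => N [N1 s0 s2 h].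
rewrite -[X in `|X|]/(fine ('E_(uniform_factorization R P N)[@nb_factors R])%E -
  m1^-1 * ln N%:R).
rewrite expectation_uniform_factorization ?(ltnW N1)//= -s2.
rewrite walk_sum_id_scaled//; set s := Num.sqrt _ in s0 s2 h *.
rewrite subr0 in h.
have -> : s ^+ 2 / m1 + s * scaled_mean id s - m1^-1 * s ^+ 2 =
  s ^+ 2 * (scaled_mean id s / s) by field; rewrite !gt_eqF.
rewrite (normrM (s ^+ 2)) (normrM m1^-1) (gtr0_norm i0).
rewrite (ger0_norm (sqr_ge0 s)) mulrA mulrC.
by rewrite ler_wpM2r// sqr_ge0.
Qed.

Lemma uniform_factorization_variance : 0 < limit_variance ->
  (fun N : nat => fine 'V_(uniform_factorization R P N)[@nb_factors R])
    ~_\oo (fun N : nat => limit_variance * ln N%:R).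
Proof.
move=> V0; apply/eqaddoP => e e0.
have TT : tends (fun s => scaled_mean (fun y => y ^+ 2) s - scaled_mean id s ^+ 2)
    limit_variance.
  move=> d d0; have d20 : 0 < d / 2 by rewrite divr_gt0.
  have m0 : 0 < Num.min 1 (d / 2) by rewrite lt_min ltr01.
  have [s0 H] := scaled_mean_id m0; have [s1 H1] := scaled_mean_sqr d20.
  exists (Num.max s0 s1) => s; rewrite ge_max => /andP[/H h /H1 h1].
  rewrite subr0 le_min in h; move: h => /andP[ha hb].
  have hc : scaled_mean id s ^+ 2 <= d / 2.
    rewrite -real_normK ?num_real// expr2 -[leRHS]mul1r.
    by apply: ler_pM.
  have hd := sqr_ge0 (scaled_mean id s).
  by move: h1; rewrite !ler_norml => /andP[p q]; apply/andP; split; lra.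
have eV : 0 < e * limit_variance by rewrite mulr_gt0.
apply: filterS (tends_nat TT eV) => N [N1 s0 s2 h].
have EE := expectation_uniform_factorization (ltnW N1).
rewrite -[X in `|X|]/(fine ('V_(uniform_factorization R P N)[@nb_factors R])%E -
  limit_variance * ln N%:R).
rewrite (variance_uniform_factorization (ltnW N1) EE)/= -s2.
rewrite walk_sum_id_scaled// walk_sum_sqr_scaled//; set s := Num.sqrt _ in s0 s2 h *.
rewrite [limit_variance * _]mulrC -mulrBr (normrM (s ^+ 2)).
rewrite (normrM (s ^+ 2) limit_variance) (gtr0_norm V0).
rewrite (ger0_norm (sqr_ge0 s)) mulrCA ler_wpM2l// ?sqr_ge0//.
Qed.

End renewal.

Lemma is_derive_quadratic (R : realType) (f : R -> R) (x l C r : R) : 0 < r -> 0 <= C ->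
  (forall h : R, `|h| <= r -> `|f (x + h) - f x - h * l| <= C * h ^+ 2) ->
  is_derive x 1 f l.
Proof.
move=> r0 C0 Hf.
have lim : h^-1 *: (f (h *: 1 + x) - f x) @[h --> 0^'] --> l.
  apply/cvgrPdist_le => e e0; near=> h.
  have hr : `|h| <= r by near: h; exact: dnbhs0_le.
  have h0 : h != 0 by near: h; exact: nbhs_dnbhs_neq.
  have he : `|h| <= e / (C + 1).
    by near: h; apply: dnbhs0_le; rewrite divr_gt0// ltr_wpDl.
  have nh : 0 < `|h| by rewrite normr_gt0.
  have -> : l - h^-1 *: (f (h *: 1 + x) - f x) =
      - (h^-1 * (f (x + h) - f x - h * l)).
    by rewrite -[h *: 1]/(h * 1) mulr1 [h + x]addrC -[_ *: _]/(_ * _); field.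
  rewrite normrN (normrM h^-1) normfV mulrC ler_pdivrMr//.
  apply: le_trans (Hf _ hr) _.
  rewrite -(real_normK (num_real h)) expr2 mulrA ler_pM2r//.
  move: he; rewrite ler_pdivlMr ?ltr_wpDl// => he.
  apply: le_trans he; rewrite mulrC ler_pM2l// lerDl//.
apply: DeriveDef; last exact: cvg_lim lim.
by apply/cvg_ex; exists l.
Unshelve. all: by end_near. Qed.

(** * Dirichlet series and moments of the steps *)

Section dirichlet_moments.
Context {R : realType} (P : set nat).
Hypothesis P_ge2 : P `<=` [set n | (2 <= n)%N].
Implicit Types (s t r m : R).

Lemma dirichletE s : dirichlet P s = (\sum_(0 <= n <oo) (weight P s n)%:E)%E.
Proof.
have -> : dirichlet P s = \esum_(n in [set: nat]) (weight P s n)%:E.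
  rewrite /dirichlet esum_mkcond; apply: eq_esum => n _.
  rewrite /weight; case: ifPn => // /set_mem Pn.
  by rewrite /powR pnatr_eq0 gtn_eqF// (leq_trans _ (P_ge2 Pn)).
by rewrite nneseries_esumT// => n; rewrite lee_fin weight_ge0.
Qed.

Lemma has_mean1_dirichlet s m : has_mean P s (fun=> 1) m -> dirichlet P s = m%:E.
Proof.
move=> hm; rewrite dirichletE; apply/cvg_lim => //.
rewrite (_ : (fun n => _) = EFin \o (fun B => \sum_(0 <= p < B) weight P s p * 1)).
  by apply: cvg_EFin; [exact: nearW|exact: hm].
apply/funext => B /=; rewrite -sumEFin; apply: eq_bigr => p _.
by rewrite mulr1.
Qed.

Lemma bounded_has_mean1 s (M : R) : (forall B, \sum_(0 <= p < B) weight P s p <= M) ->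
  exists m, has_mean P s (fun=> 1) m.
Proof.
move=> bd; suff : cvgn (fun B => \sum_(0 <= p < B) weight P s p * 1).
  by move=> /cvg_ex[m hm]; exists m.
apply: nondecreasing_is_cvgn.
  move=> a b ab; rewrite (big_cat_nat (leq0n _) ab)//= lerDl sumr_ge0// => p _.
  by rewrite mulr1 weight_ge0.
by exists M => _ [B _ <-]; under eq_bigr do rewrite mulr1.
Qed.

Lemma dirichlet_has_mean1 s : (dirichlet P s < +oo)%E ->
  exists m, has_mean P s (fun=> 1) m.
Proof.
move=> fin.
have d0 : (0 <= dirichlet P s)%E.
  by rewrite dirichletE; apply: nneseries_ge0 => n _ _; rewrite lee_fin weight_ge0.
apply: (@bounded_has_mean1 _ (fine (dirichlet P s))) => B.
rewrite -lee_fin fineK; last by rewrite ge0_fin_numE.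
rewrite dirichletE -sumEFin.
by apply: nneseries_lim_ge => n _; rewrite lee_fin weight_ge0.
Qed.

(** Exponential tilting: exponential moments of the steps at s are values of the Dirichlet series at
    shifted exponents. *)
Lemma has_mean_shift s t (phi : nat -> R) m :
  has_mean P s (fun p => expR ((s - t) * step R p) * phi p) m = has_mean P t phi m.
Proof.
rewrite /has_mean; set u := (X in X @ _); set v := (X in _ = (X @ _ --> _)).
suff -> : u = v by [].
apply/funext => B; apply: eq_bigr => p _; rewrite mulrA; congr (_ * _).
rewrite /weight; case: ifP => _; last by rewrite mul0r.
by rewrite -expRD; congr expR; ring.
Qed.

Lemma has_mean_ge0 s (phi : nat -> R) m : (forall p, P p -> 0 <= phi p) ->
  has_mean P s phi m -> 0 <= m.
Proof.
by move=> phi0 /(sum_le_has_mean 0 phi0); rewrite big_geq.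
Qed.

(** Factors are at least 2, so the series decays at least like 2^(- t). This gives uniqueness of the
    growth exponent and a point where the series is at most 1. *)
Lemma has_mean1_le s t m : s <= t -> has_mean P s (fun=> 1) m ->
  exists2 m', has_mean P t (fun=> 1) m' & m' <= expR (- (t - s) * ln 2) * m.
Proof.
move=> st hm.
have le1 p : P p -> expR ((s - t) * step R p) <= expR (- (t - s) * ln 2).
  move=> /(@step_ge R _ P_ge2) h; rewrite ler_expR opprB ler_wnM2l//; lra.
have hm2 := @has_meanZ R P _ (expR (- (t - s) * ln 2)) _ _ hm.
have [|m' hm'] := @has_mean_dom R P s (fun p => expR ((s - t) * step R p) * 1) _ _ hm2.
  by move=> p Pp; rewrite !mulr1 ger0_norm ?expR_ge0// le1.
exists m'; first by rewrite -(has_mean_shift s).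
apply: has_mean_le hm' hm2 _ => p Pp.
by rewrite !mulr1 le1.
Qed.

Lemma has_mean_moment s r m j : 0 < r -> has_mean P (s - r) (fun=> 1) m ->
  exists m', has_mean P s (fun p => step R p ^+ j) m'.
Proof.
move=> r0; rewrite -(has_mean_shift s) => hm.
have hm2 := @has_meanZ R P _ ((1 + j.+1%:R * 1 / r) ^+ j.+1) _ _ hm.
have [|m' hm'] := @has_mean_dom R P s (fun p => step R p ^+ j) _ _ hm2; last by exists m'.
move=> p Pp; have s0 := step_gt0 R P_ge2 Pp.
rewrite ger0_norm ?exprn_ge0 ?(ltW s0)//.
have := @pow_le_expR R j.+1 1 r (step R p) ler01 r0 (ltW s0) isT.
have -> : (s - (s - r)) = r by ring.
rewrite mul1r => b; rewrite (mulr1 (expR _)); apply: le_trans b.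
have : (1 + step R p) ^+ j <= (1 + step R p) ^+ j.+1.
  by rewrite exprS ler_peMl ?exprn_ge0//; lra.
apply: le_trans; apply: lerXn2r; rewrite ?nnegrE//; lra.
Qed.

Lemma has_mean_norm_le s (phi psi : nat -> R) m m' : has_mean P s phi m ->
  has_mean P s psi m' -> (forall p, P p -> `|phi p| <= psi p) -> `|m| <= m'.
Proof.
move=> hm hm' le; rewrite ler_norml; apply/andP; split.
  apply: has_mean_le (has_meanN hm') hm _ => p /le.
  by rewrite ler_norml => /andP[].
by apply: has_mean_le hm hm' _ => p /le; rewrite ler_norml => /andP[].
Qed.

(** Differentiation under the sum with a quadratic remainder. Of the margin r, one third absorbs the
    polynomial factor and one third the shift h; the rest is spare. *)
Lemma moment_is_derive j (f : R -> R) s r m l : 0 < r ->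
  has_mean P (s - r) (fun=> 1) m ->
  (forall t, `|t - s| <= r / 3 -> has_mean P t (fun p => step R p ^+ j) (f t)) ->
  has_mean P s (fun p => step R p ^+ j.+1) l ->
  is_derive s 1 f (- l).
Proof.
move=> r0; rewrite -(has_mean_shift s) => hm hf hl.
have r30 : 0 < r / 3 by rewrite divr_gt0.
have hm2 := @has_meanZ R P _ ((1 + j.+2%:R * 1 / (r / 3)) ^+ j.+2) _ _ hm.
set C := _ ^+ _ in hm2.
have C0 : 0 <= C by apply: exprn_ge0; rewrite addr_ge0// divr_ge0 ?(ltW r30)// mulr1.
have m0 : 0 <= m by apply: has_mean_ge0 hm => p _; rewrite mulr1 expR_ge0.
apply: (@is_derive_quadratic _ _ _ _ (C * m) (r / 3) r30); first exact: mulr_ge0.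
move=> h hr.
have hfh : has_mean P (s + h) (fun p => step R p ^+ j) (f (s + h)).
  by apply: hf; rewrite addrC addKr.
rewrite -(has_mean_shift s) in hfh.
have hfs : has_mean P s (fun p => step R p ^+ j) (f s).
  by apply: hf; rewrite subrr normr0 ltW.
have := has_meanB (has_meanB hfh hfs) (@has_meanZ R P _ (- h) _ _ hl).
rewrite mulNr -mulrN => hd.
rewrite [leRHS]mulrC; apply: has_mean_norm_le hd (@has_meanZ R P _ (h ^+ 2) _ _ hm2) _ => p Pp.
have x0 := step_gt0 R P_ge2 Pp; set x := step R p in x0 *.
have -> : expR ((s - (s + h)) * x) * x ^+ j - x ^+ j - - h * x ^+ j.+1 =
   x ^+ j * (expR (- h * x) - 1 - (- h * x)).
  have -> : (s - (s + h)) * x = - h * x by ring.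
  by rewrite exprS; ring.
have xj0 : 0 <= x ^+ j by rewrite exprn_ge0// ltW.
rewrite (normrM (x ^+ j)) (ger0_norm xj0).
have n1 : `|- h * x| <= r / 3 * x.
  by rewrite (normrM (- h)) normrN (gtr0_norm x0) ler_pM2r.
have e1 : `|expR (- h * x) - 1 - (- h * x)| <= (- h * x) ^+ 2 * expR (r / 3 * x).
  have a1 := expR_ge1Dx (- h * x).
  have a2 := expR_sub1Dx_ge0_le (- h * x).
  have a3 : (- h * x) ^+ 2 * expR `|- h * x| <= (- h * x) ^+ 2 * expR (r / 3 * x).
    by rewrite ler_wpM2l ?sqr_ge0// ler_expR.
  rewrite ger0_norm; last by rewrite -addrA -opprD subr_ge0.
  rewrite -addrA -opprD lerBlDl; apply: le_trans a2 _.
  by rewrite lerD2l.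
apply: le_trans (ler_wpM2l xj0 e1) _.
have -> : x ^+ j * ((- h * x) ^+ 2 * expR (r / 3 * x)) =
  h ^+ 2 * (x ^+ j.+2 * expR (r / 3 * x)) by rewrite !exprS; ring.
rewrite ler_wpM2l ?sqr_ge0//.
have b := @pow_le_expR R j.+2 1 (r / 3) x ler01 r30 (ltW x0) isT.
have b2 : x ^+ j.+2 <= C * expR (r / 3 * x).
  apply: le_trans b; rewrite mul1r; apply: lerXn2r; rewrite ?nnegrE//; lra.
apply: le_trans (ler_wpM2r (expR_ge0 _) b2) _.
rewrite (mulr1 (expR _)) -(mulrA C); apply: ler_wpM2l => //.
rewrite -expRD ler_expR.
have := mulr_gt0 r0 x0.
have -> : (s - (s - r)) * x = r * x by ring.
lra.
Qed.

Lemma dirichlet_fun_is_derive s r m l : 0 < r -> has_mean P (s - r) (fun=> 1) m ->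
  has_mean P s (@step R) l -> is_derive s 1 (dirichlet_fun P : R -> R) (- l).
Proof.
move=> r0 hm hl; apply: (@moment_is_derive 0 _ s r m l) => //.
move=> t; rewrite ler_norml => /andP[t1 t2].
have [|m' hm' _] := @has_mean1_le (s - r) t m _ hm; first lra.
by rewrite /dirichlet_fun (has_mean1_dirichlet hm').
Qed.

Lemma dirichlet_fun_derive2 s r m l : 0 < r -> has_mean P (s - r) (fun=> 1) m ->
  has_mean P s (fun p => step R p ^+ 2) l -> (dirichlet_fun P)^`(2)%classic s = l.
Proof.
move=> r0 hm hl; rewrite derive1nS derive1n1.
(* Near s, minus the first derivative is the first moment. Exponents t within r / 3 of s still have
   a margin r / 3 to the right of s - r. *)
have D : is_derive s 1 (fun t => - (dirichlet_fun P)^`()%classic t) (- l).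
  apply: (@moment_is_derive 1 _ s r m l) => //.
  move=> t; rewrite ler_norml => /andP[t1 t2].
  have [|m' hm' _] := @has_mean1_le (s - r) (t - r / 3) m _ hm; first lra.
  have r30 : 0 < r / 3 by rewrite divr_gt0.
  have [l' hl'] := has_mean_moment 1 r30 hm'.
  have D := dirichlet_fun_is_derive r30 hm' hl'.
  by rewrite derive1E (@derive_val _ _ _ _ _ _ _ D) opprK.
have := is_deriveN D; rewrite opprK derive1E => D2.
by rewrite (@derive_val _ _ _ _ _ _ _ D2) opprK.
Qed.

Lemma above_abscissa s : (abscissa P < s%:E)%E ->
  exists r m, 0 < r /\ has_mean P (s - r) (fun=> 1) m.
Proof.
move=> /ereal_inf_lt[_ [t /= tf <-]]; rewrite lte_fin => ts.
have [m hm] := dirichlet_has_mean1 tf.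
by exists (s - t), m; rewrite subr_gt0 ts subKr.
Qed.

(** For s <= 0 every term is at least 1. This forces the growth exponent to be positive. *)
Lemma two_le_dirichlet s m p q : P p -> P q -> p <> q -> s <= 0 ->
  has_mean P s (fun=> 1) m -> 2 <= m.
Proof.
move=> Pp Pq /eqP pq s0 hm.
have w1 n : P n -> 1 <= weight P s n.
  move=> Pn; rewrite /weight mem_set// -expR0 ler_expR mulr_ge0 ?oppr_ge0//.
  by rewrite ltW// (step_gt0 R P_ge2 Pn).
have := @sum_le_has_mean R P s (fun=> 1) m (maxn p q).+1 (fun _ _ => ler01) hm.
apply: le_trans; rewrite big_mkord.
have lp : (p < (maxn p q).+1)%N by rewrite ltnS leq_maxl.
have lq : (q < (maxn p q).+1)%N by rewrite ltnS leq_maxr.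
rewrite (bigD1 (Ordinal lp))//= (bigD1 (Ordinal lq))/=; last first.
  by rewrite -val_eqE/= eq_sym.
have : 0 <= \sum_(i < (maxn p q).+1 | (i != Ordinal lp) && (i != Ordinal lq))
    weight P s i * 1.
  by apply: sumr_ge0 => i _; rewrite mulr1 weight_ge0.
have := w1 p Pp; have := w1 q Pq; lra.
Qed.

(** Rules out the abscissa +oo; the terms telescope through 1 / (n + 2)^2 <= 1 / (n + 1) - 1 / (n +
    2). *)
Lemma dirichlet2_fin : (dirichlet P (2 : R) < +oo)%E.
Proof.
suff [m hm] : exists m, has_mean P 2 (fun=> 1) m by rewrite (has_mean1_dirichlet hm) ltry.
apply: (@bounded_has_mean1 2 1) => B.
have w0 p : (p < 2)%N -> weight P (2 : R) p = 0.
  move=> p2; rewrite /weight; case: ifPn => // /set_mem /P_ge2 /=.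
  by rewrite leqNgt p2.
have H n : \sum_(0 <= p < n.+2) weight P (2 : R) p <= 1 - n.+1%:R^-1.
  elim: n => [|n IH].
    by rewrite !big_nat_recr//= big_nil !w0// invr1 subrr !addr0.
  rewrite big_nat_recr//=.
  have a0 : (0 : R) < n.+1%:R by rewrite ltr0n.
  have h : weight P (2 : R) n.+2 <= n.+1%:R^-1 - n.+2%:R^-1.
    have -> : (n.+1%:R^-1 - n.+2%:R^-1 : R) = (n.+1%:R * n.+2%:R)^-1.
      by rewrite -[n.+2%:R]natr1; field; rewrite !gt_eqF// ltr_wpDr.
    rewrite /weight; case: ifPn => _; last by rewrite invr_ge0 mulr_ge0.
    rewrite mulNr expRN expRM_natl.
    rewrite /step lnK ?posrE ?ltr0n// lef_pV2 ?posrE ?exprn_gt0 ?mulr_gt0 ?ltr0n//.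
    by rewrite expr2 ler_pM2r ?ltr0n// ler_nat.
  by apply: le_trans (lerD IH h) _; rewrite addrA subrK.
have mono : \sum_(0 <= p < B) weight P (2 : R) p <= \sum_(0 <= p < B.+2) weight P (2 : R) p.
  rewrite [leRHS](big_cat_nat (leq0n B)) //=; last by rewrite leqW.
  by rewrite lerDl sumr_ge0// => p _; rewrite weight_ge0.
apply: le_trans mono _; apply: le_trans (H B) _.
by rewrite gerBl invr_ge0.
Qed.

Lemma dirichlet_nonincreasing s t : s <= t -> (dirichlet P t <= dirichlet P s)%E.
Proof.
move=> st; have [->|fin] := eqVneq (dirichlet P s) +oo%E; first exact: leey.
have [m hm] : exists m, has_mean P s (fun=> 1) m.
  by apply: dirichlet_has_mean1; rewrite ltey.
have [m' hm' le] := has_mean1_le st hm.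
rewrite (has_mean1_dirichlet hm) (has_mean1_dirichlet hm') lee_fin.
apply: le_trans le _; rewrite -[leRHS]mul1r ler_wpM2r//.
  exact: has_mean_ge0 hm.
rewrite -[leRHS](@expR0 R) ler_expR mulNr oppr_le0 mulr_ge0 ?subr_ge0//.
by rewrite ltW// ln2_gt0.
Qed.

(** * Existence and uniqueness of the growth exponent *)

Section growth_exponent.
Variables p q : nat.
Hypotheses (Pp : P p) (Pq : P q) (pq : p <> q).

(** By monotonicity the limit at a finite abscissa is a supremum, so some value exceeds 1; for the
    abscissa -oo the value at 0 is already at least 2. *)
Lemma above_abscissa_gt1 : (1 < @dirichlet_at_abscissa R P)%E ->
  exists s : R, (abscissa P < s%:E)%E /\ (1 < dirichlet P s)%E.
Proof.
rewrite /dirichlet_at_abscissa; case E : (abscissa P) => [k| |].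
- have kl : (BRight k < +oo)%O by [].
  have ni : {in Interval (BRight k) +oo%O &,
      nonincreasing_fun (dirichlet P : R -> \bar R)}.
    by move=> x y _ _; exact: dirichlet_nonincreasing.
  have /cvg_lim -> // := nonincreasing_at_right_cvge _ kl ni.
  move=> /ereal_sup_gt[_ [s /= sk <-] h]; exists s; split => //.
  by move: sk; rewrite in_itv/= andbT lte_fin.
- suff : (abscissa P <= (2 : R)%:E)%E by rewrite E.
  by apply: ereal_inf_lbound; exists 2 => //; exact: dirichlet2_fin.
- move=> _; exists 0; rewrite ltNyr; split => //.
  have [|r [m [r0 hm]]] := @above_abscissa 0; first by rewrite E ltNyr.
  have [|m' hm' _] := @has_mean1_le (0 - r) 0 m _ hm; first by rewrite sub0r oppr_le0 ltW.
  rewrite (has_mean1_dirichlet hm') lte_fin.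
  by apply: lt_le_trans (two_le_dirichlet Pp Pq pq (lexx 0) hm'); rewrite ltr1n.
Qed.

Lemma growth_exponent_exists : (1 < @dirichlet_at_abscissa R P)%E ->
  exists rho : R, is_growth_exponent P rho.
Proof.
move=> /above_abscissa_gt1[a [absa gt1]].
have [r [m [r0 hm]]] := above_abscissa absa.
have fin t : a <= t -> has_mean P t (fun=> 1) (dirichlet_fun P t).
  move=> at_; have [|m' hm' _] := @has_mean1_le (a - r) t m _ hm; first lra.
  by rewrite /dirichlet_fun (has_mean1_dirichlet hm').
have cont t : a <= t -> {for t, continuous (dirichlet_fun P : R -> R)}.
  move=> at_; have [|m' hm' _] := @has_mean1_le (a - r) (t - r) m _ hm; first lra.
  have [l hl] := has_mean_moment 1 r0 hm'.
  exact: is_derive_continuous (dirichlet_fun_is_derive r0 hm' hl).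
set fa := dirichlet_fun P a.
have fa1 : 1 < fa.
  by move: gt1; rewrite (has_mean1_dirichlet (fin a (lexx a))) lte_fin.
have l20 := ln2_gt0 R.
(* The value at b is at most 2^(- (b - a)) fa = fa e^(- fa) <= 1. *)
pose b := a + fa / ln 2.
have ab : a <= b by rewrite lerDl divr_ge0 ?(ltW l20)//; lra.
have [m' hb leb] := has_mean1_le ab (fin a (lexx a)).
have fb1 : dirichlet_fun P b <= 1.
  rewrite (has_mean_unique (fin b ab) hb); apply: le_trans leb _.
  have -> : - (b - a) * ln 2 = - fa by rewrite /b; field; rewrite gt_eqF.
  rewrite expRN mulrC ler_pdivrMr ?expR_gt0// mul1r.
  by apply: le_trans (expR_ge1Dx fa); rewrite -/fa lerDr.
have cab : {within `[a, b], continuous (dirichlet_fun P : R -> R)}.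
  apply: continuous_in_subspaceT => t; rewrite inE/= in_itv/= => /andP[ta _].
  exact: cont.
have [|c] := @IVT R (dirichlet_fun P) a b 1 ab cab.
  by rewrite ge_min fb1 orbT le_max (ltW fa1).
rewrite in_itv/= => /andP[ac _] fc; exists c.
have hc := fin c ac; rewrite fc in hc.
split; last exact: has_mean1_dirichlet hc.
rewrite gt_max (lt_le_trans absa) ?lee_fin//= lte_fin ltNge.
apply/negP => c0; have := two_le_dirichlet Pp Pq pq c0 hc.
by rewrite leNgt ltr1n.
Qed.

Lemma growth_exponent_le (rho rho' : R) :
  is_growth_exponent P rho -> is_growth_exponent P rho' -> rho' <= rho.
Proof.
move=> [_ d1] [_ d1']; rewrite leNgt; apply/negP => lt.
have [m hm] : exists m, has_mean P rho (fun=> 1) m.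
  by apply: dirichlet_has_mean1; rewrite d1 ltry.
have [m' hm' le] := has_mean1_le (ltW lt) hm.
have := d1; rewrite (has_mean1_dirichlet hm) => -[m1].
have := d1'; rewrite (has_mean1_dirichlet hm') => -[m1'].
move: le; rewrite m1 m1' mulr1 -[leLHS](@expR0 R) ler_expR leNgt mulNr oppr_lt0.
by rewrite mulr_gt0 ?subr_gt0// ln2_gt0.
Qed.

End growth_exponent.

End dirichlet_moments.

(** * Positivity of the variance and proof of the theorem *)

Lemma card_ge2P (P : set nat) : (`I_2 #<= P)%card ->
  exists p q, [/\ P p, P q & p <> q].
Proof.
move=> /pcard_leP/unsquash f; exists (f 0%N), (f 1%N); split.
- exact: (@funS _ _ _ _ f).
- exact: (@funS _ _ _ _ f).
- by move=> /(@inj _ _ _ f) /=; rewrite !inE/= => /(_ isT isT).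
Qed.

(** With zero variance the drift vanishes on [P], so all steps equal m1, which two distinct elements
    contradict. *)
Lemma limit_variance_gt0 (R : realType) (P : set nat) (rho m1 m2 : R) (p q : nat) :
  P `<=` [set n | (2 <= n)%N] -> 0 < m1 ->
  has_mean P rho (fun n => drift m1 n ^+ 2) (limit_variance m1 m2 * m1) ->
  P p -> P q -> p <> q -> 0 < limit_variance m1 m2.
Proof.
move=> P_ge2 m10 hm Pp Pq pq.
rewrite -(pmulr_lgt0 _ m10) ltNge; apply/negP => V0.
have step0 n : P n -> step R n = m1.
  move=> Pn; have := @sum_le_has_mean R P rho _ _ n.+1 (fun p _ => sqr_ge0 (drift m1 p)) hm.
  rewrite big_nat_recr//= => le0.
  have s0 : 0 <= \sum_(0 <= i < n) weight P rho i * drift m1 i ^+ 2.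
    by apply: sumr_ge0 => i _; rewrite mulr_ge0 ?weight_ge0 ?sqr_ge0.
  have : weight P rho n * drift m1 n ^+ 2 <= 0 by lra.
  rewrite pmulr_rle0 ?weight_gt0// => d0.
  have /eqP : drift m1 n ^+ 2 = 0 by apply/eqP; rewrite eq_le d0 sqr_ge0.
  rewrite sqrf_eq0 /drift subr_eq0 eq_sym => /eqP d1.
  by rewrite -[LHS](divfK (lt0r_neq0 m10)) d1 mul1r.
apply: pq; have := step0 p Pp; rewrite -(step0 q Pq) /step.
have pos n : P n -> (n%:R : R) \is Num.pos.
  by move=> /P_ge2/= n2; rewrite posrE ltr0n (leq_trans _ n2).
by move=> /ln_inj => /(_ (pos _ Pp) (pos _ Pq)) /eqP; rewrite eqr_nat => /eqP.
Qed.

(** A quarter of the room on the left of [rho]: the steps then have exponential moments up to order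
    4 theta. *)
Lemma growth_exponent_moments (R : realType) (P : set nat) (rho : R) :
  P `<=` [set n | (2 <= n)%N] -> is_growth_exponent P rho ->
  exists theta m : R, [/\ 0 < theta, 4 * theta <= rho &
    has_mean P (rho - 4 * theta) (fun=> 1) m].
Proof.
move=> P_ge2 [+ _]; rewrite gt_max => /andP[absr]; rewrite lte_fin => rho0.
have [r [m [r0 hm]]] := above_abscissa P_ge2 absr.
exists (Num.min r rho / 4).
have -> : 4 * (Num.min r rho / 4) = Num.min r rho by field.
have [|m' hm' _] := @has_mean1_le R P P_ge2 (rho - r) (rho - Num.min r rho) m _ hm.
  by rewrite lerD2l lerN2 ge_min lexx.
exists m'; split => //; last by rewrite ge_min lexx orbT.
by rewrite divr_gt0// lt_min r0.
Qed.

Theorem theorem1 (R : realType) (P : set nat)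
    (P_ge2 : P `<=` [set n | (2 <= n)%N])
    (card_P : (`I_2 #<= P)%card)
    (P_abscissa : (1 < @dirichlet_at_abscissa R P)%E) :
  (exists! rho : R, is_growth_exponent P rho) /\
  forall rho : R, is_growth_exponent P rho ->
    let mu := mean_coef P rho in
    let sigma2 := variance_coef P rho in
    let Pr := uniform_factorization R P in
    [/\ cvg_in_distribution
          (fun N => standardized_nb_factors mu (Num.sqrt sigma2) N
                    : {RV (Pr N) >-> R})
          (@normal_prob R 0 1),
        (fun N : nat => fine 'E_(Pr N)[@nb_factors R])
          ~_\oo (fun N : nat => mu * ln N%:R)
      & (fun N : nat => fine 'V_(Pr N)[@nb_factors R])
          ~_\oo (fun N : nat => sigma2 * ln N%:R)].
Proof.
have [p [q [Pp Pq pq]]] := card_ge2P card_P.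
split.
  have [rho grho] := growth_exponent_exists P_ge2 Pp Pq pq P_abscissa.
  exists rho; split => // rho' grho'; apply/eqP; rewrite eq_le.
  by rewrite !(growth_exponent_le P_ge2).
move=> rho grho mu sigma2 Pr.
have [theta [m [theta0 theta4 hm]]] := growth_exponent_moments P_ge2 grho.
have t40 : 0 < 4 * theta by rewrite mulr_gt0.
have theta_le : theta <= rho by lra.
have [m1 mean_step'] := has_mean_moment P_ge2 1 t40 hm.
have mean_step : has_mean P rho (@step R) m1 := mean_step'.
have [m2 mean_step2] := has_mean_moment P_ge2 2 t40 hm.
have mean_1 : has_mean P rho (fun=> 1) 1.
  have [_ d1] := grho; have [|m0 hm0] := @dirichlet_has_mean1 R P P_ge2 rho.
    by rewrite d1 ltry.
  by have := d1; rewrite (has_mean1_dirichlet P_ge2 hm0) => -[m01]; rewrite m01 in hm0.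
(* By tilting, this mean is the value of the series at rho - c, which converges since rho - c >= rho
   - 4 theta. *)
have mean_expR (c : R) : c <= 4 * theta ->
    exists l, has_mean P rho (fun n => expR (c * step R n)) l.
  move=> c4.
  have [|l hl _] := @has_mean1_le R P P_ge2 (rho - 4 * theta) (rho - c) m _ hm.
    by rewrite lerD2l lerN2.
  exists l; move: hl; rewrite -(has_mean_shift P rho).
  by apply: eq_has_mean => n _; rewrite mulr1 subKr.
have [|l1 mean_expR1] := mean_expR theta; first lra.
have [|l2 mean_expR2] := mean_expR (2 * theta); first lra.
have [|l4 mean_expR4] := mean_expR (4 * theta); first lra.
have m10 : 0 < m1 by apply: mean_step_gt0 mean_step.
have muE : mu = m1^-1.
  rewrite /mu /mean_coef derive1E.
  have D := dirichlet_fun_is_derive P_ge2 t40 hm mean_step.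
  by rewrite (@derive_val _ _ _ _ _ _ _ D) invrN opprK.
have sigma2E : sigma2 = limit_variance m1 m2.
  rewrite /sigma2 /variance_coef -/mu muE (dirichlet_fun_derive2 P_ge2 t40 hm mean_step2).
  by rewrite /limit_variance; field; rewrite gt_eqF.
have V0 : 0 < limit_variance m1 m2.
  apply: (limit_variance_gt0 P_ge2 m10 _ Pp Pq pq).
  by apply: mean_drift2; eassumption.
rewrite muE sigma2E; split.
- exact: (uniform_factorization_clt P_ge2 theta0 theta_le mean_1 mean_step
    mean_expR1 mean_expR2 theta4 mean_step2 V0).
- exact: (uniform_factorization_mean P_ge2 theta0 theta_le mean_1 mean_step
    mean_expR1 mean_expR2 theta4 mean_expR4 mean_step2).
- exact: (uniform_factorization_variance P_ge2 theta0 theta_le mean_1 mean_step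
    mean_expR1 mean_expR2 theta4 mean_expR4 mean_step2 V0).
Qed.
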